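(* Let $\mathcal{B}=\{\beta_1,\beta_2,\ldots,\beta_n\}\subseteq\Phi$ be a companion basis for an exchange matrix $B$ in a cluster algebra of finite type $\Delta$, with associated root system $\Phi$, and let $W$ be the reflection group of $\Phi$. Then there is an isomorphism between $W$ and $W_{\Gamma(B)}$ taking $s_{\beta_i}$ to $s_i$ for all $i$. In particular, the defining relations for $W_{\Gamma(B)}$ can be regarded as giving a presentation of $W$ in terms of the generators $s_{\beta_1},s_{\beta_2},\ldots,s_{\beta_n}$.
   Context: Cluster algebras. Let $\mathbb{F}=\mathbb{Q}(u_1,\dots,u_n)$. An $n\times n$ integer matrix $B$ is skew-symmetrisable if $DB$ is skew-symmetric for some diagonal matrix $D$ with positive diagonal entries. Consider pairs $(\mathbf{x},B)$ with $\mathbf{x}=\{x_1,\dots,x_n\}$ a free generating set of $\mathbb{F}$ and $B$ an $n\times n$ skew-symmetrisable matrix. For $k\in[1,n]$ the mutation $\mu_k(\mathbf{x},B)=(\mathbf{x}',B')$ is given by $B'_{ij}=-B_{ij}$ if $i=k$ or $j=k$, and $B'_{ij}=B_{ij}+\frac{|B_{ik}|B_{kj}+B_{ik}|B_{kj}|}{2}$ otherwise; $\mathbf{x}'$ is obtained from $\mathbf{x}$ by replacing $x_k$ with $x_k'$ where $x_k'x_k=\prod_{B_{ik}>0}x_i^{B_{ik}}+\prod_{B_{ik}<0}x_i^{-B_{ik}}$. Fix an initial seed; the seeds are all pairs obtained from it by sequences of mutations (identified up to simultaneous relabelling by permutations of $[1,n]$), and the matrices $B$ in seeds are the exchange matrices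 of the cluster algebra (the $\mathbb{Q}$-subalgebra of $\mathbb{F}$ generated by all elements $x_i$ appearing in seeds). It is of finite type if it has finitely many seeds. The Cartan counterpart of $B$ has entries $2$ on the diagonal and $-|B_{ij}|$ off the diagonal. A cluster algebra of finite type has type $\Delta$ ($\Delta$ a Dynkin diagram) if it contains a seed whose matrix has Cartan counterpart equal to the Cartan matrix of $\Delta$ (up to simultaneous permutation of rows and columns). Diagrams. The diagram $\Gamma(B)$ of $B$ is the weighted oriented graph with vertices $[1,n]$ and an arrow from $i$ to $j$ if and only if $B_{ij}>0$, with weight $|B_{ij}B_{ji}|$. In finite type all weights are at most $3$. A chordless cycle in $\Gamma=\Gamma(B)$ is an induced subgraph of the underlying unoriented graph that is a cycle; in finite type these are always cyclically oriented in $\Gamma$, and either have all weights $1$, or are $3$-cycles with weights $1,2,2$, or $4$-cycles with weights $1,2,1,2$ in cyclic order (Fomin-Zelevinsky). The group $W_\Gamma$. For vertices $i\neq j$ of $\Gamma$, let $m_{ij}=2$ if $i,j$ are not joined by an edge, and $m_{ij}=3,4,6$ if they are joined by an edge of weight $1,2,3$ respectively. $W_\Gamma$ is the group with generators $s_1,\dots,s_n$ subject to: (R1) $s_i^2=e$ for all $i$; (R2) $(s_is_j)^{m_{ij}}=e$ for all $i\neq j$; (R3) for each chordless cycle $C$: $i_0\to i_1\to\cdots\to i_{d-1}\to i_0$ in $\Gamma$, putting (subscripts modulo $d$) $r(i_a,i_{a+1})=s_{i_a}s_{i_{a+1}}\cdots s_{i_{a+d-1}}s_{i_{a+d-2}}\cdots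 s_{i_{a+1}}$: (a) if all weights in $C$ are $1$, then $r(i_a,i_{a+1})^2=e$ for $a=0,\dots,d-1$; (b) if $C$ has some edges of weight $2$, then $r(i_a,i_{a+1})^{4-w_a}=e$ for $a=0,\dots,d-1$, where $w_a$ is the weight of the edge between $i_{a-1}$ and $i_a$. Companion bases. Let $\Phi$ be the root system of rank $n$ of type $\Delta$, where the Cartan matrix of $\Delta$ has entries $(\alpha_i,\alpha_j^\vee)$ for simple roots $\alpha_i$. For $\beta\in\Phi$, $s_\beta$ is the corresponding reflection and $\beta^\vee$ the coroot. A companion basis for an exchange matrix $B$ of the cluster algebra of type $\Delta$ is a subset $\{\beta_1,\dots,\beta_n\}$ of $\Phi$ which is a $\mathbb{Z}$-basis of $\mathbb{Z}\Phi$ such that the matrix $A$ with $A_{ij}=(\beta_i,\beta_j^\vee)$ is a quasi-Cartan companion of $B$, i.e. $A$ is symmetrisable with diagonal entries $2$ and $|A_{ij}|=|B_{ij}|$ for all $i\neq j$. *)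

(* Defs.v *)
From HB Require Import structures.
From mathcomp Require Import all_boot all_order perm all_algebra.
From mathcomp Require Import boolp.
From mathcomp Require Import mpoly.

Set Implicit Arguments.
Unset Strict Implicit.
Unset Printing Implicit Defensive.

Import Order.TTheory GRing.Theory Num.Theory.

Local Open Scope ring_scope.
Local Open Scope quotient_scope.

(** * Groups given by generators and relations *)

(* A letter (i, false) stands for the generator x_i and (i, true) for its
   inverse. *)
Definition word (n : nat) : Type := seq ('I_n * bool).

Definition wgen n (i : 'I_n) : word n := [:: (i, false)].

Definition wgens n (s : seq 'I_n) : word n := [seq (i, false) | i <- s].

Definition wpow n (w : word n) (m : nat) : word n := flatten (nseq m w).

Definition linv n (l : 'I_n * bool) : 'I_n * bool := (l.1, ~~ l.2).

Definition winv n (w : word n) : word n := rev (map (@linv n) w).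

(* Equality of words modulo the normal closure of the relators. *)
Inductive pres_eq n (rel : word n -> Prop) : word n -> word n -> Prop :=
| PresRefl u : pres_eq rel u u
| PresSym u v : pres_eq rel u v -> pres_eq rel v u
| PresTrans v u w : pres_eq rel u v -> pres_eq rel v w -> pres_eq rel u w
| PresCat u u' v v' :
    pres_eq rel u u' -> pres_eq rel v v' -> pres_eq rel (u ++ v) (u' ++ v')
| PresInv l : pres_eq rel [:: l; linv l] [::]
| PresRel r : rel r -> pres_eq rel r [::].

Section Presented.
Variables (n : nat) (rel : word n -> Prop).

Definition pres_eqb (u v : word n) : bool := `[< pres_eq rel u v >].

Fact pres_eqb_refl : reflexive pres_eqb.
Proof. by move=> u; apply/asboolP; apply: PresRefl. Qed.

Fact pres_eqb_sym : ssrbool.symmetric pres_eqb.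
Proof. by move=> u v; apply/asboolP/asboolP; apply: PresSym. Qed.

Fact pres_eqb_trans : transitive pres_eqb.
Proof.
by move=> v u w /asboolP uv /asboolP vw; apply/asboolP; apply: PresTrans vw.
Qed.

Canonical pres_equiv :=
  EquivRel pres_eqb pres_eqb_refl pres_eqb_sym pres_eqb_trans.

Definition presented : Type := {eq_quot pres_equiv}.

HB.instance Definition _ := Choice.on presented.
HB.instance Definition _ := EqQuotient.on presented.

Definition pmul (x y : presented) : presented := \pi_presented (repr x ++ repr y).
Definition pinv (x : presented) : presented := \pi_presented (winv (repr x)).
Definition pone : presented := \pi_presented [::].

Lemma pi_eqP (u v : word n) :
  \pi_presented u = \pi_presented v <-> pres_eq rel u v.
Proof. by split=> [/eqmodP/asboolP|h]; last apply/eqmodP/asboolP. Qed.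

Lemma pres_repr u : pres_eq rel (repr (\pi_presented u)) u.
Proof. by apply/pi_eqP; rewrite reprK. Qed.

Lemma pmulE u v : pmul (\pi_presented u) (\pi_presented v) = \pi_presented (u ++ v).
Proof. by apply/pi_eqP; apply: PresCat; apply: pres_repr. Qed.

Lemma linvK : involutive (@linv n).
Proof. by case=> i b; rewrite /linv /= negbK. Qed.

Lemma pres_mulwV u : pres_eq rel (u ++ winv u) [::].
Proof.
elim: u => [|l u IH]; first exact: PresRefl.
rewrite /winv /= rev_cons -cats1 -/(winv u).
have -> : l :: u ++ winv u ++ [:: linv l]
        = [:: l] ++ ((u ++ winv u) ++ [:: linv l]) by rewrite -catA.
apply: (PresTrans (v := [:: l] ++ ([::] ++ [:: linv l]))); last exact: PresInv.
by apply: PresCat (PresRefl _ _) (PresCat IH (PresRefl _ _)).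
Qed.

Lemma winvK : involutive (@winv n).
Proof.
move=> u; rewrite /winv map_rev revK -map_comp -[RHS]map_id.
by apply: eq_map => l /=; rewrite linvK.
Qed.

Lemma pres_mulVw u : pres_eq rel (winv u ++ u) [::].
Proof. by rewrite -{2}(winvK u); apply: pres_mulwV. Qed.

Fact pmulA : associative pmul.
Proof.
elim/quotW=> u; elim/quotW=> v; elim/quotW=> w.
by rewrite (pmulE v w) (pmulE u v) !pmulE catA.
Qed.

Fact pmul1 : left_id pone pmul.
Proof. by elim/quotW=> u; rewrite pmulE. Qed.

Fact pmulr1 : right_id pone pmul.
Proof. by elim/quotW=> u; rewrite pmulE cats0. Qed.

Fact pmulV : left_inverse pone pinv pmul.
Proof.
move=> x; rewrite -[X in pmul _ X](reprK x) pmulE.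
by apply/pi_eqP; apply: pres_mulVw.
Qed.

Fact pmulrV : right_inverse pone pinv pmul.
Proof.
move=> x; rewrite -[X in pmul X _](reprK x) pmulE.
by apply/pi_eqP; apply: pres_mulwV.
Qed.

HB.instance Definition _ :=
  isGroup.Build presented pmulA pmul1 pmulr1 pmulV pmulrV.

Definition pgen (i : 'I_n) : presented := \pi_presented (wgen i).

End Presented.

Definition weval (G : groupType) n (g : 'I_n -> G) (w : word n) : G :=
  (\prod_(l <- w) (if l.2 then (g l.1)^-1 else g l.1))%g.

(* < x_1, .., x_n | rel > is a presentation of G with x_i interpreted as g i:
   the g i generate G, and the kernel of the evaluation map from the free group
   is the normal closure of the relators. *)
Definition has_presentation (G : groupType) n (g : 'I_n -> G)
    (rel : word n -> Prop) : Prop :=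
  (forall x : G, exists w : word n, weval g w = x) /\
  (forall w : word n, weval g w = 1%g <-> pres_eq rel w [::]).

(** * Matrices *)

Definition symmetrisable (F : realFieldType) n (A : 'M[F]_n) : Prop :=
  exists2 d : 'rV[F]_n, (forall i, 0 < d 0 i) &
    (diag_mx d *m A)^T = diag_mx d *m A.

Definition skew_symmetrisable n (B : 'M[int]_n) : Prop :=
  exists2 d : 'rV[rat]_n, (forall i, 0 < d 0 i) &
    let DB := diag_mx d *m map_mx intr B in DB^T = - DB.

Definition cartan_counterpart n (B : 'M[int]_n) : 'M[int]_n :=
  \matrix_(i, j) (if i == j then 2 else - `|B i j|).

(* The division by 2 is exact. *)
Definition mutate_mx n (k : 'I_n) (B : 'M[int]_n) : 'M[int]_n :=
  \matrix_(i, j)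
    (if (i == k) || (j == k) then - B i j
     else B i j + ((`|B i k| * B k j + B i k * `|B k j|) %/ 2)%Z).

(** * Seeds and cluster algebras *)

Definition ratfun (n : nat) : fieldType := {fraction {mpoly rat[n]}}.

Definition peval n (x : 'I_n -> ratfun n) (p : {mpoly rat[n]}) : ratfun n :=
  mmap (fun c : rat => tofrac (c%:MP_[n])) x p.

(* x_1, .., x_n are algebraically independent over Q and generate the field. *)
Definition free_generating n (x : 'I_n -> ratfun n) : Prop :=
  (forall p : {mpoly rat[n]}, peval x p = 0 -> p = 0) /\
  (forall f : ratfun n, exists p q : {mpoly rat[n]},
     peval x q != 0 /\ f = peval x p / peval x q).

(* Labelled pairs (x, B); the identification up to relabelling is made
   explicit by [relabel]. *)
Definition seed (n : nat) := ({ffun 'I_n -> ratfun n} * 'M[int]_n)%type.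

Definition valid_seed n (S : seed n) : Prop :=
  free_generating S.1 /\ skew_symmetrisable S.2.

Definition exchange_var n (k : 'I_n) (S : seed n) : ratfun n :=
  (\prod_(i < n | 0 < S.2 i k) S.1 i ^+ `|S.2 i k|%N
   + \prod_(i < n | S.2 i k < 0) S.1 i ^+ `|S.2 i k|%N) / S.1 k.

Definition mutate n (k : 'I_n) (S : seed n) : seed n :=
  ([ffun i => if i == k then exchange_var k S else S.1 i], mutate_mx k S.2).

Definition relabel n (s : 'S_n) (S : seed n) : seed n :=
  ([ffun i => S.1 (s i)], \matrix_(i, j) S.2 (s i) (s j)).

Inductive mutation_class n (S0 : seed n) : seed n -> Prop :=
| MutInit : mutation_class S0 S0
| MutStep S k : mutation_class S0 S -> mutation_class S0 (mutate k S).

(* The cluster algebra is given by its initial seed S0. *)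
Definition is_seed_of n (S0 S : seed n) : Prop :=
  exists2 T, mutation_class S0 T & exists s : 'S_n, S = relabel s T.

Definition exchange_matrix n (S0 : seed n) (B : 'M[int]_n) : Prop :=
  exists2 S, is_seed_of S0 S & B = S.2.

Definition finite_type n (S0 : seed n) : Prop :=
  exists ss : seq (seed n), forall S, is_seed_of S0 S ->
    exists2 T, T \in ss & exists s : 'S_n, S = relabel s T.

(* C is the Cartan matrix of the Dynkin diagram. *)
Definition of_finite_type n (S0 : seed n) (C : 'M[int]_n) : Prop :=
  finite_type S0 /\
  exists2 B, exchange_matrix S0 B &
    exists s : 'S_n, forall i j, cartan_counterpart B i j = C (s i) (s j).

(** * Diagrams and the group attached to a diagram *)

Record diagram (n : nat) := Diagram {
  arrow : rel 'I_n;
  weight : 'I_n -> 'I_n -> nat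
}.

Definition diagram_of n (B : 'M[int]_n) : diagram n :=
  {| arrow := fun i j => 0 < B i j;
     weight := fun i j => absz (B i j * B j i) |}.

Section DiagramGroup.
Variables (n : nat) (Gam : diagram n).

Definition joined (i j : 'I_n) : bool := arrow Gam i j || arrow Gam j i.

(* Weights above 3 do not occur in finite type; the value 0 then makes the
   relator empty. *)
Definition coxeter_exp (i j : 'I_n) : nat :=
  if ~~ joined i j then 2%N
  else match weight Gam i j with 1 => 3 | 2 => 4 | 3 => 6 | _ => 0 end%N.

(* c = i_0 -> i_1 -> .. -> i_(d-1) -> i_0; no vertices of c are joined except
   cyclically consecutive ones. *)
Definition chordless_cycle (c : seq 'I_n) : Prop :=
  [/\ (3 <= size c)%N, uniq c, cycle (arrow Gam) c &
      {in c &, forall i j, joined i j -> j = next c i \/ i = next c j}].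

(* The cyclic word s_(i_a) s_(i_(a+1)) .. s_(i_(a+d-1)) s_(i_(a+d-2)) ..
   s_(i_(a+1)), where i = i_a is a vertex of the cycle c of length d and
   i_(a+t) is the t-th iterate of [next c] at i. *)
Definition cycle_word (c : seq 'I_n) (i : 'I_n) : word n :=
  let d := size c in
  wgens [seq iter t (next c) i | t <- iota 0 d ++ rev (iota 1 (d - 2))].

Inductive diagram_relator : word n -> Prop :=
| RelInvol i : diagram_relator (wpow (wgen i) 2)
| RelBraid i j : i != j ->
    diagram_relator (wpow (wgen i ++ wgen j) (coxeter_exp i j))
| RelCycle1 c i : chordless_cycle c ->
    {in c, forall j, weight Gam j (next c j) = 1%N} -> i \in c ->
    diagram_relator (wpow (cycle_word c i) 2)
| RelCycle2 c i : chordless_cycle c ->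
    (exists2 j, j \in c & weight Gam j (next c j) = 2%N) -> i \in c ->
    diagram_relator (wpow (cycle_word c i) (4 - weight Gam (prev c i) i)).

Definition diagram_group : groupType := presented diagram_relator.

End DiagramGroup.

(** * Root systems *)

(* The Euclidean space is 'cV[R]_n with inner product (u, v) = u^T G v. *)
Section Form.
Variables (R : realFieldType) (n : nat) (G : 'M[R]_n).
Implicit Types u v b : 'cV[R]_n.

Definition form u v : R := (u^T *m G *m v) 0 0.

Definition coroot b : 'cV[R]_n := (2 / form b b) *: b.

Definition cpair u b : R := form u (coroot b).

(* The matrix of v |-> v - (v, b^vee) b; see [reflmxE]. *)
Definition reflmx b : 'M[R]_n := 1%:M - b *m ((coroot b)^T *m G).

Lemma formC u v : G^T = G -> form u v = form v u.
Proof.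
move=> GT; rewrite /form.
transitivity ((u^T *m G *m v)^T 0 0); first by rewrite [RHS]mxE.
by rewrite !trmx_mul trmxK GT mulmxA.
Qed.

Lemma reflmxE b v : G^T = G -> reflmx b *m v = v - cpair v b *: b.
Proof.
move=> GT; rewrite /reflmx mulmxBl mul1mx; congr (_ - _).
rewrite -mulmxA [X in b *m X]mx11_scalar mul_mx_scalar.
by rewrite /cpair formC.
Qed.

Lemma cpairbb b : form b b != 0 -> cpair b b = 2.
Proof.
by move=> b0; rewrite /cpair /form /coroot -scalemxAr mxE -/(form b b) divfK.
Qed.

Lemma reflmxK b : G^T = G -> form b b != 0 -> reflmx b *m reflmx b = 1%:M.
Proof.
move=> GT b0; rewrite {1}/reflmx mulmxBl mul1mx -mulmxA.
set f := _ *m G.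
have fb : f *m b = 2%:M.
  by rewrite [LHS]mx11_scalar -[_ 0 0]/(form (coroot b) b) formC // -/(cpair b b) cpairbb.
rewrite {2}/reflmx -/f mulmxBr mulmx1 (mulmxA f) fb mul_scalar_mx.
rewrite /reflmx -/f scaler_nat mulr2n opprD addrA subrr sub0r mulmxN opprK.
by rewrite subrK.
Qed.

End Form.

(* Reduced crystallographic root systems of rank n. *)
Record root_system (R : realFieldType) (n : nat) := RootSystem {
  gram : 'M[R]_n;
  roots : seq 'cV[R]_n;
  gram_sym : gram^T = gram;
  gram_pos : forall v : 'cV[R]_n, v != 0 -> 0 < form gram v v;
  roots_span : (<<roots>> = fullv)%VS;
  roots_neq0 : 0 \notin roots;
  roots_refl : {in roots &, forall a b, reflmx gram a *m b \in roots};
  roots_int : {in roots &, forall a b,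
    exists z : int, cpair gram b a = z%:~R};
  roots_reduced : {in roots, forall a (c : R),
    c *: a \in roots -> c = 1 \/ c = -1}
}.

Section RootSystem.
Variables (R : realFieldType) (n : nat) (Phi : root_system R n).

Definition root_of : Type := seq_sub (roots Phi).

Definition is_base (alpha : 'I_n -> root_of) : Prop :=
  basis_of fullv [tuple val (alpha i) | i < n] /\
  forall b : root_of, exists2 z : 'I_n -> int,
    (forall i, 0 <= z i) \/ (forall i, z i <= 0) &
    val b = \sum_i val (alpha i) *~ z i.

Definition has_cartan_matrix (C : 'M[int]_n) : Prop :=
  exists2 alpha : 'I_n -> root_of, is_base alpha &
    forall i j, cpair (gram Phi) (val (alpha i)) (val (alpha j)) = (C i j)%:~R.

(* The reflection group as the group of matrices generated by the reflections
   in the roots; these are involutions, so no inverses are needed. *)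
Definition in_reflection_group (M : 'M[R]_n) : Prop :=
  exists s : seq root_of, M = \prod_(b <- s) reflmx (gram Phi) (val b).

Definition reflection_group : Type :=
  {M : 'M[R]_n | `[< in_reflection_group M >]}.

HB.instance Definition _ := Choice.on reflection_group.
HB.instance Definition _ := SubType.on reflection_group.

Lemma root_form_neq0 (b : root_of) : form (gram Phi) (val b) (val b) != 0.
Proof.
apply: lt0r_neq0; apply: gram_pos.
by apply: contra (roots_neq0 Phi) => /eqP <-; exact: valP.
Qed.

Fact rg1_subproof : `[< in_reflection_group 1%:M >].
Proof. by apply/asboolP; exists [::]; rewrite big_nil. Qed.

Fact rgM_subproof (x y : reflection_group) :
  `[< in_reflection_group (val x *m val y) >].
Proof.
apply/asboolP; case/asboolP: (valP x) => s ->; case/asboolP: (valP y) => t ->.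
by exists (s ++ t); rewrite big_cat.
Qed.

Lemma rg_inv_ex (M : 'M[R]_n) : in_reflection_group M ->
  exists2 N, in_reflection_group N & M *m N = 1%:M.
Proof.
case=> s ->; elim: s => [|b s [N [t ->] IH]].
  by exists 1%:M; [exists [::]; rewrite big_nil | rewrite big_nil mulmx1].
exists ((\prod_(b <- t) reflmx (gram Phi) (val b)) *m reflmx (gram Phi) (val b)).
  by exists (rcons t b); rewrite -cats1 big_cat big_seq1.
rewrite big_cons -mulmxE -mulmxA (mulmxA (\prod_(_ <- s) _)) IH mul1mx.
by rewrite reflmxK ?gram_sym ?root_form_neq0.
Qed.

Fact rgV_subproof (x : reflection_group) :
  `[< in_reflection_group (invmx (val x)) >].
Proof.
apply/asboolP; case: (rg_inv_ex (asboolP _ (valP x))) => N WN xN.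
have [xU _] := mulmx1_unit xN.
by rewrite -[invmx _]mulmx1 -xN mulmxA mulVmx // mul1mx.
Qed.

Lemma rg_unit (x : reflection_group) : val x \in unitmx.
Proof.
by case: (rg_inv_ex (asboolP _ (valP x))) => N _ /mulmx1_unit[].
Qed.

Definition rg_one : reflection_group := Sub 1%:M rg1_subproof.
Definition rg_mul (x y : reflection_group) : reflection_group :=
  Sub (val x *m val y) (rgM_subproof x y).
Definition rg_inv (x : reflection_group) : reflection_group :=
  Sub (invmx (val x)) (rgV_subproof x).

Fact rg_mulA : associative rg_mul.
Proof. by move=> x y z; apply: val_inj; rewrite /= mulmxA. Qed.
Fact rg_mul1 : left_id rg_one rg_mul.
Proof. by move=> x; apply: val_inj; rewrite /= mul1mx. Qed.
Fact rg_mulr1 : right_id rg_one rg_mul.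
Proof. by move=> x; apply: val_inj; rewrite /= mulmx1. Qed.
Fact rg_mulV : left_inverse rg_one rg_inv rg_mul.
Proof. by move=> x; apply: val_inj; rewrite /= mulVmx ?rg_unit. Qed.
Fact rg_mulrV : right_inverse rg_one rg_inv rg_mul.
Proof. by move=> x; apply: val_inj; rewrite /= mulmxV ?rg_unit. Qed.

HB.instance Definition _ :=
  isGroup.Build reflection_group rg_mulA rg_mul1 rg_mulr1 rg_mulV rg_mulrV.

Fact refl_subproof (b : root_of) :
  `[< in_reflection_group (reflmx (gram Phi) (val b)) >].
Proof. by apply/asboolP; exists [:: b]; rewrite big_seq1. Qed.

Definition refl (b : root_of) : reflection_group :=
  Sub (reflmx (gram Phi) (val b)) (refl_subproof b).

Definition quasi_cartan_companion (A : 'M[R]_n) (B : 'M[int]_n) : Prop :=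
  [/\ symmetrisable A, forall i, A i i = 2 &
      forall i j, i != j -> `|A i j| = `|B i j|%:~R].

(* The first two items say that the b_i form a Z-basis of the lattice
   spanned by the roots. *)
Definition companion_basis (B : 'M[int]_n) (b : 'I_n -> root_of) : Prop :=
  [/\ forall z : 'I_n -> int, \sum_i val (b i) *~ z i = 0 -> forall i, z i = 0,
      forall v : 'cV[R]_n, inIntSpan (in_tuple (roots Phi)) v <->
                           inIntSpan [tuple val (b i) | i < n] v &
      quasi_cartan_companion
        (\matrix_(i, j) cpair (gram Phi) (val (b i)) (val (b j))) B].

End RootSystem.

(* Main.v *)
(* The claim is transported along mutations, starting from the seed of Dynkin
   type. Two properties travel with it: the chordless cycles of the diagram are
   cyclically oriented, and there are roots b_i whose matrix of Cartan integers A
   is a quasi-Cartan companion of B. Positivity of the form forces an odd number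
   of positive A_ij on each chordless cycle, since otherwise, after sign changes,
   the sum of the b_i along the cycle would be a nonzero vector of nonpositive
   length. This parity makes the orientation of the cycles invariant under
   mutation, and determines A up to signs, so that all companions of B behave
   alike. At a vertex k the roots b_i with i -> k are replaced by their images
   under the reflection in b_k, and correspondingly t_i = s_k s_i s_k for i -> k,
   t_i = s_i otherwise; the relations attached to the edges and to the chordless
   cycles of the mutated diagram follow from those of the original one by
   conjugation and braid relations, and conversely because mutation is an
   involution. At the Dynkin seed the companion is conjugate, up to signs, to a
   base of the root system, where the relations are Coxeter's; that these present
   the reflection group follows from the exchange condition. *)

From HB Require Import structures.
From mathcomp Require Import all_boot all_order perm all_algebra.
From mathcomp Require Import zify ring lra.
From mathcomp Require Import boolp.
Require Import Defs.

Set Implicit Arguments.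
Unset Strict Implicit.
Unset Printing Implicit Defensive.

Import Order.TTheory GRing.Theory Num.Theory.

(** * Words and reflections along a path *)

(** No classification of diagrams enters. Edge weights are at most 3 by strict Cauchy-Schwarz for
    two roots of a companion, and the possible weighted triangles come from the same bound after one
    of the two roots is reflected in a third. The presentation is claimed for every companion of [B]
    at once: the induction pulls an arbitrary companion of the mutated matrix back to [B] and has no
    control over which companion of [B] it obtains. Mutating there and back conjugates all
    generators by [s_k], which preserves every relation, so a transfer of relations in one direction
    is enough. The delicate configuration is a chordless cycle of the mutated diagram that avoids
    [k]: a parity count on the cone with apex [k] shows that at most one vertex of the cycle, or
    exactly two adjacent ones, are joined to [k]. In the second case the cycle comes from one that
    is longer by the vertex [k]; otherwise it is unchanged by the mutation. *)

Section Words.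
Variables (G : groupType) (n : nat) (s : 'I_n -> G).
Local Open Scope group_scope.

Lemma weval_nil : weval s [::] = 1.
Proof. by rewrite /weval big_nil. Qed.

Lemma weval_cat u v : weval s (u ++ v) = weval s u * weval s v.
Proof. by rewrite /weval big_cat. Qed.

Lemma weval_gen i : weval s (wgen i) = s i.
Proof. by rewrite /weval big_seq1. Qed.

Lemma weval_pow w m : weval s (wpow w m) = weval s w ^+ m.
Proof.
elim: m => [|m IH]; first exact: weval_nil.
by rewrite /wpow /= weval_cat IH expgS.
Qed.

Lemma weval_gens l : weval s (wgens l) = \prod_(i <- l) s i.
Proof. by rewrite /weval big_map. Qed.

Lemma weval_linv l : weval s [:: l; linv l] = 1.
Proof.
rewrite /weval big_cons big_seq1 /linv; case: l => i [] /=; first exact: mulVg.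
exact: mulgV.
Qed.

Lemma weval_pres_eq (rel : word n -> Prop) u v :
  (forall r, rel r -> weval s r = 1) -> pres_eq rel u v ->
  weval s u = weval s v.
Proof.
move=> hrel; elim=> {u v}; first by [].
- by move=> u v _ ->.
- by move=> v u w _ -> _ ->.
- by move=> u u' v v' _ hu _ hv; rewrite !weval_cat hu hv.
- by move=> l; rewrite weval_linv weval_nil.
- by move=> r /hrel ->; rewrite weval_nil.
Qed.

Lemma weval_conj x w : weval (fun i => s i ^ x) w = weval s w ^ x.
Proof.
rewrite /weval conjg_prod; apply: eq_bigr => -[i []] _ //=.
by rewrite conjVg.
Qed.

Lemma eq_weval t : s =1 t -> weval s =1 weval t.
Proof. by move=> st w; apply: eq_bigr => -[i b] _; rewrite /= st. Qed.

(* For p = y_1 .. y_m this is s_(y_1) .. s_(y_m) .. s_(y_1). *)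
Fixpoint path_refl (p : seq 'I_n) : G :=
  match p with
  | [::] => 1
  | [:: y] => s y
  | y :: q => path_refl q ^ s y
  end.

(** The letters come in reverse order because [x ^ (a * b)] conjugates by [a] first, and in
    [path_refl] the generator nearest the end of the path acts first. *)
Fixpoint path_prod (p : seq 'I_n) : G :=
  if p is y :: q then path_prod q * s y else 1.

Lemma path_refl_cat p q :
  q != [::] -> path_refl (p ++ q) = path_refl q ^ path_prod p.
Proof.
move=> q0; elim: p => [|y p IH] /=; first by rewrite conjg1.
rewrite conjgM -IH; case: p {IH} => [|z p] //=.
by case: q q0.
Qed.

Lemma path_prod_comm p x : {in p, forall y, commute x (s y)} ->
  commute x (path_prod p).
Proof.
elim: p => [|y p IH] h; first exact: commute1.
apply: commuteM; first by apply: IH => z zp; apply: h; rewrite inE zp orbT.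
by apply: h; rewrite inE eqxx.
Qed.

Lemma path_refl_comm p x : {in p, forall y, commute x (s y)} ->
  commute x (path_refl p).
Proof.
elim: p => [|y p IH] h; first exact: commute1.
have hy : commute x (s y) by apply: h; rewrite inE eqxx.
have hp : commute x (path_refl p).
  by apply: IH => z zp; apply: h; rewrite inE zp orbT.
rewrite /=; case: p {IH h} hp => // z p hp.
by rewrite /conjg; do !apply: commuteM => //; apply: commuteV.
Qed.

Hypothesis s2 : forall i, s i * s i = 1.

Lemma sV i : (s i)^-1 = s i.
Proof. exact: mulg1_eq. Qed.

(** For involutions the nested conjugates spell the palindrome that follows the first letter of
    [cycle_word]; this is how the cycle relations become statements about [path_refl]. *)
Lemma path_reflE p : 
  path_refl p = \prod_(i <- p ++ rev (take (size p).-1 p)) s i.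
Proof.
elim: p => [|y p IH]; first by rewrite big_nil.
case: p IH => [|z p] IH; first by rewrite big_seq1.
have -> : path_refl (y :: z :: p) = path_refl (z :: p) ^ s y by [].
have -> : take (size [:: y, z & p]).-1 [:: y, z & p]
        = y :: take (size (z :: p)).-1 (z :: p) by [].
rewrite IH rev_cons -cats1 catA cat_cons big_cat big_seq1 big_cons /=.
by rewrite !big_cons /conjg sV !mulgA.
Qed.

End Words.

Lemma commuteP (G : groupType) (x y : G) : commute x y -> (x ^ y = x)%g.
Proof. by move=> xy; rewrite /conjg xy mulKg. Qed.

(** * Orders of products of involutions, and braid relations as statements about conjugates *)

Section ConjugateOrders.
Variable G : groupType.
Implicit Types x y z : G.
Local Open Scope group_scope.

Lemma ord_conj z x y e : (x ^ z * y ^ z) ^+ e = 1 <-> (x * y) ^+ e = 1.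
Proof.
rewrite -conjMg -conjXg; split=> [|->]; last exact: conj1g.
by move/eqP; rewrite conjg_eq1 => /eqP.
Qed.

Lemma ord_swap x y e : (x * y) ^+ e = 1 -> (y * x) ^+ e = 1.
Proof.
have -> : y * x = (x * y) ^ y^-1 by rewrite /conjg invgK mulgK.
by move=> h; rewrite -conjXg h conj1g.
Qed.

Variables I J K : G.
Hypotheses (I2 : I * I = 1) (J2 : J * J = 1) (K2 : K * K = 1).

Lemma conjg_invol x y : y * y = 1 -> (x ^ y) ^ y = x.
Proof. by move=> y2; rewrite -conjgM y2 conjg1. Qed.

Lemma braid3 : (J * K) ^+ 3 = 1 -> J ^ K = K ^ J.
Proof.
move=> h; rewrite /conjg (mulg1_eq J2) (mulg1_eq K2).
apply/eqP; rewrite -divg_eq1; apply/eqP.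
rewrite !invgM (mulg1_eq J2) (mulg1_eq K2) !mulgA.
have h' : (K * J) ^+ 3 = 1 by apply: ord_swap.
by rewrite -h' !expgSS expg1 !mulgA.
Qed.

Lemma braid4 : (J * K) ^+ 4 = 1 -> commute K (K ^ J).
Proof.
move=> h; have h' : (K * J) ^+ 4 = 1 by apply: ord_swap.
rewrite /commute /conjg (mulg1_eq J2); apply/eqP; rewrite -divg_eq1; apply/eqP.
by rewrite !invgM (mulg1_eq J2) (mulg1_eq K2) -h' !expgSS expg1 !mulgA.
Qed.

End ConjugateOrders.

Lemma eq_path_refl (G : groupType) n (s t : 'I_n -> G) p :
  {in p, t =1 s} -> path_refl t p = path_refl s p.
Proof.
elim: p => //= y p IH h.
rewrite (h y) ?inE ?eqxx // IH // => z zp.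
by apply: h; rewrite inE zp orbT.
Qed.

Lemma eq_path_prod (G : groupType) n (s t : 'I_n -> G) p :
  {in p, t =1 s} -> path_prod t p = path_prod s p.
Proof.
elim: p => //= y p IH h.
rewrite (h y) ?inE ?eqxx // IH // => z zp.
by apply: h; rewrite inE zp orbT.
Qed.

(* The relations attached to a cycle, for the generators t obtained from s by
   conjugating one vertex of the cycle by [s k]. *)
Section CycleTransfer.
Variables (G : groupType) (n : nat) (s t : 'I_n -> G) (i j k : 'I_n).
Variable (p : seq 'I_n).
Local Open Scope group_scope.
Hypothesis s2 : forall x, s x * s x = 1.
Hypothesis tp : {in p, t =1 s}.
Hypothesis tk : t k = s k.
Hypothesis kp : {in p, forall y, commute (s k) (s y)}.

Let cK x y : (x ^ s y) ^ s y = x. Proof. exact: conjg_invol. Qed.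

Let conjK_path q : {subset q <= p} -> path_refl s q ^ s k = path_refl s q.
Proof.
move=> qp; apply: commuteP; apply: commute_sym; apply: path_refl_comm => y yq.
by apply: kp; apply: qp.
Qed.

Let conjK_prod q : {subset q <= p} -> path_prod s q ^ s k = path_prod s q.
Proof.
move=> qp; apply: commuteP; apply: commute_sym; apply: path_prod_comm => y yq.
by apply: kp; apply: qp.
Qed.

Let conjK_gen y : y \in p -> s y ^ s k = s y.
Proof. by move=> yp; apply: commuteP; apply: commute_sym; apply: kp. Qed.

Let eq_refl q : {subset q <= p} -> path_refl t q = path_refl s q.
Proof. by move=> qp; apply: eq_path_refl => y /qp/tp. Qed.

Let eq_prod q : {subset q <= p} -> path_prod t q = path_prod s q.
Proof. by move=> qp; apply: eq_path_prod => y /qp/tp. Qed.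

(** * Removing [k] from between [i] and [j] *)

Section Shrink.
Hypotheses (ti : t i = s i ^ s k) (tj : t j = s j).

Lemma shrink_first e : (s i * path_refl s [:: k, j & p]) ^+ e = 1 ->
  (t i * path_refl t (j :: p)) ^+ e = 1.
Proof.
move=> h; apply/(ord_conj (s k)); rewrite ti cK.
rewrite (@eq_path_refl _ _ s t (j :: p)) // => y.
by rewrite inE => /predU1P[->//|/tp].
Qed.

Let reflE : path_refl t (p ++ [:: i]) = (s i ^ s k) ^ path_prod s p.
Proof. by rewrite path_refl_cat //= ti eq_prod. Qed.

(** The new edge between [i] and [j] has as weight the product of those at [k], which is at most 3,
    so one factor is 1. If it is the edge at [i], the relation at [j] comes from the old one at [j];
    if it is the edge at [j], as in [shrink_second2], it comes from the old one at [k]. *)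
Lemma shrink_second1 e : (s i * s k) ^+ 3 = 1 ->
  (s j * path_refl s (p ++ [:: i; k])) ^+ e = 1 ->
  (t j * path_refl t (p ++ [:: i])) ^+ e = 1.
Proof. by move=> /braid3 b; rewrite path_refl_cat //= reflE tj b. Qed.

Lemma shrink_second2 e : (s k * s j) ^+ 3 = 1 ->
  (s k * path_refl s (j :: p ++ [:: i])) ^+ e = 1 ->
  (t j * path_refl t (p ++ [:: i])) ^+ e = 1.
Proof.
move=> /braid3 b; have -> : path_refl s (j :: p ++ [:: i])
          = path_refl s (p ++ [:: i]) ^ s j by case: (p).
rewrite path_refl_cat //= reflE tj => h.
apply/(ord_conj (s k)); rewrite -b //.
rewrite -(conjK_prod (q := p)) // -conjJg cK.
by move: h; move/(ord_conj (s j)); rewrite cK.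
Qed.

Lemma shrink_other e p1 y p2 : p = p1 ++ y :: p2 ->
  (s y * path_refl s (p2 ++ [:: i, k, j & p1])) ^+ e = 1 ->
  (t y * path_refl t (p2 ++ [:: i, j & p1])) ^+ e = 1.
Proof.
move=> pE; have p1p : {subset p1 <= p} by move=> z; rewrite pE mem_cat => ->.
have p2p : {subset p2 <= p} by move=> z; rewrite pE mem_cat inE => ->; rewrite !orbT.
have yp : y \in p by rewrite pE mem_cat inE eqxx orbT.
move=> h; apply/(ord_conj (s k)); move: h.
rewrite tp // conjK_gen // !path_refl_cat // eq_prod // conjJg conjK_prod //.
suff -> : path_refl s [:: i, k, j & p1] = path_refl t [:: i, j & p1] ^ s k by [].
have -> : path_refl t [:: i, j & p1] = path_refl s (j :: p1) ^ t i.
  rewrite -(@eq_path_refl _ _ s t (j :: p1)) // => z.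
  by rewrite inE => /predU1P[->//|/p1p/tp].
have -> : path_refl s [:: i, k, j & p1] = (path_refl s (j :: p1) ^ s k) ^ s i.
  by [].
by rewrite ti [RHS]conjJg cK.
Qed.

End Shrink.

(** * Inserting [k] between [i] and [j] *)

Section Grow.
Hypotheses (ti : t i = s i) (tj : t j = s j ^ s k).

Let kjE : path_refl t [:: k, j & p] = path_refl s (j :: p).
Proof.
have -> : path_refl t [:: k, j & p] = path_refl t (j :: p) ^ s k by rewrite /= tk.
case: p tp conjK_path => [|y q] tp' cp; first by rewrite /= tj cK.
have -> : path_refl t [:: j, y & q] = path_refl s (y :: q) ^ t j.
  by rewrite -(@eq_path_refl _ _ s t (y :: q)).
by rewrite tj conjJg cK cp.
Qed.

Lemma grow_first e : (s i * path_refl s (j :: p)) ^+ e = 1 ->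
  (t i * path_refl t [:: k, j & p]) ^+ e = 1.
Proof. by rewrite kjE ti. Qed.

Let Q := path_refl s (p ++ [:: i]).

Let QE : Q = s i ^ path_prod s p.
Proof. by rewrite /Q path_refl_cat. Qed.

Let jpiE : path_refl t (j :: p ++ [:: i]) = Q ^ (s j ^ s k).
Proof.
have -> : path_refl t (j :: p ++ [:: i]) = path_refl t (p ++ [:: i]) ^ t j by case: (p).
by rewrite tj path_refl_cat //= ti eq_prod // QE.
Qed.

Let pikE : path_refl t (p ++ [:: i; k]) = (s k ^ s i) ^ path_prod s p.
Proof. by rewrite path_refl_cat //= ti tk eq_prod. Qed.

(** The braid relation writes [s k] as [s j ^ (s j ^ s k)], which makes the relation at the inserted
    vertex a conjugate of the old one at [j]. *)
Lemma grow_new1 e : (s j * s k) ^+ 3 = 1 ->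
  (s j * Q) ^+ e = 1 -> (t k * path_refl t (j :: p ++ [:: i])) ^+ e = 1.
Proof.
move=> /braid3 b h; rewrite jpiE tk.
have {1}-> : s k = s j ^ (s j ^ s k).
  by rewrite b // -{1}(commuteP (commute_refl (s j))) -conjJg b // cK.
exact/ord_conj.
Qed.

(** With a double edge between [j] and [k] the rewriting of [grow_new1] fails. Instead [s k]
    commutes with [s k ^ s j] and [s j] with [Q], so the conjugations unwind until only the braid
    relation of [k] and [i] is left. *)
Lemma grow_new2 e : (s j * s k) ^+ 4 = 1 -> commute (s j) Q ->
  (s k * s i) ^+ e = 1 -> (t k * path_refl t (j :: p ++ [:: i])) ^+ e = 1.
Proof.
move=> b jQ h; rewrite jpiE tk.
have kj : commute (s k) (s k ^ s j) by apply: braid4.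
have -> : s j ^ s k = s k * s j * s k by rewrite /conjg sV // mulgA.
rewrite !conjgM; apply/(ord_conj (s k)); rewrite cK (commuteP (commute_refl _)).
apply/(ord_conj (s j)); rewrite cK.
apply/(ord_conj (s k)); rewrite cK (commuteP (commute_sym kj)).
apply/(ord_conj (s j)); rewrite cK (commuteP (commute_sym jQ)) QE.
have {1}<- : s k ^ path_prod s p = s k.
  by apply: commuteP; apply: path_prod_comm.
exact/ord_conj.
Qed.

Lemma grow_second1 e : (s i * s k) ^+ 3 = 1 ->
  (s j * Q) ^+ e = 1 -> (t j * path_refl t (p ++ [:: i; k])) ^+ e = 1.
Proof.
move=> /braid3 b h; rewrite pikE tj -b //.
rewrite -(conjK_prod (q := p)) // -conjJg -QE; exact/ord_conj.
Qed.

Lemma grow_second2 e : (s i * s k) ^+ 4 = 1 -> commute (s j) Q ->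
  (s j * s k) ^+ e = 1 -> (t j * path_refl t (p ++ [:: i; k])) ^+ e = 1.
Proof.
move=> b jQ h; rewrite pikE tj; apply/(ord_conj (s k)); rewrite cK.
rewrite conjJg conjK_prod //.
have ki : commute (s k) (s k ^ s i) by apply: braid4.
have kP : s k ^ path_prod s p = s k.
  by apply: commuteP; apply: path_prod_comm.
rewrite (commuteP (commute_sym ki)) conjJg kP -QE.
by rewrite -{1}(commuteP jQ); apply/ord_conj.
Qed.

Lemma grow_other e p1 y p2 : p = p1 ++ y :: p2 ->
  (s y * path_refl s (p2 ++ [:: i, j & p1])) ^+ e = 1 ->
  (t y * path_refl t (p2 ++ [:: i, k, j & p1])) ^+ e = 1.
Proof.
move=> pE; have p1p : {subset p1 <= p} by move=> z; rewrite pE mem_cat => ->.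
have p2p : {subset p2 <= p} by move=> z; rewrite pE mem_cat inE => ->; rewrite !orbT.
have yp : y \in p by rewrite pE mem_cat inE eqxx orbT.
rewrite tp // !path_refl_cat // eq_prod //.
suff -> : path_refl t [:: i, k, j & p1] = path_refl s [:: i, j & p1] by [].
rewrite -[RHS]/(path_refl s (j :: p1) ^ s i) -ti.
rewrite -[LHS]/((path_refl t (j :: p1) ^ t k) ^ t i) tk; congr (_ ^ _).
case: p1 p1p {pE} => [|z q] p1p; first by rewrite /= tj cK.
rewrite -[path_refl t _]/(path_refl t (z :: q) ^ t j) eq_refl // tj conjJg cK.
by rewrite conjK_path.
Qed.

End Grow.

End CycleTransfer.

(** * Edges and triangles at the mutated vertex *)

Section SmallTransfer.
Variables (G : groupType) (I J K : G).
Local Open Scope group_scope.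
Hypotheses (I2 : I * I = 1) (J2 : J * J = 1) (K2 : K * K = 1).

Lemma edge_triangle e : (I * J ^ K) ^+ e = 1 -> (I ^ K * J) ^+ e = 1.
Proof. by move=> h; apply/(ord_conj K); rewrite conjg_invol. Qed.

(** An edge created by a path from [I] through [K] to [J]: one edge of the path is simple, here the
    one at [I], in [edge_path2] the one at [J]. The braid relation moves the conjugation to the
    other end, where commutation of [I] and [J] removes it. *)
Lemma edge_path1 e : commute I J -> (I * K) ^+ 3 = 1 -> (K * J) ^+ e = 1 ->
  (I ^ K * J) ^+ e = 1.
Proof.
move=> ij /braid3-> // h; apply/(ord_conj I); rewrite conjg_invol //.
by rewrite (commuteP (commute_sym ij)).
Qed.

Lemma edge_path2 e : commute I J -> (K * J) ^+ 3 = 1 -> (I * K) ^+ e = 1 ->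
  (I ^ K * J) ^+ e = 1.
Proof.
move=> ij b h; apply: edge_triangle; rewrite -braid3 //.
by apply/(ord_conj J); rewrite conjg_invol // (commuteP ij).
Qed.

Hypotheses (IK4 : (I * K) ^+ 4 = 1) (JK4 : (J * K) ^+ 4 = 1).

(** For the triangle with two double edges at [K] and a simple edge opposite, which the mutation at
    [K] turns into a triangle with the same weights and the reverse orientation. *)
Lemma triangle_new e : (I * J) ^+ 3 = 1 -> (K * J ^ I) ^+ e = 1 ->
  (K * I ^ (J ^ K)) ^+ e = 1.
Proof.
move=> b h; have kj : commute K (K ^ J) by apply: braid4.
have -> : J ^ K = K * J * K by rewrite /conjg (mulg1_eq K2) mulgA.
rewrite !conjgM; apply/(ord_conj K); rewrite conjg_invol //.
rewrite (commuteP (commute_refl K)).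
apply/(ord_conj J); rewrite conjg_invol //.
apply/(ord_conj K); rewrite conjg_invol // (commuteP (commute_sym kj)).
by apply/(ord_conj J); rewrite conjg_invol // braid3.
Qed.

Lemma triangle_second e : (K * J ^ I) ^+ e = 1 -> (J ^ K * K ^ I) ^+ e = 1.
Proof.
move=> h; have ki : commute K (K ^ I) by apply: braid4.
apply/(ord_conj K); rewrite conjg_invol // (commuteP (commute_sym ki)).
by apply: ord_swap; apply/(ord_conj I); rewrite conjg_invol.
Qed.

End SmallTransfer.

(** * Chordless cycles in graphs *)

Section Edges.
Variable T : eqType.
Implicit Types (p q c : seq T) (x y : T).

Definition pedges p : seq (T * T) := zip p (behead p).

Definition cedges c : seq (T * T) :=
  if c is x :: q then pedges (x :: rcons q x) else [::].

Lemma pedges_cons x y p : pedges [:: x, y & p] = (x, y) :: pedges (y :: p).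
Proof. by []. Qed.

Lemma pedges_cat p y q :
  pedges (p ++ y :: q) = pedges (rcons p y) ++ pedges (y :: q).
Proof.
elim: p => [|x p IH] //; case: p IH => [|z p] //= IH.
by rewrite !pedges_cons IH.
Qed.

Lemma pedges_rcons p x y :
  pedges (rcons (rcons p x) y) = rcons (pedges (rcons p x)) (x, y).
Proof. by rewrite -cats1 cat_rcons pedges_cat /= cats1. Qed.

Lemma pedges_rev p :
  pedges (rev p) = rev [seq (e.2, e.1) | e <- pedges p].
Proof.
elim: p => [|x p IH] //; case: p IH => [|y p] // IH.
rewrite rev_cons pedges_cons map_cons [RHS]rev_cons -IH rev_cons.
by rewrite pedges_rcons.
Qed.

Lemma mem_pedges p a b : (a, b) \in pedges p -> a \in p /\ b \in p.
Proof.
elim: p => [|x [|y p] IH] //; rewrite pedges_cons inE => /orP[/eqP[-> ->]|].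
  by rewrite !inE !eqxx orbT.
by move=> /IH[ap bp]; rewrite ![_ \in x :: _]inE ap bp !orbT.
Qed.

Lemma path_pedges (e : rel T) x p :
  path e x p = all (fun a => e a.1 a.2) (pedges (x :: p)).
Proof. by elim: p x => [|y p IH] x //=; rewrite IH. Qed.

Lemma cycle_cedges (e : rel T) c : cycle e c = all (fun a => e a.1 a.2) (cedges c).
Proof. by case: c => [|x q] //; rewrite -path_pedges. Qed.

Lemma cedges_rot1 x q : cedges (rcons q x) = rot 1 (cedges (x :: q)).
Proof.
case: q => [|y q] //.
have -> : cedges (rcons (y :: q) x) = pedges (rcons (rcons (y :: q) x) y) by [].
by rewrite pedges_rcons -rot1_cons.
Qed.

Lemma cedges_rot m c : perm_eq (cedges (rot m c)) (cedges c).
Proof.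
case: (leqP m (size c)) => [|/ltnW h]; last by rewrite rot_oversize.
elim: m => [|m IH] mc; first by rewrite rot0.
rewrite -[m.+1]add1n rotD ?add1n //.
apply: perm_trans (IH (ltnW mc)).
case: (rot m c) => [|x q] //; rewrite rot1_cons cedges_rot1.
by rewrite perm_rot.
Qed.

Lemma mem_cedges_rot m c : cedges (rot m c) =i cedges c.
Proof. exact/perm_mem/cedges_rot. Qed.

Lemma cedges_rev c :
  perm_eq (cedges (rev c)) [seq (e.2, e.1) | e <- cedges c].
Proof.
case: c => [|x q] //=; rewrite rev_cons.
rewrite perm_sym -perm_rev -[in X in perm_eq X _]pedges_rev.
rewrite rev_cons rev_rcons cedges_rot1 perm_sym perm_rot.
by [].
Qed.

Lemma cedges_fst c : map fst (cedges c) = c.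
Proof.
case: c => [|x q] //=; move: {2}x => z.
by elim: q x => [|y q IH] x //=; rewrite -[in RHS](IH y).
Qed.

Lemma mem_cedges c a b : (a, b) \in cedges c -> a \in c /\ b \in c.
Proof.
case: c => [|x q] // /mem_pedges[]; rewrite !(inE, mem_rcons).
by case/or3P => ->; case/or3P => ->; rewrite ?orbT.
Qed.

Lemma cedges_next c a b :
  uniq c -> ((a, b) \in cedges c) = (a \in c) && (b == next c a).
Proof.
move=> uc; have nx x : x \in c -> (x, next c x) \in cedges c.
  move=> xc; apply: (@next_cycle _ (fun x y => (x, y) \in cedges c)) => //.
  by rewrite cycle_cedges; apply/allP => -[].
apply/idP/andP => [ab|[ac /eqP->]]; last exact: nx.
have [ac _] := mem_cedges ab; split=> //; apply/eqP.
(* The first components of [cedges c] are the entries of [c], so in a [uniq] cycle an edge is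
   determined by its source. *)
have := nx a ac; move: ab; move: uc; rewrite -{1}(cedges_fst c).
elim: (cedges c) => // -[u v] E IH /= /andP[uE /IH{}IH].
have hE w : (u, w) \in E -> False by move=> /(map_f fst); rewrite (negbTE uE).
rewrite !inE !xpair_eqE; case: (eqVneq a u) => [->|_] /=; last by apply: IH.
by case/orP => [/eqP->|/hE//]; case/orP => [/eqP->|/hE//].
Qed.

End Edges.

Section Cycles.
Variable T : eqType.
Implicit Types (p q c : seq T) (x y : T) (e : rel T).

Definition padj p x y := ((x, y) \in pedges p) || ((y, x) \in pedges p).
Definition cadj c x y := ((x, y) \in cedges c) || ((y, x) \in cedges c).

Definition induced_path e p :=
  uniq p /\ {in p &, forall x y, e x y = padj p x y}.

Definition induced_cycle e c :=
  [/\ uniq c, 2 < size c & {in c &, forall x y, e x y = cadj c x y}].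

Lemma induced_cycle_rot e m c : induced_cycle e c -> induced_cycle e (rot m c).
Proof.
case=> uc sc h; split; rewrite ?rot_uniq ?size_rot // => x y.
by rewrite !mem_rot => xc yc; rewrite h // /cadj !mem_cedges_rot.
Qed.

Lemma mem_cedges_rev c x y : ((x, y) \in cedges (rev c)) = ((y, x) \in cedges c).
Proof.
rewrite (perm_mem (cedges_rev c)); apply/mapP/idP => [[[u v] uv [-> ->]]//|yx].
by exists (y, x).
Qed.

Lemma cadj_rev c x y : cadj (rev c) x y = cadj c x y.
Proof. by rewrite /cadj !mem_cedges_rev orbC. Qed.

Lemma induced_cycle_rev e c : induced_cycle e c -> induced_cycle e (rev c).
Proof.
case=> uc sc h; split; rewrite ?rev_uniq ?size_rev // => x y.
by rewrite !mem_rev => xc yc; rewrite h // cadj_rev.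
Qed.

Lemma eq_induced_cycle e e' c : {in c &, e =2 e'} ->
  induced_cycle e c -> induced_cycle e' c.
Proof. by move=> ee [uc sc h]; split=> // x y xc yc; rewrite -ee // h. Qed.

Lemma rot_to_cons c x : x \in c -> exists m q, rot m c = x :: q.
Proof. by move=> /rot_to[m q]; exists m, q. Qed.

Lemma cedges_cons x y q z : 
  cedges (x :: rcons (y :: q) z)
    = (x, y) :: rcons (pedges (y :: rcons q z)) (z, x).
Proof.
rewrite -[LHS]/((x, y) :: pedges (rcons (rcons (y :: q) z) x)).
by rewrite pedges_rcons.
Qed.

End Cycles.

(** * Parity of edge labels along closed walks *)

Section Parity.
Variables (T : eqType) (e : rel T) (f : T -> T -> bool).
Implicit Types (p q c : seq T) (x y : T).
Hypotheses (e_sym : symmetric e) (e_irr : irreflexive e).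
Hypothesis f_sym : symmetric f.

Definition par (E : seq (T * T)) : bool := \big[addb/false]_(a <- E) f a.1 a.2.

Lemma par_nil : par [::] = false. Proof. exact: big_nil. Qed.
Lemma par_cons a E : par (a :: E) = f a.1 a.2 (+) par E.
Proof. exact: big_cons. Qed.
Lemma par_cat E E' : par (E ++ E') = par E (+) par E'.
Proof. exact: big_cat. Qed.
Lemma par_rcons a E : par (rcons E a) = par E (+) f a.1 a.2.
Proof. by rewrite -cats1 par_cat par_cons par_nil addbF. Qed.
Lemma perm_par E E' : perm_eq E E' -> par E = par E'.
Proof. by move=> h; apply: perm_big. Qed.
Lemma par_cedges_rot m c : par (cedges (rot m c)) = par (cedges c).
Proof. exact/perm_par/cedges_rot. Qed.
Lemma par_swap E : par [seq (a.2, a.1) | a <- E] = par E.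
Proof. by rewrite /par big_map; apply: eq_bigr => a _; rewrite f_sym. Qed.
Lemma par_pedges_rev p : par (pedges (rev p)) = par (pedges p).
Proof. by rewrite pedges_rev (@perm_par _ [seq (a.2, a.1) | a <- pedges p]) ?perm_rev // par_swap. Qed.
Section Balanced.
Hypothesis even : forall c, induced_cycle e c -> par (cedges c) = false.

(* A shortest closed walk of odd parity would be an induced cycle. *)
Lemma closed_walk_even c : cycle e c -> par (cedges c) = false.
Proof.
have [m] := ubnP (size c); elim: m c => // m IH c /ltnSE cm ec.
have key k x p1 y p2 : rot k c = x :: p1 ++ y :: p2 ->
  [/\ size c = (size p1 + size p2).+2, path e x (rcons p1 y),
      path e y (rcons p2 x) &
      par (cedges c) =
      par (pedges (x :: rcons p1 y)) (+) par (pedges (y :: rcons p2 x))].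
  move=> cE; split.
  - by rewrite -(size_rot k) cE /= size_cat /= addnS.
  - by move: ec; rewrite -(rot_cycle k) cE /= rcons_cat -cat_rcons cat_path => /andP[].
  - by move: ec; rewrite -(rot_cycle k) cE /= rcons_cat -cat_rcons cat_path last_rcons => /andP[].
  - rewrite -(par_cedges_rot k) cE.
    by rewrite [cedges _]/= rcons_cat -cat_cons rcons_cons pedges_cat par_cat.
case: (boolP (uniq c)) => uc; last first.
  (* A repeated vertex cuts the walk into two shorter closed walks. *)
  have [p0 [x [p1 [p2 cE]]]] : exists p0 x p1 p2, c = p0 ++ x :: p1 ++ x :: p2.
    elim: c uc {IH cm ec key} => // x c IH; rewrite [uniq _]/= negb_and negbK.
    case/orP => [/splitPr[p1 p2]|/IH[p0 [y [p1 [p2 ->]]]]].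
      by exists [::], x, p1, p2.
    by exists (x :: p0), y, p1, p2.
  have [|sc e1 e2 ->] := key (size p0) x (p1) x (p2 ++ p0).
    by rewrite cE rot_size_cat /= -catA.
  rewrite -[par (pedges (x :: rcons p1 x))]/(par (cedges (x :: p1))).
  rewrite -[par (pedges (x :: rcons (p2 ++ p0) x))]/(par (cedges (x :: (p2 ++ p0)))).
  rewrite IH ?IH //=; apply: leq_trans cm; rewrite sc ltnS ?leq_addr //.
  by rewrite ltnS leq_addl.
case: (leqP (size c) 2) => sc.
  case: c sc ec {IH cm key uc} => [|x [|y [|z c]]] //= _; first by rewrite par_nil.
    by rewrite e_irr.
  by move=> _; rewrite !par_cons par_nil /= f_sym addbF addbb.
case: (boolP (all (fun x => all (fun y => e x y == cadj c x y) c) c)) => [/allP ind|].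
  by apply: even; split=> // x y /ind/allP + yc; move=> /(_ y yc)/eqP.
(* A chord closes each of the two arcs into a shorter closed walk; it is counted twice and cancels
   in the parity. *)
case/allPn => x xc /allPn[y yc exy].
have cadj_e a b : cadj c a b -> e a b.
  move: ec; rewrite cycle_cedges => /allP h /orP[/h//|/h].
  by rewrite e_sym.
have {exy cadj_e} [exy nxy] : e x y /\ ~~ cadj c x y.
  by move: exy (cadj_e x y); case: (e x y); case: (cadj c x y) => // _ /(_ isT).
have [k [q cE]] := rot_to_cons xc.
have : y \in q.
  move: yc; rewrite -(mem_rot k) cE inE => /predU1P[yx|//].
  by rewrite yx e_irr in exy.
move=> yq; case/splitPr: yq cE => p1 p2 cE.
have nadj a b : ((a, b) \in cedges c) = ((a, b) \in cedges (x :: p1 ++ y :: p2)).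
  by rewrite -cE mem_cedges_rot.
move: nxy; rewrite /cadj !nadj [cedges _]/= rcons_cat -cat_cons rcons_cons pedges_cat.
rewrite !mem_cat => nxy.
have [sc' _ _ ->] := key _ _ _ _ _ cE.
have [_ e1 e2 _] := key _ _ _ _ _ cE.
have p1n : p1 != [::] by case: (p1) nxy => //; rewrite /pedges /= inE eqxx.
have p2n : p2 != [::] by case: (p2) nxy => //; rewrite /pedges /= !inE eqxx !orbT.
have IH1 : par (cedges (x :: rcons p1 y)) = false.
  apply: IH; last by rewrite /= rcons_path e1 last_rcons e_sym.
  rewrite /= size_rcons; apply: leq_trans cm; rewrite sc' !ltnS.
  by case: (p2) p2n => // z w _; rewrite addnS ltnS leq_addr.
have IH2 : par (cedges (y :: rcons p2 x)) = false.
  apply: IH; last by rewrite /= rcons_path e2 last_rcons.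
  rewrite /= size_rcons; apply: leq_trans cm; rewrite sc' !ltnS.
  by case: (p1) p1n => // z w _; rewrite addSn ltnS leq_addl.
move: IH1 IH2; rewrite [cedges (x :: _)]/= [cedges (y :: _)]/= -!rcons_cons.
rewrite !pedges_rcons !par_rcons /= f_sym.
by do 2!case: (par _); case: (f _ _).
Qed.

End Balanced.
End Parity.

(** The potential of [x] is the parity of a walk to [x] from the root of its component. Going out to
    [x], along the edge to [y] and back to the root is a closed walk, hence even. *)
Lemma balanced_potential (T : finType) (e : rel T) (f : T -> T -> bool) :
  symmetric e -> irreflexive e -> symmetric f ->
  (forall c, induced_cycle e c -> par f (cedges c) = false) ->
  exists eps : T -> bool, forall x y, e x y -> f x y = eps x (+) eps y.
Proof.
move=> e_sym e_irr f_sym even.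
pose r := fingraph.root e.
have csym : connect_sym e by apply: sym_connect_sym.
have walk x : exists q, path e (r x) q && (x == last (r x) q).
  have /connectP[q pq lq] : connect e (r x) x by rewrite csym connect_root.
  by exists q; rewrite pq -lq eqxx.
pose q x := xchoose (walk x).
have qP x : path e (r x) (q x) /\ last (r x) (q x) = x.
  by have /andP[? /eqP<-] := xchooseP (walk x).
exists (fun x => par f (pedges (r x :: q x))) => x y exy.
have rxy : r x = r y by apply/eqP; rewrite /r root_connect //; apply: connect1.
have [px lx] := qP x; have [py ly] := qP y; rewrite -rxy in py ly *.
have qyE : rcons (rev (q y)) (r x) = y :: behead (rcons (rev (q y)) (r x)).
  rewrite -rev_cons lastI ly rev_rcons /=; congr (_ :: _).
have qxE : r x :: q x = rcons (belast (r x) (q x)) x by rewrite lastI lx.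
have px' : rcons (r x :: q x) y = rcons (rcons (belast (r x) (q x)) x) y.
  by rewrite qxE.
have := @closed_walk_even _ e f e_sym e_irr f_sym even (r x :: q x ++ rev (q y)).
rewrite cycle_cedges /= rcons_cat qyE -cat_cons pedges_cat par_cat px' pedges_rcons.
rewrite -qxE par_rcons /= -qyE -rev_cons par_pedges_rev // all_cat.
have -> : all (fun a => e a.1 a.2) (rcons (pedges (r x :: q x)) (x, y)).
  by rewrite all_rcons exy /= -path_pedges.
have -> : all (fun a => e a.1 a.2) (pedges (rev (r x :: q y))).
  rewrite pedges_rev all_rev all_map; move: py; rewrite path_pedges.
  by apply: sub_all => -[a b] /=; rewrite e_sym.
move=> /(_ isT); do 2!case: (par _ _); by case: (f x y).
Qed.

Section InducedSub.
Variables (T : eqType) (e : rel T).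
Implicit Types (p q c : seq T) (x y : T).

Lemma pedges_irr p a : uniq p -> (a, a) \in pedges p -> False.
Proof.
elim: p => [|x [|y p] IH] //; rewrite cons_uniq => /andP[xp /IH{}IH].
rewrite pedges_cons inE xpair_eqE => /orP[/andP[/eqP-> /eqP xy]|//].
by rewrite xy inE eqxx in xp.
Qed.

Lemma cedges_irr c a : uniq c -> 1 < size c -> (a, a) \in cedges c -> False.
Proof.
move=> u s aa; have [ac _] := mem_cedges aa; have [m [q cE]] := rot_to_cons ac.
move: u s aa; rewrite -(rot_uniq m) -(size_rot m) -(mem_cedges_rot m) cE.
case: q {cE} => // y q u _; rewrite [cedges _]/= pedges_cons inE xpair_eqE eqxx /=.
move: u; rewrite cons_uniq => /andP[an u] /orP[/eqP ay|]; first by rewrite ay inE eqxx in an.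
by apply: pedges_irr; rewrite -rcons_cons rcons_uniq an.
Qed.

Lemma induced_path_cat p1 y p2 : induced_path e (p1 ++ y :: p2) ->
  induced_path e (rcons p1 y) /\ induced_path e (y :: p2).
Proof.
move=> [u h]; have u1 : uniq (rcons p1 y).
  by move: u; rewrite -cat_rcons cat_uniq => /andP[].
have u2 : uniq (y :: p2) by move: u; rewrite cat_uniq => /and3P[].
have dis a : a \in rcons p1 y -> a \in y :: p2 -> a = y.
  move: u; rewrite -cat_rcons cat_uniq => /and3P[_ /hasPn d _] a1.
  by rewrite inE => /predU1P[//|/d]; rewrite a1.
have sub1 a : a \in rcons p1 y -> a \in p1 ++ y :: p2.
  by rewrite -cat_rcons mem_cat => ->.
have sub2 a : a \in y :: p2 -> a \in p1 ++ y :: p2.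
  by rewrite mem_cat orbC => ->.
split; split=> // a b aP bP.
  rewrite h ?sub1 // /padj pedges_cat !mem_cat.
  have no v w : v \in rcons p1 y -> w \in rcons p1 y ->
      ((v, w) \in pedges (y :: p2)) = false.
    move=> vP wP; apply/negP => vw; have [/(dis v vP) vy /(dis w wP) wy] := mem_pedges vw.
    by move: vw; rewrite vy wy; apply: pedges_irr.
  by rewrite !no // !orbF.
have no v w : v \in y :: p2 -> w \in y :: p2 ->
    ((v, w) \in pedges (rcons p1 y)) = false.
  move=> vP wP; apply/negP => vw; have [vy wy] := mem_pedges vw.
  by move: vw; rewrite (dis v) // (dis w) //; apply: pedges_irr.
by rewrite h ?sub2 // /padj pedges_cat !mem_cat !no.
Qed.

(** With [p2] empty, the closing edge of the cycle would join [y] and [x], and the arc would not be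
    induced. *)
Lemma induced_arc x p1 y p2 : p2 != [::] ->
  induced_cycle e (x :: p1 ++ y :: p2) -> induced_path e (x :: rcons p1 y).
Proof.
case: p2 => // z r _ [u _ h].
have u1 : uniq (x :: rcons p1 y).
  by move: u; rewrite -cat_rcons -cat_cons cat_uniq => /andP[].
have sub a : a \in x :: rcons p1 y -> a \in x :: p1 ++ [:: y, z & r].
  by rewrite -cat_rcons -cat_cons mem_cat => ->.
have dis a : a \in x :: rcons p1 y -> a \in z :: r -> False.
  move: u; rewrite -cat_rcons -cat_cons cat_uniq => /and3P[_ /hasPn d _] a1 /d.
  by rewrite a1.
split=> // a b aP bP; rewrite h ?sub // /cadj.
have -> : cedges (x :: p1 ++ [:: y, z & r])
        = pedges (x :: rcons p1 y) ++ (y, z) :: pedges (z :: rcons r x).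
  by rewrite [cedges _]/= rcons_cat -cat_cons pedges_cat.
have uzr : uniq (z :: rcons r x).
  rewrite -rcons_cons rcons_uniq; move: u; rewrite -cat_rcons -cat_cons cat_uniq.
  case/and3P=> _ /hasPn d ->; rewrite andbT; apply/negP => /d.
  by rewrite inE eqxx.
have no v w : v \in x :: rcons p1 y -> w \in x :: rcons p1 y ->
    ((v, w) \in (y, z) :: pedges (z :: rcons r x)) = false.
  move=> vP wP; apply/negP; rewrite inE xpair_eqE => /orP[/andP[_ /eqP wz]|vw].
    by apply: (dis w) => //; rewrite wz inE eqxx.
  have [] := mem_pedges vw; rewrite -rcons_cons !mem_rcons ![_ \in x :: _]inE.
  case/predU1P=> [vx|/(dis v vP)//]; case/predU1P=> [wx|/(dis w wP)//].
  by move: vw; rewrite vx wx; apply: pedges_irr.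
by rewrite /padj !mem_cat !no // !orbF.
Qed.

End InducedSub.

(* k is the centre of a cone over an induced cycle; d x tells whether the edge
   between k and its neighbour x points away from k. *)
Section Wheel.
Variables (T : eqType) (e : rel T) (f : T -> T -> bool).
Hypotheses (e_sym : symmetric e) (f_sym : symmetric f).
Variables (k : T) (d : pred T).
Hypothesis (ekk : e k k = false).
Hypothesis cyc_odd : forall c, induced_cycle e (k :: c) ->
  par f (cedges (k :: c)) /\ d (head k c) = ~~ d (last k c).
Implicit Types (p q c : seq T) (x y z : T).

Lemma cone_cycle x q y : induced_path e (x :: rcons q y) -> k \notin x :: rcons q y ->
  e k x -> e k y -> {in q, forall z, ~~ e k z} ->
  induced_cycle e [:: k, x & rcons q y].
Proof.
move=> [u h] kn kx ky kq.
have eK a : a \in x :: rcons q y -> e k a = (a == x) || (a == y).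
  rewrite inE mem_rcons inE.
  case: (eqVneq a x) => [->|ax] /=; first by rewrite kx.
  by case: (eqVneq a y) => [->|ay] //= aq; apply/negbTE/kq.
have cE : cedges [:: k, x & rcons q y]
    = (k, x) :: rcons (pedges (x :: rcons q y)) (y, k).
  by rewrite -cedges_cons.
have nk a : ((k, a) \in pedges (x :: rcons q y)) = false.
  by apply/negP => /mem_pedges[h1 _]; rewrite h1 in kn.
have nk' a : ((a, k) \in pedges (x :: rcons q y)) = false.
  by apply/negP => /mem_pedges[_ h1]; rewrite h1 in kn.
split; first by rewrite cons_uniq kn.
  by rewrite /= size_rcons.
have xk : (x == k) = false by apply/negP => /eqP xk; rewrite xk inE eqxx in kn.
have yk : (k == y) = false.
  by apply/negP => /eqP ky'; rewrite ky' inE mem_rcons inE eqxx orbT in kn.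
move=> a b; rewrite ![_ \in k :: _]inE /cadj cE !inE !mem_rcons !inE !xpair_eqE.
case: (eqVneq a k) => [->|ak] /=; case: (eqVneq b k) => [->|bk] //= aP bP.
- by rewrite ekk nk [k == x]eq_sym xk yk.
- rewrite nk nk' yk andbF eK ?inE ?mem_rcons ?inE //.
  by case: (b == x); case: (b == y).
- rewrite nk nk' e_sym eK ?inE ?mem_rcons ?inE // yk.
  by case: (a == x); case: (a == y).
- by rewrite h ?inE ?mem_rcons ?inE // !andbF.
Qed.

Lemma cone_par x q y : induced_path e (x :: rcons q y) -> k \notin x :: rcons q y ->
  e k x -> e k y -> {in q, forall z, ~~ e k z} ->
  f k x (+) par f (pedges (x :: rcons q y)) (+) f k y /\ d x = ~~ d y.
Proof.
move=> ip kn kx ky kq; have ic := cone_cycle ip kn kx ky kq.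
have cE : cedges [:: k, x & rcons q y]
    = (k, x) :: rcons (pedges (x :: rcons q y)) (y, k).
  by rewrite -cedges_cons.
have [] := cyc_odd ic; rewrite cE par_cons par_rcons [head _ _]/=.
by rewrite [last _ _]/= last_rcons /= [f y k]f_sym addbA.
Qed.

(** Between successive neighbours of [k] the walk closes up through [k] to an odd induced cycle on
    which [d] changes. The inner spokes cancel, so the parity counts the changes of [d]. *)
Lemma walk_par x q : induced_path e (x :: q) -> k \notin x :: q ->
  e k x -> e k (last x q) ->
  f k x (+) par f (pedges (x :: q)) (+) f k (last x q) = (d x != d (last x q)).
Proof.
have [m] := ubnP (size q); elim: m x q => // m IH x q /ltnSE qm ip kn kx kl.
case: (boolP (q == [::])) => [/eqP->|q0]; first by rewrite /= par_nil addbF addbb eqxx.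
have hq : has (e k) q.
  apply/hasP; exists (last x q) => //; case: (q) q0 => // a b _.
  exact: (mem_last a b).
case/split_find: {q}_ / hq ip kn kl qm q0 => y q1 q2 ky /hasPn kq ip kn kl qm _.
move: ip kn kl; rewrite cat_rcons -cat_cons => ip kn kl.
have [ip1 ip2] := induced_path_cat ip.
have kn1 : k \notin rcons (x :: q1) y.
  by move: kn; rewrite -cat_rcons mem_cat negb_or => /andP[].
have kn2 : k \notin y :: q2 by move: kn; rewrite mem_cat negb_or => /andP[].
have [P1 dxy] := cone_par ip1 kn1 kx ky kq.
have kl' : e k (last y q2) by rewrite last_cat in kl.
have := IH y q2 _ ip2 kn2 ky kl'.
have -> : size q2 < m by apply: leq_trans qm; rewrite size_cat size_rcons addSn ltnS leq_addl.
move=> /(_ isT); rewrite cat_cons [last x _]last_cat /= -cat_cons pedges_cat par_cat dxy.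
move: P1; rewrite -rcons_cons; case: (par _ _); case: (par _ _); case: (f k x);
case: (f k y); case: (f k _); case: (d y); case: (d _) => //.
Qed.

(** If [k] has at least three neighbours on the rim, the arcs between consecutive ones close up
    through [k] to odd induced cycles. Each spoke occurs in two of them, so an odd rim forces an odd
    number of neighbours; but [d] alternates from each neighbour to the next, which forces an even
    number. *)
Lemma wheel c : induced_cycle e c -> par f (cedges c) -> k \notin c ->
  count (e k) c <= 1 \/
  exists m x y p, [/\ rot m c = [:: x, y & p], e k x, e k y &
                      {in p, forall z, ~~ e k z}].
Proof.
move=> ic pc kc; case: (boolP (has (e k) c)) => [/hasP[x xc kx]|]; last first.
  by rewrite has_count -leqNgt leqn0 => /eqP->; left.
have [m [q cE]] := rot_to_cons xc.
have {ic} := induced_cycle_rot m ic; rewrite cE => ic.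
have {pc} : par f (cedges (x :: q)) by rewrite -cE par_cedges_rot.
move=> pc; have {kc} : k \notin x :: q by rewrite -cE mem_rot.
move=> kc.
have count_rot : count (e k) c = count (e k) (x :: q) by rewrite -cE; apply/seq.permP; rewrite perm_sym perm_rot.
have last_nb r : has (e k) r -> exists r1 y r2, [/\ r = r1 ++ y :: r2, e k y & {in r2, forall z, ~~ e k z}].
  elim: r => //= a r IH; case: (boolP (has (e k) r)) => [/IH[r1 [y [r2 [-> ky hr]]]] _|/hasPn hr].
    by exists (a :: r1), y, r2.
  by rewrite orbF => ka; exists [::], a, r.
case: (boolP (has (e k) q)) => [|]; last first.
  by rewrite has_count -leqNgt leqn0 => /eqP q0; left; rewrite count_rot /= q0 kx.
move=> /last_nb[q1 [y [q2 [qE ky kq2]]]]; rewrite {q}qE in cE ic pc kc count_rot.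
have arc2 : q1 != [::] -> induced_path e (y :: rcons q2 x).
  move=> q10; apply: (induced_arc q10); have := induced_cycle_rot (size q1).+1 ic.
  by rewrite -cat_cons -[(size q1).+1]/(size (x :: q1)) rot_size_cat.
have arc1 : q2 != [::] -> induced_path e (x :: rcons q1 y).
  by move=> q20; apply: (induced_arc q20).
have parE : par f (cedges (x :: q1 ++ y :: q2)) =
  par f (pedges (x :: rcons q1 y)) (+) par f (pedges (y :: rcons q2 x)).
  by rewrite [cedges _]/= rcons_cat -cat_cons pedges_cat par_cat.
have kn1 : k \notin x :: rcons q1 y.
  by move: kc; rewrite -cat_rcons -cat_cons mem_cat negb_or => /andP[].
have kn2 : k \notin y :: rcons q2 x.
  move: kc; rewrite !inE mem_cat mem_rcons !inE !negb_or => /and4P[-> _ -> ->] //.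
(* Here [x] and [y] are the first and the last neighbour of [k] on the rim; a third one, [z], is
   chosen as the last before [y]. *)
case: (boolP (has (e k) q1)) => [/last_nb[q3 [z [q4 [q1E kz kq4]]]]|/hasPn kq1].
  have q10 : q1 != [::] by rewrite q1E; case: (q3).
  have [P2 dyx] := cone_par (arc2 q10) kn2 ky kx kq2.
  have cE' : x :: q1 ++ y :: q2 = x :: q3 ++ z :: q4 ++ y :: q2.
    by rewrite q1E -catA.
  have ip3 : induced_path e (x :: rcons q3 z).
    by apply: (@induced_arc _ _ x q3 z (q4 ++ y :: q2)); [case: (q4)|rewrite -cE'].
  have ip4 : induced_path e (z :: rcons q4 y).
    apply: (@induced_arc _ _ z q4 y (q2 ++ x :: q3)); first by case: (q2).
    have := induced_cycle_rot (size q3).+1 ic.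
    rewrite cE' -[(size q3).+1]/(size (x :: q3)) -cat_cons rot_size_cat.
    by rewrite /= -!catA.
  have sub3 : {subset x :: rcons q3 z <= x :: rcons q1 y}.
    move=> a; rewrite q1E !inE !mem_rcons !inE mem_cat inE.
    by do ![case/orP] => ->; rewrite ?orbT.
  have sub4 : {subset z :: rcons q4 y <= x :: rcons q1 y}.
    move=> a; rewrite q1E !inE !mem_rcons !inE mem_cat inE.
    by do ![case/orP] => ->; rewrite ?orbT.
  have [P4 dzy] := cone_par ip4 (contra (sub4 k) kn1) kz ky kq4.
  have := walk_par ip3 (contra (sub3 k) kn1) kx.
  rewrite last_rcons => /(_ kz) P3.
  have P34 : par f (pedges (x :: rcons q1 y))
     = par f (pedges (x :: rcons q3 z)) (+) par f (pedges (z :: rcons q4 y)).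
    by rewrite q1E rcons_cat -cat_cons pedges_cat par_cat.
  move: pc; rewrite parE P34; move: P2 P3 P4; rewrite dzy dyx.
  by do 3![case: (par _ _)]; case: (f k x); case: (f k y); case: (f k z); case: (d x).
(* Only two neighbours: if both arcs between them have interior vertices, both close up through [k]
   to odd cycles, the spokes cancel, and the rim would be even. *)
right; case: (eqVneq q1 [::]) => [q10|q10].
  by rewrite q10 in cE; exists m, x, y, q2; split.
case: (eqVneq q2 [::]) => [q20|q20].
  rewrite q20 in cE *.
  have [m' m'E] : exists m', rot m' c = [:: y, x & q1].
    exists (rot_add c m (size q1).+1); rewrite -rot_rot_add cE.
    by rewrite -cat_cons -[(size q1).+1]/(size (x :: q1)) rot_size_cat.
  by exists m', y, x, q1; split.
have [P1 _] := cone_par (arc1 q20) kn1 kx ky kq1.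
have [P2 _] := cone_par (arc2 q10) kn2 ky kx kq2.
move: pc P1 P2; rewrite parE.
by do 2![case: (par _ _)]; case: (f k x); case: (f k y).
Qed.

End Wheel.

Local Open Scope ring_scope.

(** * Roots and reflections *)

Section FormTheory.
Variables (R : realFieldType) (n : nat) (Phi : root_system R n).
Notation g := (gram Phi).
Notation fm := (form g).
Implicit Types (u v w x y : 'cV[R]_n) (a b : root_of Phi).

Lemma formDl u v w : fm (u + v) w = fm u w + fm v w.
Proof. by rewrite /form linearD /= !mulmxDl mxE. Qed.

Lemma formZl c u v : fm (c *: u) v = c * fm u v.
Proof. by rewrite /form linearZ /= -!scalemxAl mxE. Qed.

Lemma form_sym u v : fm u v = fm v u.
Proof. exact: formC (gram_sym Phi). Qed.

Lemma formDr u v w : fm u (v + w) = fm u v + fm u w.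
Proof. by rewrite form_sym formDl !(form_sym u). Qed.

Lemma formZr c u v : fm u (c *: v) = c * fm u v.
Proof. by rewrite form_sym formZl (form_sym u). Qed.

Lemma formNl u v : fm (- u) v = - fm u v.
Proof. by rewrite -scaleN1r formZl mulN1r. Qed.

Lemma formNr u v : fm u (- v) = - fm u v.
Proof. by rewrite form_sym formNl form_sym. Qed.

Lemma form0l v : fm 0 v = 0.
Proof. by rewrite -(scale0r 0) formZl mul0r. Qed.

Lemma form_sumr (T : Type) (r : seq T) (F : T -> 'cV[R]_n) u :
  fm u (\sum_(i <- r) F i) = \sum_(i <- r) fm u (F i).
Proof.
elim: r => [|x r IH]; first by rewrite !big_nil form_sym form0l.
by rewrite !big_cons formDr IH.
Qed.

Lemma form_suml (T : Type) (r : seq T) (F : T -> 'cV[R]_n) u :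
  fm (\sum_(i <- r) F i) u = \sum_(i <- r) fm (F i) u.
Proof. by rewrite form_sym form_sumr; apply: eq_bigr => i _; apply: form_sym. Qed.

Lemma form_gt0 v : (0 < fm v v) = (v != 0).
Proof.
apply/idP/idP => [|h]; last exact: gram_pos.
by apply: contraTneq => ->; rewrite form0l ltxx.
Qed.

Lemma root_gt0 b : 0 < fm (val b) (val b).
Proof. by rewrite lt_def root_form_neq0 /=; case: (eqVneq (val b) 0) => [->|h]; [rewrite form0l|rewrite ltW // form_gt0]. Qed.

Lemma cpairE u w : cpair g u w = 2 * fm u w / fm w w.
Proof. by rewrite /cpair /coroot formZr; ring. Qed.

Lemma cpairDl u v w : cpair g (u + v) w = cpair g u w + cpair g v w.
Proof. by rewrite /cpair formDl. Qed.

Lemma cpairZl c u w : cpair g (c *: u) w = c * cpair g u w.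
Proof. by rewrite /cpair formZl. Qed.

Lemma cpairNl u w : cpair g (- u) w = - cpair g u w.
Proof. by rewrite /cpair formNl. Qed.

Lemma reflE v w : reflmx g w *m v = v - cpair g v w *: w.
Proof. exact: reflmxE (gram_sym Phi). Qed.

Lemma reflK v b : reflmx g (val b) *m (reflmx g (val b) *m v) = v.
Proof. by rewrite mulmxA reflmxK ?mul1mx ?gram_sym ?root_form_neq0. Qed.

Lemma form_refl u v b :
  fm (reflmx g (val b) *m u) (reflmx g (val b) *m v) = fm u v.
Proof.
rewrite !reflE !cpairE !(formDl, formDr, formNl, formNr, formZl, formZr).
rewrite (form_sym (val b) v).
by have := root_form_neq0 b => b0; field.
Qed.

Lemma cpair_refl u v b :
  cpair g (reflmx g (val b) *m u) (reflmx g (val b) *m v) = cpair g u v.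
Proof. by rewrite !cpairE !form_refl. Qed.

Lemma reflmx_refl v b :
  reflmx g (reflmx g (val b) *m v)
    = reflmx g (val b) *m reflmx g v *m reflmx g (val b).
Proof.
apply/matrixP => i j; pose d := delta_mx j 0 : 'cV[R]_n.
suff H : reflmx g (reflmx g (val b) *m v) *m d
    = reflmx g (val b) *m reflmx g v *m reflmx g (val b) *m d.
  by move/matrixP: H => /(_ i 0); rewrite -!colE !mxE.
rewrite -!mulmxA reflE (reflE _ v) mulmxBr reflK; congr (_ - _).
by rewrite -scalemxAr -{1}(reflK d b) cpair_refl.
Qed.

Lemma root_refl_in a b : reflmx g (val a) *m val b \in roots Phi.
Proof. by apply: roots_refl; apply: valP. Qed.

Definition rrefl a b : root_of Phi := SeqSub (root_refl_in a b).

Lemma rreflE a b : val (rrefl a b) = val b - cpair g (val b) (val a) *: val a.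
Proof. by rewrite /= reflE. Qed.

Lemma rreflK a b : rrefl a (rrefl a b) = b.
Proof. by apply: val_inj; rewrite /= reflK. Qed.

Lemma cpair_rrefl a b c :
  cpair g (val (rrefl c a)) (val (rrefl c b)) = cpair g (val a) (val b).
Proof. exact: cpair_refl. Qed.

Lemma cpair_self a : cpair g (val a) (val a) = 2.
Proof. by rewrite cpairbb ?root_form_neq0. Qed.

Lemma rrefl_self a : val (rrefl a a) = - val a.
Proof. by rewrite rreflE cpair_self scalerDl scale1r opprD addNKr. Qed.

Lemma cint_ex a b : exists z : int, cpair g (val a) (val b) == z%:~R.
Proof. by have [z ->] := roots_int (valP b) (valP a); exists z. Qed.

Definition cint a b : int := xchoose (cint_ex a b).

Lemma cintE a b : cpair g (val a) (val b) = (cint a b)%:~R.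
Proof. exact/eqP/(xchooseP (cint_ex a b)). Qed.

Lemma cint_eq a b z : cpair g (val a) (val b) = z%:~R -> cint a b = z.
Proof. by rewrite cintE => /eqP; rewrite eqr_int => /eqP. Qed.

Lemma form_cint a b : 2 * fm (val a) (val b) = (cint a b)%:~R * fm (val b) (val b).
Proof. by rewrite -cintE cpairE divfK // root_form_neq0. Qed.

Lemma cint_gt0 a b : (0 < cint a b) = (0 < fm (val a) (val b)).
Proof.
rewrite -(ltr0z R) -(pmulr_lgt0 _ (root_gt0 b)) -form_cint.
by rewrite pmulr_rgt0 // ltr0n.
Qed.

Lemma cint_gt0C a b : (0 < cint a b) = (0 < cint b a).
Proof. by rewrite !cint_gt0 form_sym. Qed.

Lemma cint_eq0 a b : (cint a b == 0) = (fm (val a) (val b) == 0).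
Proof.
rewrite -(intr_eq0 R) -cintE cpairE !mulf_eq0 invr_eq0.
by rewrite (negbTE (root_form_neq0 b)) orbF pnatr_eq0.
Qed.

Lemma cint_cocycle a b c :
  cint a b * cint b c * cint c a = cint a c * cint c b * cint b a.
Proof.
apply/eqP; rewrite -(eqr_int R) !intrM -!cintE !cpairE.
rewrite (form_sym (val c) (val a)) (form_sym (val c) (val b)) (form_sym (val b) (val a)).
apply/eqP; by field; rewrite !root_form_neq0.
Qed.

Definition indep a b := forall c d : R, c *: val a + d *: val b = 0 -> c = 0 /\ d = 0.

(* Strict Cauchy-Schwarz. *)
Lemma cint_le3 a b : indep a b -> cint a b * cint b a <= 3.
Proof.
move=> ind; suff : cint a b * cint b a < 4 by lia.
have fa := root_gt0 a; have fb := root_gt0 b.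
set A := val a in fa *; set B := val b in fb *.
have w0 : fm B B *: A - fm A B *: B != 0.
  apply/eqP; rewrite -scaleNr => /ind[h _].
  by rewrite h ltxx in fb.
have := form_gt0 (fm B B *: A - fm A B *: B); rewrite w0.
rewrite !(formDl, formDr, formNl, formNr, formZl, formZr) (form_sym B A).
set p := fm A A in fa *; set q := fm B B in fb *; set r := fm A B.
set X := (X in 0 < X); have -> : X = q * (p * q - r ^+ 2) by rewrite /X; ring.
rewrite pmulr_rgt0 // => h.
rewrite -(ltr_int R) intrM -!cintE !cpairE (form_sym B A) -/p -/q -/r.
have -> : 2 * r / q * (2 * r / p) = 4 * r ^+ 2 / (p * q) by field; rewrite !gt_eqF.
rewrite ltr_pdivrMr ?mulr_gt0 //; lra.
Qed.

End FormTheory.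

(** * Companions *)

Section Diagrams.
Variable n : nat.
Implicit Types (B : 'M[int]_n) (i j k : 'I_n).

Definition adj B : rel 'I_n := fun i j => B i j != 0.
Definition arr B : rel 'I_n := fun i j => 0 < B i j.

Definition sign_skew B : Prop := forall i j, (0 < B i j) = (B j i < 0).

Definition oriented B : Prop := forall c, induced_cycle (adj B) c ->
  cycle (arr B) c \/ cycle (arr B) (rev c).

Lemma sign_skew_diag B i : sign_skew B -> B i i = 0.
Proof. by move=> /(_ i i); lia. Qed.

Lemma sign_skew_lt B i j : sign_skew B -> (B i j < 0) = (0 < B j i).
Proof. by move=> /(_ j i). Qed.

Lemma sign_skew_eq0 B i j : sign_skew B -> B i j = 0 -> B j i = 0.
Proof. by move=> sk; have := sk i j; have := sk j i; lia. Qed.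

Lemma adj_sym B : sign_skew B -> symmetric (adj B).
Proof. by move=> sk i j; rewrite /adj; have := sk i j; have := sk j i; lia. Qed.

Lemma adj_irr B : sign_skew B -> irreflexive (adj B).
Proof. by move=> sk i; rewrite /adj sign_skew_diag ?eqxx. Qed.

Lemma mutate_mxE B k i j : mutate_mx k B i j =
  if (i == k) || (j == k) then - B i j else
  B i j + (if (0 < B i k) && (0 < B k j) then B i k * B k j
           else if (B i k < 0) && (B k j < 0) then - (B i k * B k j) else 0).
Proof.
rewrite mxE; case: ifP => // _; congr (_ + _).
set x := B i k; set y := B k j.
have E z w : w = z * 2 -> (w %/ 2)%Z = z by move=> ->; rewrite mulzK.
by do 2?[case: ifP] => h1; try move=> h2; apply: E; nia.
Qed.

Lemma induced_triangle (e : rel 'I_n) i j k : symmetric e -> irreflexive e ->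
  e i j -> e j k -> e k i -> induced_cycle e [:: i; j; k].
Proof.
move=> es ei ij jk ki.
have nij : i != j by apply: contraTneq ij => ->; rewrite ei.
have njk : j != k by apply: contraTneq jk => ->; rewrite ei.
have nki : k != i by apply: contraTneq ki => ->; rewrite ei.
split; first by rewrite /= !inE negb_or nij njk [i == k]eq_sym nki.
  by [].
have [ji kj ik] : [/\ e j i, e k j & e i k] by split; rewrite es.
move=> x y; rewrite !inE /cadj /cedges /pedges /= !inE !xpair_eqE.
have F (x' y' : 'I_n) : x' != y' -> (x' == y') = false /\ (y' == x') = false.
  by rewrite [y' == _]eq_sym => /negbTE->.
have [ij1 ij2] := F i j nij; have [jk1 jk2] := F j k njk; have [ki1 ki2] := F k i nki.
by case/or3P => /eqP->; case/or3P => /eqP->;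
  rewrite ?eqxx ?ei ?ij ?jk ?ki ?ji ?kj ?ik ?ij1 ?ij2 ?jk1 ?jk2 ?ki1 ?ki2.
Qed.

Lemma cycle3_rev (e : rel 'I_n) i j k : cycle e [:: i; j; k] || cycle e (rev [:: i; j; k])
  = [&& e i j, e j k & e k i] || [&& e j i, e k j & e i k].
Proof. by rewrite /= !andbT /rev /=; do 6!case: (e _ _). Qed.

(* The integer matrix a is a quasi-Cartan companion of B, with the
   consequences of positivity that the mutation argument uses. *)
Record positive_companion B (a : 'I_n -> 'I_n -> int) : Prop := PositiveCompanion {
  pc_abs : forall i j, i != j -> `|a i j| = `|B i j|;
  pc_sym : forall i j, (0 < a i j) = (0 < a j i);
  pc_cocycle : forall i j k, a i j * a j k * a k i = a i k * a k j * a j i;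
  pc_le3 : forall i j, i != j -> a i j * a j i <= 3;
  pc_refl_le3 : forall i j k, i != j -> j != k -> i != k ->
    (a i j - a i k * a k j) * (a j i - a j k * a k i) <= 3;
  pc_odd : forall c, induced_cycle (adj B) c ->
    par (fun x y => 0 < a x y) (cedges c)
}.

End Diagrams.

Section Companion.
Variables (R : realFieldType) (n : nat) (Phi : root_system R n).
Notation g := (gram Phi).
Implicit Types (B : 'M[int]_n) (b : 'I_n -> root_of Phi) (i j k : 'I_n).

Definition independent b : Prop := forall z : 'I_n -> R,
  \sum_i z i *: val (b i) = 0 -> forall i, z i = 0.

Definition companion B b : Prop :=
  independent b /\ forall i j, i != j -> `|cint (b i) (b j)| = `|B i j|.

(** The set [P] is left free: besides the sources of arrows into [k], a single vertex is reflected
    to obtain [pc_refl_le3]. *)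
Definition mutate_roots (P : pred 'I_n) k b i : root_of Phi :=
  if P i then rrefl (b k) (b i) else b i.

Lemma cint_rrefl_l (a b c : root_of Phi) :
  cint (rrefl c a) b = cint a b - cint a c * cint c b.
Proof.
apply: cint_eq; rewrite rreflE cpairDl cpairNl cpairZl !cintE.
by rewrite rmorphB rmorphM.
Qed.

Lemma cint_rrefl (a b c : root_of Phi) : cint (rrefl c a) (rrefl c b) = cint a b.
Proof. by apply: cint_eq; rewrite cpair_rrefl cintE. Qed.

Lemma cint_rrefl_r (a b c : root_of Phi) :
  cint a (rrefl c b) = cint a b - cint a c * cint c b.
Proof. by rewrite -{1}(rreflK c a) cint_rrefl cint_rrefl_l. Qed.

Lemma cint_self (a : root_of Phi) : cint a a = 2.
Proof. by apply: cint_eq; rewrite cpair_self. Qed.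

(** Each reflected root changes by a multiple of [b k], which is itself kept, so the change of
    family is unitriangular; [c] collects the multiples of [b k]. *)
Lemma independent_mutate P k b : ~~ P k -> independent b ->
  independent (mutate_roots P k b).
Proof.
move=> Pk ind z z0.
pose c := \sum_(i | P i) z i * cpair g (val (b i)) (val (b k)).
pose z' i := if i == k then z k - c else z i.
have z'0 : \sum_i z' i *: val (b i) = 0.
  rewrite -[RHS]z0 (bigD1 k) //= [RHS](bigD1 k) //=.
  rewrite /mutate_roots (negbTE Pk) /z' eqxx scalerBl -addrA; congr (_ + _).
  transitivity (- (c *: val (b k)) + \sum_(i | i != k) z i *: val (b i)).
    by congr (_ + _); apply: eq_bigr => i /negbTE->.
  have -> : c *: val (b k) = \sum_(i | i != k)
      if P i then (z i * cpair g (val (b i)) (val (b k))) *: val (b k) else 0.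
    rewrite -big_mkcondr /c scaler_suml; apply: eq_bigl => i.
    by case: eqVneq => //= ->; rewrite (negbTE Pk).
  rewrite -sumrN -big_split /=; apply: eq_bigr => i _.
  case: (P i); last by rewrite oppr0 add0r.
  by rewrite -scalerA addrC -scalerBr; congr (_ *: _); rewrite [RHS]rreflE.
have h := ind z' z'0.
have zi i : i != k -> z i = 0 by move=> ik; have := h i; rewrite /z' (negbTE ik).
have := h k; rewrite /z' eqxx /c big1 ?subr0 => [zk i|i Pi].
  by case: (eqVneq i k) => [->//|/zi].
by rewrite zi ?mul0r //; apply: contraNneq Pk => <-.
Qed.

Lemma independent_pair b i j : independent b -> i != j -> indep (b i) (b j).
Proof.
move=> ind ij c d cd; pose z x := if x == i then c else if x == j then d else 0.
have z0 : \sum_x z x *: val (b x) = 0.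
  rewrite (bigD1 i) //= (bigD1 j) ?(eq_sym j) //= big1 => [|x /andP[xi xj]].
    by rewrite /z !eqxx eq_sym (negbTE ij) addr0.
  by rewrite /z (negbTE xi) (negbTE xj) scale0r.
have h := ind z z0; have := h i; have := h j; rewrite /z !eqxx eq_sym (negbTE ij).
by move=> -> ->.
Qed.

Definition family_mx b : 'M[R]_n := \matrix_(i, j) val (b j) i 0.

Lemma col_family_mx b j : col j (family_mx b) = val (b j).
Proof. by apply/matrixP => i x; rewrite !mxE ord1. Qed.

Lemma independent_unitmx b : independent b -> family_mx b \in unitmx.
Proof.
move=> ind; rewrite -unitmx_tr -row_free_unit; apply: inj_row_free => u.
rewrite mulmx_sum_row => u0.
have u0' : \sum_i u 0 i *: val (b i) = 0.
  apply: trmx_inj; rewrite trmx0 -[RHS]u0 linear_sum /=.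
  by apply: eq_bigr => i _; rewrite linearZ /= -tr_col col_family_mx.
by apply/rowP => i; rewrite (ind _ u0') mxE.
Qed.

Lemma independent_mx_eq b (X Y : 'M[R]_n) : independent b ->
  (forall i, X *m val (b i) = Y *m val (b i)) -> X = Y.
Proof.
move=> ind h; have e : X *m family_mx b = Y *m family_mx b.
  apply/matrixP => i j; have := h j.
  by rewrite -col_family_mx colE !mulmxA -!colE => /matrixP/(_ i 0); rewrite !mxE.
by rewrite -(mulmxK (independent_unitmx ind) X) e mulmxK ?independent_unitmx.
Qed.

(** * Squared length of the sum of vectors along a path or a cycle *)

Section QuadraticForm.
Variable v : 'I_n -> 'cV[R]_n.
Notation F x y := (form g (v x) (v y)).

Lemma form_consE x U :
  form g (v x + U) (v x + U) = F x x + 2 * form g (v x) U + form g U U.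
Proof. by rewrite !(formDl, formDr) (form_sym _ U (v x)); ring. Qed.

Lemma form_path p : uniq p ->
  {in p &, forall x y, x != y -> ~~ padj p x y -> F x y = 0} ->
  form g (\sum_(x <- p) v x) (\sum_(x <- p) v x)
    = \sum_(x <- p) F x x + 2 * \sum_(a <- pedges p) F a.1 a.2.
Proof.
elim: p => [|x p IH]; first by rewrite !big_nil form0l mulr0 addr0.
case: p IH => [|y q] IH; first by rewrite !big_seq1 big_nil mulr0 addr0.
rewrite cons_uniq => /andP[xn u] h; rewrite big_cons form_consE IH //.
  rewrite pedges_cons [\sum_(i <- x :: _) F i i]big_cons.
  rewrite [\sum_(i <- _ :: pedges _) _]big_cons /=.
  suff -> : form g (v x) (\sum_(i <- y :: q) v i) = F x y by ring.
  rewrite big_cons formDr form_sumr big_seq big1 ?addr0 // => z zq.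
  have zp : z \in y :: q by rewrite inE zq orbT.
  apply: h; rewrite ?inE ?eqxx // ?zq ?orbT //; first by apply: contraNneq xn => ->.
  have zx : z != x by apply: contraNneq xn => <-.
  rewrite /padj pedges_cons !inE !xpair_eqE eqxx (negbTE zx) /= !negb_or.
  have zy : z != y by move: u; rewrite cons_uniq => /andP[yq _]; apply: contraNneq yq => <-.
  by rewrite zy /=; apply/andP; split; apply/negP => /mem_pedges[]; rewrite (negbTE xn).
move=> a b aP bP ab nab; apply: h => //; rewrite ?[_ \in x :: _]inE ?aP ?bP ?orbT //.
rewrite /padj pedges_cons !inE !xpair_eqE; move: nab; rewrite /padj.
have -> : (a == x) = false by apply: contraNF xn => /eqP<-.
by have -> : (b == x) = false by apply: contraNF xn => /eqP<-.
Qed.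

Lemma form_cycle c : uniq c -> (2 < size c)%N ->
  {in c &, forall x y, x != y -> ~~ cadj c x y -> F x y = 0} ->
  form g (\sum_(x <- c) v x) (\sum_(x <- c) v x)
    = \sum_(x <- c) F x x + 2 * \sum_(a <- cedges c) F a.1 a.2.
Proof.
case: c => [|x [|y q]] //; case/lastP: q => // q z.
rewrite cons_uniq => /andP[xn u] _ h.
have cE : cedges [:: x, y & rcons q z]
    = (x, y) :: rcons (pedges (y :: rcons q z)) (z, x) by rewrite -cedges_cons.
have nx w : w \in y :: rcons q z -> (w == x) = false.
  by move=> wP; apply: contraNF xn => /eqP<-.
have nx1 w : ((x, w) \in pedges (y :: rcons q z)) = false.
  by apply/negP => /mem_pedges[]; rewrite (negbTE xn).
have nx2 w : ((w, x) \in pedges (y :: rcons q z)) = false.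
  by apply/negP => /mem_pedges[]; rewrite (negbTE xn).
rewrite big_cons form_consE form_path //.
  rewrite [\sum_(i <- x :: _) F i i]big_cons cE.
  rewrite [\sum_(i <- _ :: rcons (pedges _) _) _]big_cons [\sum_(i <- rcons (pedges _) _) _]big_rcons /=.
  suff -> : form g (v x) (\sum_(j <- y :: rcons q z) v j) = F x y + F z x by ring.
  rewrite big_cons big_rcons /= !formDr (form_sym _ (v z)) form_sumr big_seq big1 ?add0r //.
  move=> w wq; have wP : w \in y :: rcons q z by rewrite inE mem_rcons inE wq !orbT.
  apply: h; rewrite ?inE ?eqxx ?mem_rcons ?inE ?wq ?orbT //; first by rewrite eq_sym nx.
  rewrite /cadj cE !inE !mem_rcons !inE nx1 nx2 !xpair_eqE eqxx nx // !orbF /=.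
  rewrite !andbT negb_or; move: u; rewrite cons_uniq rcons_uniq mem_rcons inE negb_or.
  case/and3P => /andP[_ yq] zq _.
  by rewrite andbF orbF; apply/andP; split; [apply: contraNneq yq => <-|apply: contraNneq zq => <-].
move=> a b aP bP ab nab; apply: h => //; rewrite ?[_ \in x :: _]inE ?aP ?bP ?orbT //.
rewrite /cadj cE !inE !mem_rcons !inE !xpair_eqE !nx // !andbF /=.
by move: nab; rewrite /padj.
Qed.

(* The sum of the vectors along the cycle is isotropic or worse, because
   -2(v_x, v_y) is at least the square of the length of v_x. *)
Lemma form_cycle_le0 c : uniq c -> (2 < size c)%N ->
  {in c &, forall x y, x != y -> ~~ cadj c x y -> F x y = 0} ->
  (forall x y, (x, y) \in cedges c -> 2 * F x y <= - F x x) ->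
  form g (\sum_(x <- c) v x) (\sum_(x <- c) v x) <= 0.
Proof.
move=> u s h le; rewrite form_cycle // mulr_sumr.
have -> : \sum_(x <- c) F x x = \sum_(a <- cedges c) F a.1 a.1.
  by rewrite -[in LHS](cedges_fst c) big_map.
rewrite -big_split big_seq; apply: sumr_le0 => -[x y] /le /=; lra.
Qed.

End QuadraticForm.

(** On a path the signs can be chosen one edge at a time. The value at the far end is the parity of
    the whole path, which decides whether a closing edge fits as well. *)
Lemma path_potential (T : eqType) (f : T -> T -> bool) x (q : seq T) : uniq (x :: q) ->
  exists eps : T -> bool,
    [/\ eps x = false, eps (last x q) = par f (pedges (x :: q)) &
        forall y z, (y, z) \in pedges (x :: q) -> f y z = eps y (+) eps z].
Proof.
elim: q x => [|y q IH] x; first by exists (fun=> false); rewrite par_nil.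
rewrite cons_uniq => /andP[xn /IH[eps [e1 e2 e3]]].
exists (fun z => if z == x then false else eps z (+) f x y).
have nx w : w \in y :: q -> (w == x) = false.
  by move=> wP; apply: contraNF xn => /eqP<-.
rewrite eqxx pedges_cons par_cons -e2 [last x _]/= nx ?mem_last //.
split=> //; first by rewrite addbC.
move=> a b; rewrite inE xpair_eqE => /orP[/andP[/eqP-> /eqP->]|ab].
  by rewrite eqxx nx ?inE ?eqxx // e1.
have [aP bP] := mem_pedges ab; rewrite !nx // (e3 _ _ ab).
by case: (eps a); case: (eps b); case: (f x y).
Qed.

Lemma companion_odd B b c : companion B b -> induced_cycle (adj B) c ->
  par (fun x y => 0 < cint (b x) (b y)) (cedges c).
Proof.
move=> [ind bB] [u s h]; apply/negPn/negP => /negbTE p0.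
(* An even parity makes the signs chosen along the path agree with the closing edge too, so that
   after the sign changes all pairings along the cycle are negative. *)
have [eps epsP] : exists eps : 'I_n -> bool, forall x y, (x, y) \in cedges c ->
    (0 < cint (b x) (b y)) = eps x (+) eps y.
  case: (c) u p0 => [|x q] u p0; first by exists (fun=> false).
  have [eps [e1 e2 e3]] := path_potential (fun x y => 0 < cint (b x) (b y)) u.
  exists eps => a d; move: p0; rewrite /= -rcons_cons lastI pedges_rcons -lastI.
  rewrite par_rcons -e2 mem_rcons inE xpair_eqE /= => p0.
  by case/orP => [/andP[/eqP-> /eqP->]|/e3//]; rewrite e1; move: p0; case: (eps _); case: (0 < _).
pose sg x : R := (-1) ^+ (eps x).
pose v x := sg x *: val (b x).
have sg2 x : sg x * sg x = 1 by rewrite /sg; case: (eps x); rewrite ?expr0 ?expr1; ring.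
have vE x y : form g (v x) (v y) = sg x * sg y * form g (val (b x)) (val (b y)).
  by rewrite /v formZl formZr mulrA.
have le0 : form g (\sum_(x <- c) v x) (\sum_(x <- c) v x) <= 0.
  apply: form_cycle_le0 => // x y.
    move=> xc yc xy; rewrite -h // /adj negbK -normr_eq0 -bB // normr_eq0.
    by rewrite cint_eq0 vE => /eqP->; rewrite mulr0.
  move=> xy; have [xc yc] := mem_cedges xy.
  have nxy : x != y.
    by apply: contraTneq xy => ->; apply/negP; apply: cedges_irr; rewrite ?(ltnW s).
  have /h := xc; move=> /(_ y yc); rewrite /cadj xy /= => a0.
  have {}a0 : cint (b y) (b x) != 0.
    by rewrite cint_eq0 form_sym -cint_eq0 -normr_eq0 bB // normr_eq0.
  rewrite !vE sg2 mul1r.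
  (* A negative integer is at most -1; this is the inequality that [form_cycle_le0] asks for. *)
  have : sg x * sg y * (cint (b y) (b x))%:~R <= -1 :> R.
    have := epsP x y xy; rewrite cint_gt0C /sg.
    case: (eps x); case: (eps y) => /= s0; rewrite ?expr0 ?expr1 ?mulrNN ?mulrN ?mulNr ?mul1r;
     rewrite -1?mulrNz -[-1]/((-1)%:~R) ?ler_int; lia.
  have gx := root_gt0 (b x).
  have -> : 2 * (sg x * sg y * form g (val (b x)) (val (b y))) =
      (sg x * sg y * (cint (b y) (b x))%:~R) * form g (val (b x)) (val (b x)).
    by rewrite -[RHS]mulrA -form_cint (form_sym _ (val (b x))); ring.
  by move=> le; rewrite -[X in _ <= X]mulN1r; apply: ler_wpM2r => //; exact: ltW.
have u0 : \sum_(x <- c) v x = 0.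
  by apply/eqP; apply: contraTT le0 => h0; rewrite -ltNge form_gt0.
pose z i : R := if i \in c then sg i else 0.
have z0 : \sum_i z i *: val (b i) = 0.
  rewrite -[RHS]u0 [RHS]big_uniq // [RHS]big_mkcond; apply: eq_bigr => i _.
  by rewrite /z /v; case: (i \in c); rewrite ?scale0r.
have x0 : 'I_n by case: (c) s => // x.
have xc : nth x0 c 0 \in c by rewrite mem_nth // ltnW // ltnW.
have := sg2 (nth x0 c 0); have := ind z z0 (nth x0 c 0); rewrite /z xc => ->.
by rewrite mulr0 => /eqP; rewrite eq_sym oner_eq0.
Qed.

Lemma companion_positive B b : companion B b ->
  positive_companion B (fun i j => cint (b i) (b j)).
Proof.
move=> cb; have [ind bB] := cb; split=> //.
- by move=> i j; apply: cint_gt0C.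
- by move=> i j k; apply: cint_cocycle.
- by move=> i j ij; apply/cint_le3/independent_pair.
(* Cauchy-Schwarz for [b j] and the reflection of [b i] in [b k]; only [b i] is reflected, and the
   two factors are the Cartan integers of that pair. *)
- move=> i j k ij jk ik.
  have ind' : independent (mutate_roots (pred1 i) k b).
    by apply: independent_mutate; rewrite //= eq_sym.
  have := cint_le3 (independent_pair ind' ij).
  by rewrite /mutate_roots /= eqxx (eq_sym j) (negbTE ij) cint_rrefl_l cint_rrefl_r.
- by move=> c; apply: companion_odd.
Qed.

Lemma positive_companion_triangle B (a : 'I_n -> 'I_n -> int) i j k : sign_skew B ->
  positive_companion B a -> B i j != 0 -> B j k != 0 -> B k i != 0 ->
  (0 < a i j) = ((0 < a j k) == (0 < a k i)).
Proof.
move=> sk pa ij jk ki; have := induced_triangle (adj_sym sk) (adj_irr sk) ij jk ki.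
move/(pc_odd pa); rewrite /cedges /= /pedges /= !par_cons par_nil /=.
by case: (0 < a i j); case: (0 < a j k); case: (0 < a k i).
Qed.

Lemma oriented_triangle B i j k : sign_skew B -> oriented B ->
  B i j != 0 -> B j k != 0 -> B k i != 0 ->
  [&& 0 < B i j, 0 < B j k & 0 < B k i] || [&& 0 < B j i, 0 < B k j & 0 < B i k].
Proof.
move=> sk ori ij jk ki; have := induced_triangle (adj_sym sk) (adj_irr sk) ij jk ki.
by move/ori/orP; rewrite cycle3_rev.
Qed.

(** Reflecting one of the two roots subtracts [a i k * a k j] from [a i j]. On a triangle the odd
    number of positive entries gives these two terms the same sign, so absolute values are
    subtracted; the cyclic orientation makes the mutation of [B] subtract absolute values as
    well. *)
Lemma companion_mutate B b k : sign_skew B -> oriented B -> companion B b ->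
  companion (mutate_mx k B) (mutate_roots (fun i => 0 < B i k) k b).
Proof.
move=> sk ori cb; have [ind bB] := cb; have pa := companion_positive cb.
have kk : B k k = 0 by apply: sign_skew_diag.
split; first by apply: independent_mutate; rewrite ?kk.
have key i j : i != j -> i != k -> j != k -> (0 < B i k) != (0 < B j k) ->
   `|cint (rrefl (b k) (b i)) (b j)| = `|mutate_mx k B i j|.
  move=> ij ik jk Bijk; rewrite cint_rrefl_l mutate_mxE (negbTE ik) (negbTE jk).
  have aij := bB i j ij; have aik := bB i k ik.
  have akj : `|cint (b k) (b j)| = `|B k j| by apply: bB; rewrite eq_sym.
  have s1 := sk k j; have s2 := sk j k; have s3 := sk i k; have s4 := sk k i.
  have s5 := sk i j; have s6 := sk j i.
  case: (eqVneq (B k j) 0) => [z|nz].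
    have c0 : cint (b k) (b j) = 0 by apply/eqP; rewrite -normr_eq0 akj z.
    by rewrite c0 mulr0 subr0 z ltxx !andbF addr0.
  case: (eqVneq (B i k) 0) => [z|nz'].
    have c0 : cint (b i) (b k) = 0 by apply/eqP; rewrite -normr_eq0 aik z.
    by rewrite c0 mul0r subr0 z ltxx addr0.
  have jk0 : B j k != 0 by lia.
  have ki0 : B k i != 0 by lia.
  case: (eqVneq (B i j) 0) => [z|nzij].
    have c0 : cint (b i) (b j) = 0 by apply/eqP; rewrite -normr_eq0 aij z.
    rewrite c0 z sub0r add0r normrN normrM aik akj -normrM.
    by case: ifP => h1 //; case: ifP => h2; [rewrite normrN | lia].
  have := oriented_triangle sk ori nzij jk0 ki0.
  have := positive_companion_triangle sk pa nzij jk0 ki0.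
  have sjk := pc_sym pa j k; have ski := pc_sym pa k i.
  rewrite sjk ski => tri o.
  case/orP: o => /and3P[o1 o2 o3].
    have p1 : B i k < 0 by lia.
    have p2 : B k j < 0 by lia.
    by rewrite (lt_gtF p1) p1 p2 /=; nia.
  have p1 : B i j < 0 by lia.
  by rewrite o2 o3 /=; nia.
move=> i j ij; rewrite /mutate_roots.
have s1 := sk k j; have s2 := sk j k; have s3 := sk i k; have s4 := sk k i.
case: (eqVneq i k) => [ik|ik].
  rewrite ik in ij *; rewrite kk ltxx mutate_mxE eqxx /= normrN -bB //.
  case: ifP => // _; rewrite cint_rrefl_r cint_self; lia.
case: (eqVneq j k) => [jk|jk].
  rewrite jk in ij *; rewrite kk ltxx mutate_mxE eqxx orbT normrN -bB //.
  case: ifP => // _; rewrite cint_rrefl_l cint_self; lia.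
have bij := bB i j ij.
case: (ltP 0 (B i k)) => Bik; case: (ltP 0 (B j k)) => Bjk.
- rewrite cint_rrefl mutate_mxE (negbTE ik) (negbTE jk) bij /=.
  by rewrite Bik (lt_gtF Bik) -s2 Bjk (_ : (0 < B k j) = false) ?addr0 //; lia.
- by apply: key => //; rewrite Bik ltNge Bjk.
- by rewrite cint_rrefl_r -cint_rrefl_l; apply: key => //; rewrite Bjk ltNge Bik.
- rewrite mutate_mxE (negbTE ik) (negbTE jk) bij /=.
  case: ifP => [|_]; first lia.
  by case: ifP => [|_]; first lia; rewrite addr0.
Qed.

End Companion.

(** * Mutation of oriented diagrams *)

(* lia and nia split on every boolean hypothesis, so membership facts are
   removed first. *)
Ltac drop_mem := repeat match goal with
  | H : context [@in_mem] |- _ => clear H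
  | H : context [@mem] |- _ => clear H
  | H : context [@uniq] |- _ => clear H
  | H : context [@induced_cycle] |- _ => clear H
  end.
Ltac zlia := drop_mem; lia.
Ltac znia := drop_mem; nia.

Section Symmetriser.
Variable n : nat.
Implicit Types (B : 'M[int]_n) (i j k : 'I_n).

Definition skew_by (d : 'I_n -> rat) B : Prop :=
  (forall i, 0 < d i) /\ forall i j, d i * (B i j)%:~R = - (d j * (B j i)%:~R).

Lemma skew_by_sign d B : skew_by d B -> sign_skew B.
Proof.
move=> [d0 dB] i j; have := dB i j => h.
rewrite -(ltr0z rat) -(ltrz0 rat) -(pmulr_rgt0 _ (d0 i)) h oppr_gt0.
by rewrite pmulr_rlt0.
Qed.

Lemma skew_by_mutate d B k : skew_by d B -> skew_by d (mutate_mx k B).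
Proof.
move=> dB; have sk := skew_by_sign dB; have [d0 dE] := dB; split=> // i j.
rewrite !mutate_mxE [(j == k) || _]orbC.
case: ifP => _; first by rewrite !rmorphN /= !mulrN dE.
have E1 := dE i k; have E2 := dE k j; have E0 := dE i j.
(* The correction term obeys the symmetrising identity with the same [d]: the factor [d k] is passed
   on at the middle vertex, and the two signs cancel. *)
have P : d i * (B i k * B k j)%:~R = d j * (B j k * B k i)%:~R.
  transitivity (- ((B k i)%:~R * (d k * (B k j)%:~R)) : rat).
    by rewrite rmorphM /= mulrA E1; ring.
  by rewrite E2 rmorphM /=; ring.
rewrite !rmorphD /= !mulrDr E0 opprD; congr (_ + _).
have s1 := sk i k; have s2 := sk k i; have s3 := sk j k; have s4 := sk k j.
case: ifP => h1; [|case: ifP => h2]; (case: ifP => h3; [|case: ifP => h4]);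
  rewrite ?rmorphN /= ?mulrN ?P ?opprK ?mulr0 ?oppr0 //; lia.
Qed.

Lemma mutate_mxK B k : mutate_mx k (mutate_mx k B) = B.
Proof.
apply/matrixP => i j; rewrite !mutate_mxE !eqxx !orbT /=.
case: ifP => h; rewrite h ?opprK // !mulrNN !oppr_gt0 !oppr_lt0.
case: ifP => h1; case: ifP => h2; rewrite ?addrK ?addrNK ?addr0 //; first lia.
Qed.

End Symmetriser.

Lemma companion_weight n (B : 'M[int]_n) a x y :
  positive_companion B a -> x != y -> `|B x y * B y x| <= 3.
Proof.
move=> pa xy; have yx : y != x by rewrite eq_sym.
rewrite normrM -(pc_abs pa xy) -(pc_abs pa yx) -normrM ger0_norm ?(pc_le3 pa xy) //.
by have := pc_sym pa x y; nia.
Qed.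

Section MutatedCycles.
Variables (n : nat) (B : 'M[int]_n) (k : 'I_n).
Notation B' := (mutate_mx k B).
Implicit Types (i j x y : 'I_n) (c p q : seq 'I_n).
Hypotheses (skB : sign_skew B) (skB' : sign_skew B').
Hypothesis oriB : oriented B.

Let EB' x y : x != k -> y != k -> B' x y =
  B x y + (if (0 < B x k) && (0 < B k y) then B x k * B k y
           else if (B x k < 0) && (B k y < 0) then - (B x k * B k y) else 0).
Proof. by move=> xk yk; rewrite mutate_mxE (negbTE xk) (negbTE yk). Qed.

Let EB x y : x != k -> y != k -> B x y =
  B' x y + (if (0 < B' x k) && (0 < B' k y) then B' x k * B' k y
           else if (B' x k < 0) && (B' k y < 0) then - (B' x k * B' k y) else 0).
Proof.
by move=> xk yk; rewrite -{1}(mutate_mxK B k) mutate_mxE (negbTE xk) (negbTE yk).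
Qed.

Lemma mutate_row y : B' k y = - B k y.
Proof. by rewrite mutate_mxE eqxx. Qed.

Lemma mutate_col x : B' x k = - B x k.
Proof. by rewrite mutate_mxE eqxx orbT. Qed.

Lemma mutate_same x y : ~~ ((0 < B x k) && (0 < B k y)) ->
  ~~ ((B x k < 0) && (B k y < 0)) -> x != k -> y != k -> B' x y = B x y.
Proof. by move=> /negbTE h1 /negbTE h2 xk yk; rewrite EB' // h1 h2 addr0. Qed.

Lemma mutate_nonadj x y : B x k = 0 -> x != k -> y != k -> B' x y = B x y.
Proof. by move=> xk0 xk yk; rewrite EB' // xk0 ltxx /= addr0. Qed.

Lemma mutate_nonadj_r x y : B k y = 0 -> x != k -> y != k -> B' x y = B x y.
Proof. by move=> xk0 xk yk; rewrite EB' // xk0 ltxx !andbF addr0. Qed.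

Lemma eq_cycle_arr c : {in c &, forall x y, B' x y = B x y} ->
  cycle (arr B') c = cycle (arr B) c.
Proof.
move=> h; rewrite !cycle_cedges; apply: eq_in_all => -[x y] /mem_cedges[xc yc].
by rewrite /arr /= h.
Qed.

Lemma same_induced c : {in c &, forall x y, B' x y = B x y} ->
  induced_cycle (adj B') c -> induced_cycle (adj B) c.
Proof. by move=> h; apply: eq_induced_cycle => x y xc yc; rewrite /adj h. Qed.

Lemma same_oriented c : {in c &, forall x y, B' x y = B x y} ->
  induced_cycle (adj B') c -> cycle (arr B') c \/ cycle (arr B') (rev c).
Proof.
move=> h /(same_induced h)/oriB; rewrite !eq_cycle_arr //.
by move=> x y; rewrite !mem_rev; apply: h.
Qed.

(** * Chordless cycles of the mutated diagram through [k] *)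

Section Through.
Variables (i j : 'I_n) (p : seq 'I_n).
Hypothesis ic : induced_cycle (adj B') [:: i, k, j & p].

Let uc : uniq [:: i, k, j & p]. Proof. by case: ic. Qed.

Let cE : cedges [:: i, k, j & p] = [:: (i, k), (k, j) & pedges (j :: rcons p i)].
Proof. by []. Qed.

Let ik : i != k.
Proof. by move: uc; rewrite /= !inE !negb_or => /andP[/and3P[]]. Qed.
Let ij : i != j.
Proof. by move: uc; rewrite /= !inE !negb_or => /andP[/and3P[]]. Qed.
Let jk : j != k.
Proof. by rewrite eq_sym; move: uc; rewrite /= !inE !negb_or => /and3P[_ /andP[]]. Qed.
Let kp : k \notin p.
Proof. by move: uc; rewrite /= !inE !negb_or => /and3P[_ /andP[]]. Qed.

Let ip : i \notin p.
Proof. by move: uc; rewrite /= !inE !negb_or => /andP[/and3P[]]. Qed.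
Let jp : j \notin p.
Proof. by move: uc; rewrite /= => /and4P[]. Qed.

Let kn1 x : ((k, x) \in pedges (j :: rcons p i)) = false.
Proof.
apply/negP => /mem_pedges[]; rewrite inE mem_rcons inE eq_sym (negbTE jk).
by rewrite eq_sym (negbTE ik) (negbTE kp).
Qed.
Let kn2 x : ((x, k) \in pedges (j :: rcons p i)) = false.
Proof.
apply/negP => /mem_pedges[_]; rewrite inE mem_rcons inE eq_sym (negbTE jk).
by rewrite eq_sym (negbTE ik) (negbTE kp).
Qed.

Lemma through_adj : B' k i != 0 /\ B' k j != 0.
Proof.
case: ic => _ _ h; split; rewrite -/(adj B' _ _) h ?inE ?eqxx ?orbT //.
  by rewrite /cadj cE !inE eqxx !orbT.
by rewrite /cadj cE !inE eqxx !orbT.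
Qed.

Lemma through_nonadj x : x \in p -> B' k x = 0.
Proof.
move=> xp; apply/eqP; rewrite -[_ == 0]negbK -/(adj B' k x).
case: ic => _ _ h; rewrite h ?inE ?eqxx ?xp ?orbT //.
have xi : (x == i) = false by apply: contraNF ip => /eqP<-.
have xj : (x == j) = false by apply: contraNF jp => /eqP<-.
have xk : (x == k) = false by apply: contraNF kp => /eqP<-.
by rewrite /cadj cE !inE !xpair_eqE kn1 kn2 eqxx xi xj xk (eq_sym k) (negbTE ik) (eq_sym k) (negbTE jk).
Qed.

Lemma through_p_same x y : x \in p -> y \in [:: i, j & p] -> B x y = B' x y.
Proof.
move=> xp yp; have := through_nonadj xp; rewrite mutate_row => k0.
rewrite mutate_nonadj //; last 2 first.
- by apply: contraNneq kp => <-.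
- by move: yp; rewrite !inE => /or3P[/eqP->|/eqP->|yp] //; apply: contraNneq kp => <-.
by have := skB k x; have := skB x k; zlia.
Qed.

Lemma through_adjE : {in [:: i, j & p] &, forall x y,
  adj B' x y = ((x, y) \in pedges (j :: rcons p i)) || ((y, x) \in pedges (j :: rcons p i))}.
Proof.
move=> x y xp yp; case: ic => _ _ h; rewrite h ?inE; last 2 first.
- by move: xp; rewrite !inE => /or3P[] ->; rewrite ?orbT.
- by move: yp; rewrite !inE => /or3P[] ->; rewrite ?orbT.
have nk z : z \in [:: i, j & p] -> (z == k) = false.
  rewrite !inE => /or3P[/eqP->|/eqP->|zp]; rewrite ?(negbTE ik) ?(negbTE jk) //.
  by apply: contraNF kp => /eqP<-.
by rewrite /cadj cE !inE !xpair_eqE !nk // !andbF.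
Qed.

Hypotheses (Bik : 0 < B' i k) (Bkj : 0 < B' k j).

Lemma through_edge : B i j = B' i j + B' i k * B' k j.
Proof. by rewrite EB // Bik Bkj. Qed.

(** In a chordless cycle of length at least 4 the vertices [i] and [j] are not joined after the
    mutation, so mutating back creates the arrow from [i] to [j] that short-cuts [k]; the entries
    involving [p] do not change. *)
Lemma through_shrink : p != [::] -> 
  [/\ B' i j = 0, 0 < B i j & induced_cycle (adj B) [:: i, j & p]].
Proof.
move=> p0; have pE : exists z r, p = z :: r by case: (p) p0 => // z r; exists z, r.
have up : uniq [:: i, j & p].
  have up : uniq p by move: uc => /and4P[].
  by rewrite /= inE negb_or ij ip jp up.
have nij : adj B' i j = false.
  rewrite through_adjE ?inE ?eqxx ?orbT //.
  case: pE => z [r pE]; rewrite pE rcons_cons pedges_cons !inE !xpair_eqE eqxx (negbTE ij) /=.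
  have iz : (i == z) = false by apply: contraNF ip => /eqP->; rewrite pE inE eqxx.
  rewrite iz /=; have nj : j \notin z :: rcons r i.
    by rewrite -rcons_cons mem_rcons inE negb_or eq_sym ij -pE.
  by apply/negP => /orP[] /mem_pedges[]; rewrite (negbTE nj).
have B'0 : B' i j = 0 by apply/eqP; rewrite -[_ == 0]negbK -/(adj B' i j) nij.
have Bij : 0 < B i j by rewrite through_edge B'0 add0r; znia.
split=> //; split=> //; first by case: (p) p0.
move=> x y xp yp.
have -> : cadj [:: i, j & p] x y = [|| (x, y) == (i, j), (y, x) == (i, j) | adj B' x y].
  rewrite through_adjE // /cadj /cedges rcons_cons pedges_cons !inE.
  by do 4?case: (_ \in _); do 2?case: (_ == _).
have eqv : (x \in p) || (y \in p) -> adj B x y = adj B' x y.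
  case/orP => h; first by rewrite /adj through_p_same.
  by rewrite (adj_sym skB) (adj_sym skB') /adj through_p_same.
have ne u v : (u \in p) -> ((u, v) == (i, j)) || ((v, u) == (i, j)) = false.
  move=> zp; rewrite !xpair_eqE; move: up; rewrite /= !inE !negb_or => /and3P[/andP[_ h1] h2 _].
  have -> : (u == i) = false by apply: contraNF h1 => /eqP<-.
  have -> : (u == j) = false by apply: contraNF h2 => /eqP<-.
  by rewrite andbF.
case: (boolP (x \in p)) => xp'; first by rewrite orbA ne // eqv // xp'.
case: (boolP (y \in p)) => yp'; first by rewrite orbA [_ || (_ == _)]orbC ne // eqv // yp' orbT.
move: xp yp; rewrite !inE (negbTE xp') (negbTE yp') !orbF.
have Bji : B j i != 0 by have := skB i j; zlia.
have Bij0 : B i j != 0 by zlia.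
have ji : (j == i) = false by rewrite eq_sym (negbTE ij).
by case/orP => /eqP->; case/orP => /eqP->;
  rewrite !xpair_eqE ?eqxx ?(negbTE ij) ?ji ?(adj_irr skB) ?(adj_irr skB') ?andbF ?orbT.
Qed.

Lemma through_oriented : p != [::] -> path (arr B') j (rcons p i).
Proof.
move=> p0; have [_ Bij icB] := through_shrink p0.
have := oriB icB; rewrite !cycle_cedges => o.
have {o} : path (arr B) j (rcons p i).
  case: o => [|/allP/(_ (j, i))]; first by rewrite /= -path_pedges => /andP[].
  by rewrite mem_cedges_rev /= inE eqxx => /(_ isT); rewrite /arr; have := skB j i; zlia.
rewrite !path_pedges; move=> /allP h; apply/allP => -[x y] xy.
have := h _ xy; rewrite /arr /=.
have [xP yP] := mem_pedges xy.
have sub z : z \in j :: rcons p i -> z \in [:: i, j & p].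
  by rewrite !inE mem_rcons inE orbCA.
case: (boolP (x \in p)) => xp; first by rewrite through_p_same ?sub.
case: (boolP (y \in p)) => yp.
  rewrite -(sign_skew_lt _ _ skB) -(sign_skew_lt _ _ skB') through_p_same ?sub //.
have : adj B' x y by rewrite through_adjE ?sub // xy.
move: (sub x xP) (sub y yP); rewrite !inE (negbTE xp) (negbTE yp) !orbF.
have [B0 _ _] := through_shrink p0.
have B0' : B' j i = 0 by have := skB' i j; have := skB' j i; zlia.
by case/orP => /eqP->; case/orP => /eqP->; rewrite /adj ?B0 ?B0' ?eqxx // sign_skew_diag ?eqxx.
Qed.

End Through.

Variable a : 'I_n -> 'I_n -> int.
Hypothesis pa : positive_companion B a.

(** If both edges at [k] pointed towards [k], or both away from it, the mutation would only reverse
    these two edges, and the cycle would already be chordless and not cyclically oriented in [B]. *)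
Lemma through_opposite i j p : induced_cycle (adj B') [:: i, k, j & p] ->
  (0 < B' i k) = (0 < B' k j).
Proof.
move=> ic; have [ki0 kj0] := through_adj ic; have nonadj := through_nonadj ic.
have s1 := skB' i k; have s2 := skB' k i; have s3 := skB' j k; have s4 := skB' k j.
apply/eqP/negPn/negP => ne.
have nk x : x \in [:: i, k, j & p] -> x != k -> 
    (0 < B' x k) && (0 < B' i k) || (B' x k < 0) && (B' i k < 0) || (B' x k == 0).
  rewrite !inE => /or4P[/eqP->|/eqP->|/eqP->|/nonadj h _].
  - by zlia.
  - by rewrite eqxx.
  - by zlia.
  - by have := skB' k x; have := skB' x k; zlia.
have eqa : {in [:: i, k, j & p] &, adj B' =2 adj B}.
  move=> x y xc yc; case: (eqVneq x k) => [->|xk].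
    by rewrite /adj mutate_row oppr_eq0.
  case: (eqVneq y k) => [->|yk]; first by rewrite /adj mutate_col oppr_eq0.
  rewrite /adj (@mutate_same x y) //; have := nk x xc xk; have := nk y yc yk;
    have := mutate_col x; have := mutate_row y; have := skB' y k; have := skB' k y; zlia.
have := oriB (eq_induced_cycle eqa ic); rewrite !cycle_cedges.
have := mutate_col i; have := mutate_row j; have := mutate_row i; have := mutate_col j.
move=> e1 e2 e3 e4.
case=> [/=/and3P[]|/allP h]; first by rewrite /arr /=; zlia.
have := h (k, i); have := h (j, k).
rewrite !mem_cedges_rev /= !inE !eqxx /= !orbT.
by move=> /(_ isT) + /(_ isT); rewrite /arr /=; zlia.
Qed.

Lemma through_cycle i j p : induced_cycle (adj B') [:: i, k, j & p] ->
  0 < B' i k -> cycle (arr B') [:: i, k, j & p].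
Proof.
move=> ic ik; have kj : 0 < B' k j by rewrite -(through_opposite ic).
rewrite /= {1 2}/arr ik kj /=.
case: (eqVneq p [::]) => [p0|p0]; last exact: through_oriented.
rewrite p0 in ic *; rewrite /= andbT /arr.
have ij0 : B' i j != 0.
  case: ic => _ _ h; rewrite -/(adj B' i j) h ?inE ?eqxx ?orbT //.
  by rewrite /cadj /cedges /= !inE !eqxx !orbT.
have [uik uij _] : [/\ i != k, i != j & true].
  by case: ic; rewrite /= !inE !negb_or => /andP[/andP[-> ->]].
have ujk : j != k by case: ic; rewrite /= !inE !negb_or [j == k]eq_sym => /and3P[].
have s1 := skB' i j; have s2 := skB' j i; have s3 := skB' i k; have s4 := skB' j k.
have s5 := skB' k i; have s6 := skB' k j.
rewrite s2; case: (ltgtP (B' i j) 0) => // [ij|ij]; last by rewrite ij eqxx in ij0.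
(* If the arrow went from [i] to [j], both entries between them would have absolute value at least 2
   in [B], against the weight bound 3. *)
have Bij : B i j = B' i j + B' i k * B' k j by rewrite EB // ik kj.
have Bji : B j i = B' j i - B' j k * B' k i.
  rewrite EB //; case: ifP => h1; first by zlia.
  by case: ifP => // h2; zlia.
have := companion_weight pa uij; rewrite Bij Bji.
have h1 : 1 <= B' i k * B' k j by znia.
have h2 : 1 <= B' j k * B' k i by znia.
znia.
Qed.

Lemma rev_rot_cons i j p :
  rot (size p) (rev [:: i, k, j & p]) = [:: j, k, i & rev p].
Proof. by rewrite !rev_cons -!cats1 -!catA -(size_rev p) rot_size_cat. Qed.

Lemma through_oriented_cycle c : k \in c -> induced_cycle (adj B') c ->
  cycle (arr B') c \/ cycle (arr B') (rev c).
Proof.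
move=> kc; have [m [q cE]] := rot_to_cons kc => ic.
have icr := induced_cycle_rot m ic.
have [i [j [p [m' cE']]]] : exists i j p m', rot m' c = [:: i, k, j & p].
  case: q cE => [|j q] cE; first by case: icr; rewrite cE.
  case/lastP: q cE => [|q i] cE; first by case: icr; rewrite cE.
  exists i, j, q, (rot_add c m (size [:: k, j & q])); rewrite -rot_rot_add cE.
  by rewrite -!rcons_cons -cats1 rot_size_cat.
have {icr} ic' := induced_cycle_rot m' ic; rewrite cE' in ic'.
have [ki0 kj0] := through_adj ic'.
case: (ltP 0 (B' i k)) => ik.
  by left; rewrite -(rot_cycle m') cE' through_cycle.
right.
have icr := induced_cycle_rot (size p) (induced_cycle_rev ic').
have jk : 0 < B' j k.
  have := through_opposite ic'; have := skB' i k; have := skB' k i; have := skB' j k; have := skB' k j; zlia.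
have : cycle (arr B') (rev (rot m' c)).
  rewrite -(rot_cycle (size p)) cE' rev_rot_cons through_cycle -?rev_rot_cons //.
by rewrite rev_rot /rotr rot_cycle.
Qed.

(** * Chordless cycles of the mutated diagram avoiding [k] *)

Variable a' : 'I_n -> 'I_n -> int.
Hypothesis pa' : positive_companion B' a'.
Hypothesis a'E : forall x y, x != k -> y != k -> a' x y =
  if (0 < B x k) == (0 < B y k) then a x y else a x y - a x k * a k y.

(* If the edge from i to j were already present in the diagram of B, the cycle
   would be induced in both diagrams, while the companions a and a' have
   opposite signs on that edge and the same signs on all others. *)
Lemma avoiding_grow i j p : induced_cycle (adj B') [:: i, j & p] ->
  k \notin [:: i, j & p] -> {in p, forall z, B' k z = 0} ->
  0 < B' i j -> 0 < B' j k -> 0 < B' k i ->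
  B i j = 0 /\ induced_cycle (adj B) [:: i, k, j & p].
Proof.
move=> ic; rewrite !inE !negb_or => /and3P[ki kj kp] zp Bij Bjk Bki.
have ik : i != k by rewrite eq_sym.
have jk : j != k by rewrite eq_sym.
have [u s h] := ic; have /and3P[] := u; rewrite inE negb_or => /andP[uij ip] jp up.
have [e1 e2 e3 e4] : [/\ B i k = - B' i k, B j k = - B' j k, B k i = - B' k i & B k j = - B' k j].
  by rewrite !mutate_row !mutate_col !opprK.
have s1 := skB i j; have s2 := skB j i; have s3 := skB i k; have s4 := skB j k.
have s5 := skB k i; have s6 := skB k j.
have EBij := EB' ik jk.
have pz x : x \in p -> B k x = 0 /\ B x k = 0.
  move=> xp; have := zp x xp; rewrite mutate_row => h0.
  by have := skB k x; have := skB x k; zlia.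
have pk x : x \in p -> x != k by move=> xp; apply: contraNneq kp => <-.
have sameL x y : x \in p -> y != k -> B' x y = B x y.
  by move=> xp yk; apply: mutate_nonadj => //; [case: (pz x xp)|exact: pk].
have sameR x y : y \in p -> x != k -> B' x y = B x y.
  by move=> xp yk; apply: mutate_nonadj_r => //; [case: (pz y xp)|exact: pk].
have cI : cedges [:: i, j & p] = (i, j) :: pedges (j :: rcons p i) by [].
have ck z : z \in [:: i, j & p] -> z != k.
  by rewrite !inE => /or3P[/eqP->|/eqP->|/pk].
have adjE x y : x \in [:: i, j & p] -> y \in [:: i, j & p] ->
    (x \in p) || (y \in p) -> adj B x y = adj B' x y.
  by move=> /ck xk /ck yk /orP[] xp; rewrite /adj ?(sameL _ _ xp) ?(sameR _ _ xp).
have ji : (j == i) = false by rewrite eq_sym (negbTE uij).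
have sub z : z \in j :: rcons p i -> z \in [:: i, j & p].
  by rewrite !inE mem_rcons inE orbCA.
have [noij noji] : (i, j) \notin pedges (j :: rcons p i) /\ (j, i) \notin pedges (j :: rcons p i).
  case: (p) s ip jp => // z r _ iz jz.
  rewrite rcons_cons pedges_cons !inE !xpair_eqE eqxx (negbTE uij) /=.
  have iz' : (i == z) = false by apply: contraNF iz => /eqP->; rewrite inE eqxx.
  rewrite iz' /=; have nj : j \notin z :: rcons r i.
    by rewrite -rcons_cons mem_rcons inE negb_or ji.
  by split; apply/negP => /mem_pedges[]; rewrite (negbTE nj).
have Bij0 : B i j = 0.
  apply/eqP/negPn/negP => nz.
  have nz' : B j i != 0 by zlia.
  have := oriented_triangle skB oriB nz (k := k).
  have jk0 : B j k != 0 by zlia.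
  have ki0 : B k i != 0 by zlia.
  move=> /(_ jk0 ki0) o.
  have neg : B i j < 0 by case/orP: o => /and3P[]; zlia.
  have icB : induced_cycle (adj B) [:: i, j & p].
    apply: eq_induced_cycle ic => x y xc yc.
    case: (boolP ((x \in p) || (y \in p))) => [/adjE->//|].
    rewrite negb_or => /andP[nx ny]; move: xc yc; rewrite !inE (negbTE nx) (negbTE ny) !orbF.
    have Bji' : B' j i != 0 by have := skB' i j; zlia.
    by case/orP => /eqP->; case/orP => /eqP->;
      rewrite ?(adj_irr skB) ?(adj_irr skB') /adj ?nz ?nz' ?Bji' // gt_eqF.
  have := pc_odd pa icB; have := pc_odd pa' ic; rewrite cI !par_cons /=.
  have -> : par (fun x y => 0 < a' x y) (pedges (j :: rcons p i)) =
            par (fun x y => 0 < a x y) (pedges (j :: rcons p i)).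
    rewrite /par !big_seq; apply: eq_bigr => -[x y] xy /=.
    have [xP yP] := mem_pedges xy.
    have cz z : z \in p -> a z k = 0 /\ a k z = 0.
      move=> zP; have zk := pk z zP; have [h1 h2] := pz z zP.
      have := pc_abs pa zk; rewrite eq_sym in zk; have := pc_abs pa zk.
      by rewrite h1 h2; zlia.
    rewrite a'E ?ck ?sub //; case: ifP => // ne.
    case: (boolP (x \in p)) => xp; first by have [-> _] := cz x xp; rewrite mul0r subr0.
    case: (boolP (y \in p)) => yp; first by have [_ ->] := cz y yp; rewrite mulr0 subr0.
    have nxy : x != y by apply: contraFneq ne => ->.
    move: (sub x xP) (sub y yP) xy nxy; rewrite !inE (negbTE xp) (negbTE yp) !orbF.
    by case/orP => /eqP->; case/orP => /eqP->; rewrite ?eqxx ?(negbTE noij) ?(negbTE noji).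
  have tri := positive_companion_triangle skB pa nz jk0 ki0.
  have a'ij : a' i j = a i j - a i k * a k j.
    by rewrite a'E //; case: ifP => //; zlia.
  (* [a i j] and [a i k * a k j] have the same sign and the second is larger in absolute value,
     because [B' i j] and [B i j] have opposite signs; so the sign is reversed. *)
  have -> : (0 < a' i j) = ~~ (0 < a i j).
    rewrite a'ij; move: tri; rewrite (pc_sym pa j k) (pc_sym pa k i).
    have := pc_abs pa uij; have := pc_abs pa ik; have := pc_abs pa kj.
    have [p1 p2] : 0 < B i k /\ 0 < B k j by split; zlia.
    move: EBij; rewrite p1 p2 /=; clear -Bij neg p1 p2; nia.
  by case: (0 < a i j); case: (par _ _).
split=> //; split=> //.
  by rewrite !cons_uniq !inE !negb_or ik uij ip kj kp jp; exact: up.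
have cE : cedges [:: i, k, j & p] = [:: (i, k), (k, j) & pedges (j :: rcons p i)] by [].
have kn : k \notin j :: rcons p i.
  by rewrite !inE mem_rcons inE !negb_or kj ki kp.
have kn1 x : ((k, x) \in pedges (j :: rcons p i)) = false.
  by apply/negP => /mem_pedges[]; rewrite (negbTE kn).
have kn2 x : ((x, k) \in pedges (j :: rcons p i)) = false.
  by apply/negP => /mem_pedges[_]; rewrite (negbTE kn).
have adjk y : y \in [:: i, k, j & p] -> adj B k y = (y == i) || (y == j).
  rewrite !inE => /or4P[/eqP->|/eqP->|/eqP->|yp].
  - by rewrite eqxx /adj; zlia.
  - by rewrite (adj_irr skB) (negbTE ki) (negbTE kj).
  - by rewrite eqxx orbT /adj; zlia.
  - rewrite /adj; have [-> _] := pz y yp; rewrite eqxx.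
    have -> : (y == i) = false by apply: contraNF ip => /eqP<-.
    by have -> : (y == j) = false by apply: contraNF jp => /eqP<-.
move=> x y xc yc; rewrite /cadj cE !inE !xpair_eqE.
case: (eqVneq x k) => [->|xk].
  rewrite adjk // kn1 kn2 [k == i]eq_sym (negbTE ik) /= !orbF.
  case: (eqVneq y k) => [->|yk]; first by rewrite (negbTE ki) (negbTE kj).
  by rewrite andbT orbC; case: (y == i).
case: (eqVneq y k) => [->|yk].
  rewrite (adj_sym skB) adjk // kn1 kn2 (negbTE ki) (negbTE kj) !andbF /= !orbF.
  by rewrite andbT.
rewrite !andbF /=.
have [xc' yc'] : x \in [:: i, j & p] /\ y \in [:: i, j & p].
  by move: xc yc; rewrite !inE (negbTE xk) (negbTE yk).
case: (boolP ((x \in p) || (y \in p))) => [xy|].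
  rewrite adjE // h // /cadj cI !inE !xpair_eqE.
  have np z : z \in p -> (z == i) = false /\ (z == j) = false.
    by move=> zP; split; [apply: contraNF ip => /eqP<-|apply: contraNF jp => /eqP<-].
  by case/orP: xy => /np[-> ->]; rewrite ?andbF.
rewrite negb_or => /andP[nx ny]; move: xc' yc'; rewrite !inE (negbTE nx) (negbTE ny) !orbF.
have Bji0 : B j i = 0 by zlia.
have ujpi : uniq (j :: rcons p i).
  by rewrite -rcons_cons rcons_uniq inE negb_or uij ip cons_uniq jp; exact: up.
case/orP => /eqP->; case/orP => /eqP->;
  rewrite ?(adj_irr skB) ?(negbTE noij) ?(negbTE noji) /adj ?Bij0 ?Bji0 ?eqxx //.
- by rewrite orbb; apply/esym/negP; apply: pedges_irr.
- by rewrite orbb; apply/esym/negP; apply: pedges_irr.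
Qed.

(** [wheel] applies with the signs of [a'] as parity and the directions of the edges at [k] as [d],
    since cycles through [k] are already known to be odd and oriented. Two adjacent neighbours of
    [k] span an oriented triangle with it, and reading [c] backwards if necessary fixes its
    direction. *)
Lemma avoiding_cycle c : k \notin c -> induced_cycle (adj B') c ->
  [\/ {in c, forall x, B' k x <= 0}, {in c, forall x, 0 <= B' k x} |
   exists m i j p c', [/\ c' = c \/ c' = rev c, rot m c' = [:: i, j & p],
     {in p, forall z, B' k z = 0} & [/\ 0 < B' i j, 0 < B' j k & 0 < B' k i]]].
Proof.
move=> kc ic.
case: (boolP (has (fun x => 0 < B' k x) c)) => [|/hasPn h]; last first.
  by apply: Or31 => x /h; rewrite -leNgt.
case: (boolP (has (fun x => B' k x < 0) c)) => [|/hasPn h _]; last first.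
  by apply: Or32 => x /h; rewrite -leNgt.
move=> /hasP[y yc ky] /hasP[x xc kx].
have odd' c0 : induced_cycle (adj B') (k :: c0) ->
    par (fun x y => 0 < a' x y) (cedges (k :: c0)) /\
    (0 < B' k (head k c0)) = ~~ (0 < B' k (last k c0)).
  move=> ic0; split; first exact: pc_odd pa' _ ic0.
  have : cycle (arr B') (k :: c0) \/ cycle (arr B') (rev (k :: c0)).
    by apply: through_oriented_cycle; rewrite ?mem_head.
  case: c0 ic0 => [|z c0] ic0; first by case: ic0.
  case/lastP: c0 ic0 => [|c0 w] ic0; first by case: ic0.
  have cE : cedges [:: k, z & rcons c0 w]
    = (k, z) :: rcons (pedges (z :: rcons c0 w)) (w, k) by rewrite -cedges_cons.
  rewrite !cycle_cedges [head _ _]/= [last _ _]/= last_rcons => -[] /allP h.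
    have := h (k, z); have := h (w, k); rewrite cE !inE !mem_rcons !inE !eqxx !orbT.
    move=> /(_ isT) + /(_ isT); rewrite /arr /=; have := skB' k w; have := skB' w k; zlia.
  have := h (z, k); have := h (k, w).
  rewrite !mem_cedges_rev cE !inE !mem_rcons !inE !eqxx !orbT.
  move=> /(_ isT) + /(_ isT); rewrite /arr /=; have := skB' k z; have := skB' z k; zlia.
have [] := @wheel _ (adj B') (fun x y => 0 < a' x y) (adj_sym skB') (pc_sym pa') k
  (fun x => 0 < B' k x) (adj_irr skB' k) odd' c ic (pc_odd pa' ic) kc.
  have [m [q cE]] := rot_to_cons xc.
  have -> : count (adj B' k) c = count (adj B' k) (x :: q).
    by rewrite -cE; apply/seq.permP; rewrite perm_sym perm_rot.
  have kx' : adj B' k x by rewrite /adj; zlia.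
  have ky' : adj B' k y by rewrite /adj; zlia.
  have : y \in x :: q by rewrite -cE mem_rot.
  rewrite inE /= kx' => /predU1P[yx|yq]; first by rewrite yx in ky; zlia.
  have : has (adj B' k) q by apply/hasP; exists y.
  by rewrite has_count; case: (count _ q).
move=> [m [u [v [p [cE ku kv kp]]]]].
have zp : {in p, forall z, B' k z = 0}.
  by move=> z /kp; rewrite /adj negbK => /eqP.
have icr := induced_cycle_rot m ic; rewrite cE in icr.
have uv : adj B' u v.
  by case: icr => _ _ h; rewrite h ?inE ?eqxx ?orbT // /cadj /cedges /= pedges_cons inE eqxx.
have vk : adj B' v k by rewrite (adj_sym skB').
have tri := induced_triangle (adj_sym skB') (adj_irr skB') ku uv vk.
have : cycle (arr B') [:: k; u; v] \/ cycle (arr B') (rev [:: k; u; v]).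
  by apply: through_oriented_cycle; rewrite ?mem_head.
move/orP; rewrite cycle3_rev => /orP[/and3P[h1 h2 h3]|/and3P[h1 h2 h3]].
  by apply: Or33; exists m, u, v, p, c; split; [left| | |].
have [m' cE'] : exists m', rot m' (rev c) = [:: v, u & rev p].
  exists (rot_add (rev c) (size c - m) (size p)); rewrite -rot_rot_add.
  have -> : rot (size c - m) (rev c) = rev (rot m c).
    by rewrite rev_rot /rotr size_rev.
  by rewrite cE !rev_cons -!cats1 -!catA -(size_rev p) rot_size_cat.
apply: Or33; exists m', v, u, (rev p), (rev c); split; [by right|by []| |by []].
by move=> z; rewrite mem_rev; apply: zp.
Qed.

(** No directed path of length 2 through [k] connects vertices of [c], so the mutation does not
    touch the entries on [c]. *)
Lemma avoiding_same c : k \notin c ->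
  {in c, forall x, B' k x <= 0} \/ {in c, forall x, 0 <= B' k x} ->
  {in c &, forall x y, B' x y = B x y}.
Proof.
move=> kc h x y xc yc.
have xk : x != k by apply: contraNneq kc => <-.
have yk : y != k by apply: contraNneq kc => <-.
have e1 := mutate_row x; have e2 := mutate_row y.
have s1 := skB x k; have s2 := skB k x; have s3 := skB y k; have s4 := skB k y.
by case: h => h; have h1 := h x xc; have h2 := h y yc; apply: mutate_same => //; zlia.
Qed.

Lemma grow_cycle i j p : induced_cycle (adj B') [:: i, j & p] ->
  k \notin [:: i, j & p] -> {in p, forall z, B' k z = 0} ->
  0 < B' i j -> 0 < B' j k -> 0 < B' k i ->
  cycle (arr B) [:: i, k, j & p] /\ cycle (arr B') [:: i, j & p].
Proof.
move=> ic kn zp ij jk ki; have [Bij icB] := avoiding_grow ic kn zp ij jk ki.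
have := kn; rewrite !inE !negb_or => /and3P[uki ukj ukp].
have e1 := mutate_row i; have e2 := mutate_row j.
have e3 := mutate_col i; have e4 := mutate_col j.
have s1 := skB' k i; have s2 := skB' i k; have s3 := skB' j k; have s4 := skB' k j.
have cy : cycle (arr B) [:: i, k, j & p].
  have := oriB icB; rewrite !cycle_cedges => -[//|/allP h].
  have := h (k, i); rewrite mem_cedges_rev inE eqxx => /(_ isT).
  by rewrite /arr /=; zlia.
split=> //; move: cy; rewrite /= => /and3P[_ _].
rewrite {2}/arr ij /= !path_pedges => /allP h; apply/allP => -[x y] xy.
have := h _ xy; rewrite /arr /=.
have [xP yP] := mem_pedges xy.
have sub z : z \in j :: rcons p i -> z \in [:: i, j & p].
  by rewrite !inE mem_rcons inE orbCA.
have ck z : z \in [:: i, j & p] -> z != k.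
  move=> zc; rewrite eq_sym; move: zc; rewrite !inE => /or3P[/eqP->|/eqP->|zP] //.
  by apply: contraNneq ukp => ->.
case: (boolP (x \in p)) => xp.
  have h0 : B x k = 0.
    by have := zp x xp; rewrite mutate_row; have := skB x k; have := skB k x; zlia.
  by rewrite mutate_nonadj ?ck ?sub.
case: (boolP (y \in p)) => yp.
  have h0 : B k y = 0 by have := zp y yp; rewrite mutate_row; zlia.
  by rewrite mutate_nonadj_r ?ck ?sub.
move: (sub x xP) (sub y yP); rewrite !inE (negbTE xp) (negbTE yp) !orbF.
case/orP => /eqP->; case/orP => /eqP->; rewrite ?(sign_skew_diag _ skB) ?Bij ?ltxx //.
by have := skB i j; have := skB j i; rewrite Bij; zlia.
Qed.

Lemma oriented_mutate : oriented B'.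
Proof.
move=> c ic; case: (boolP (k \in c)) => kc; first exact: through_oriented_cycle.
case: (avoiding_cycle kc ic) => [h|h|[m [i [j [p [c' [cc cE zp [ij jk ki]]]]]]]].
- by apply: same_oriented => //; apply: avoiding_same => //; left.
- by apply: same_oriented => //; apply: avoiding_same => //; right.
have ic' : induced_cycle (adj B') c'.
  by case: cc => -> //; apply: induced_cycle_rev.
have kc' : k \notin c' by case: cc => ->; rewrite ?mem_rev.
have := induced_cycle_rot m ic'; rewrite cE => icr.
have kn : k \notin [:: i, j & p] by rewrite -cE mem_rot.
have [_] := grow_cycle icr kn zp ij jk ki; rewrite -cE rot_cycle.
by case: cc => -> ?; [left|right].
Qed.

End MutatedCycles.

(** * Invariance of the relations under mutation *)

Definition satisfies (G : groupType) n (s : 'I_n -> G) (Gam : diagram n) : Prop :=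
  forall r, diagram_relator Gam r -> weval s r = 1%g.

Definition edge_weight n (B : 'M[int]_n) (i j : 'I_n) : nat := absz (B i j * B j i).

(** The base vertex of a cycle relation is the head of the list and its predecessor the last entry;
    the choice of base vertex is absorbed in the quantification over all rotations of the cycle. *)
Record cycle_satisfies (G : groupType) n (s : 'I_n -> G) (B : 'M[int]_n) : Prop :=
  CycleSatisfies {
  cs_invol : forall i, (s i * s i = 1)%g;
  cs_braid : forall i j, i != j -> ((s i * s j) ^+ coxeter_exp (diagram_of B) i j = 1)%g;
  cs_cycle1 : forall x p, induced_cycle (adj B) (x :: p) -> cycle (arr B) (x :: p) ->
    all (fun e => edge_weight B e.1 e.2 == 1)%N (cedges (x :: p)) ->
    ((s x * path_refl s p) ^+ 2 = 1)%g;
  cs_cycle2 : forall x p, induced_cycle (adj B) (x :: p) -> cycle (arr B) (x :: p) ->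
    has (fun e => edge_weight B e.1 e.2 == 2)%N (cedges (x :: p)) ->
    ((s x * path_refl s p) ^+ (4 - edge_weight B (last x p) x)%N = 1)%g
}.

Section Relators.
Variables (n : nat) (B : 'M[int]_n).
Hypothesis skB : sign_skew B.
Notation Gam := (diagram_of B).

Lemma joinedE i j : joined Gam i j = adj B i j.
Proof. by rewrite /joined /= /adj; have := skB i j; have := skB j i; lia. Qed.

Lemma chordless_cycleP c :
  chordless_cycle Gam c <-> induced_cycle (adj B) c /\ cycle (arr B) c.
Proof.
split=> [[s u cy h]|[[u s h] cy]].
  split=> //; split=> // x y xc yc; rewrite /cadj !cedges_next // xc yc /= -joinedE.
  apply/idP/orP => [/(h x y xc yc)[->|->]|[/eqP->|/eqP->]]; rewrite ?eqxx; [by left|by right| |].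
    by rewrite /joined (next_cycle cy xc).
  by rewrite /joined (next_cycle cy yc) orbT.
split=> // x y xc yc; rewrite joinedE h // /cadj !cedges_next // xc yc /=.
by case/orP => /eqP->; [left|right].
Qed.

Lemma rot_traject (c : seq 'I_n) i q m : uniq c -> rot m c = i :: q ->
  [seq iter t (next c) i | t <- iota 0 (size c)] = i :: q.
Proof.
move=> u cE; have := cycle_next u; rewrite -(rot_cycle m) cE /= => /fpathE.
rewrite size_rcons => h.
have sz : size c = (size q).+1 by rewrite -(size_rot m) cE.
have : i :: rcons q i = traject (next c) i (size q).+2 by rewrite h.
rewrite trajectSr -rcons_cons => /rcons_inj/(congr1 fst) h2; rewrite sz.
apply: (@eq_from_nth _ i) => [|t]; first by rewrite size_map size_iota.
rewrite size_map size_iota => tq; rewrite [RHS](congr1 (fun r => nth i r t) h2).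
by rewrite (nth_map 0%N) ?size_iota // nth_iota // (nth_traject _ tq).
Qed.

Lemma weval_cycle_word (G : groupType) (s : 'I_n -> G) c i q m :
  (forall x, s x * s x = 1)%g -> uniq c -> rot m c = i :: q ->
  weval s (cycle_word c i) = (s i * path_refl s q)%g.
Proof.
move=> s2 u cE; rewrite /cycle_word weval_gens path_reflE //.
have sz : size c = (size q).+1 by rewrite -(size_rot m) cE.
rewrite map_cat (rot_traject u cE) map_rev /=.
(* The way back omits both ends: the turning vertex, which is already written, and the base
   vertex. *)
have -> : [seq iter t (next c) i | t <- iota 1 (size c - 2)] = take (size q).-1 q.
  have : [seq iter t (next c) i | t <- iota 0 (size c)] = i :: q := rot_traject u cE.
  rewrite sz /= => -[<-]; rewrite size_map size_iota -map_take; congr map.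
  by rewrite take_iota; congr iota; lia.
by rewrite big_cons.
Qed.

Lemma prev_last (c : seq 'I_n) i q m : uniq c -> rot m c = i :: q -> prev c i = last i q.
Proof.
move=> u cE; have : (last i q, i) \in cedges c.
  rewrite -(mem_cedges_rot m) cE /=; case/lastP: q {cE} => [|q z]; first by rewrite inE.
  by rewrite last_rcons -!rcons_cons pedges_rcons mem_rcons inE eqxx.
by rewrite cedges_next // => /andP[_ /eqP h]; rewrite [in LHS]h prev_next.
Qed.

Lemma weight_next (c : seq 'I_n) (P : pred nat) : uniq c ->
  {in c, forall j, P (edge_weight B j (next c j))} <->
  all (fun e => P (edge_weight B e.1 e.2)) (cedges c).
Proof.
move=> u; split=> [h|/allP h j jc].
  by apply/allP => -[x y]; rewrite cedges_next // => /andP[xc /eqP->]; apply: h.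
by apply: (h (j, next c j)); rewrite cedges_next // jc eqxx.
Qed.

Lemma satisfiesP (G : groupType) (s : 'I_n -> G) :
  satisfies s Gam <-> cycle_satisfies s B.
Proof.
split=> [h|[inv braid c1 c2] r].
  have inv i : (s i * s i = 1)%g.
    by have := h _ (RelInvol Gam i); rewrite weval_pow weval_gen expg2.
  split=> //.
  - move=> i j ij; have := h _ (RelBraid Gam ij).
    by rewrite weval_pow weval_cat !weval_gen.
  - move=> x p ic cy w1; have cc : chordless_cycle Gam (x :: p) by apply/chordless_cycleP.
    have [u _ _] := ic.
    have := h _ (@RelCycle1 _ Gam _ x cc _ (mem_head _ _)).
    rewrite weval_pow (@weval_cycle_word _ _ _ _ p 0) ?rot0 //; apply.
    move=> j jc; apply/eqP; move: j jc.
    by apply/(@weight_next _ (fun w => w == 1%N)).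
  - move=> x p ic cy w2; have cc : chordless_cycle Gam (x :: p) by apply/chordless_cycleP.
    have [u _ _] := ic.
    have := h _ (@RelCycle2 _ Gam _ x cc _ (mem_head _ _)).
    rewrite weval_pow (@weval_cycle_word _ _ _ _ p 0) ?rot0 //.
    rewrite (@prev_last _ x p 0) ?rot0 //; apply.
    case/hasP: w2 => -[y z]; rewrite cedges_next // => /andP[yc /eqP->] /eqP w2.
    by exists y.
case=> {r}.
- by move=> i; rewrite weval_pow weval_gen expg2.
- by move=> i j ij; rewrite weval_pow weval_cat !weval_gen; apply: braid.
- move=> c i /chordless_cycleP[ic cy] w1 /rot_to_cons[m [q cE]].
  have [u _ _] := ic; rewrite weval_pow (weval_cycle_word inv u cE).
  apply: c1; rewrite -?cE; [exact: induced_cycle_rot|by rewrite rot_cycle|].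
  rewrite (eq_all_r (mem_cedges_rot m c)).
  by apply/(@weight_next _ (fun w => w == 1%N)) => // j jc; apply/eqP/w1.
- move=> c i /chordless_cycleP[ic cy] [j jc w2] /rot_to_cons[m [q cE]].
  have [u _ _] := ic; rewrite weval_pow (weval_cycle_word inv u cE) (prev_last u cE).
  apply: c2; rewrite -?cE; [exact: induced_cycle_rot|by rewrite rot_cycle|].
  rewrite (eq_has_r (mem_cedges_rot m c)); apply/hasP; exists (j, next c j).
    by rewrite cedges_next // jc eqxx.
  exact/eqP.
Qed.

End Relators.

(** In a list without repetitions a rotation is determined by its first entry. *)
Lemma rot_cons_split (T : eqType) m x (q c c1 c2 : seq T) : uniq c ->
  rot m (x :: q) = c -> c = c1 ++ x :: c2 -> q = c2 ++ c1.
Proof.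
move=> u rE cE.
have [m' xqE] : exists m', x :: q = rot m' c.
  by exists (size c - m)%N; rewrite -rE; apply/esym/rotK.
have [m'' [ms {}xqE]] : exists m'', (m'' < size c)%N /\ x :: q = rot m'' c.
  case: (ltnP m' (size c)) => [h|h]; first by exists m'.
  by exists 0%N; rewrite rot0 cE size_cat addnS xqE -cE rot_oversize.
have xc1 : x \notin c1.
  by move: u; rewrite cE -cat_rcons cat_uniq rcons_uniq => /andP[/andP[]].
have e1 : index x c = size c1 by rewrite cE index_cat (negbTE xc1) /= eqxx addn0.
have hd : nth x c m'' = x by rewrite -[m'']addn0 -nth_drop -[RHS]/(nth x (x :: q) 0) xqE /rot nth_cat size_drop subn_gt0 ms.
have e2 : m'' = size c1 by rewrite -e1 -{1}hd index_uniq.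
by move: xqE; rewrite e2 cE rot_size_cat => -[].
Qed.

Lemma edge_weight_sym n (B : 'M[int]_n) i j : edge_weight B i j = edge_weight B j i.
Proof. by rewrite /edge_weight mulrC. Qed.

Lemma coxeter_expE n (B : 'M[int]_n) i j : sign_skew B ->
  coxeter_exp (diagram_of B) i j = if B i j == 0 then 2%N else
    match edge_weight B i j with 1 => 3 | 2 => 4 | 3 => 6 | _ => 0 end%N.
Proof.
by move=> sk; rewrite /coxeter_exp joinedE // /adj negbK /edge_weight /=.
Qed.

Lemma coxeter_exp_sym n (B : 'M[int]_n) i j : sign_skew B ->
  coxeter_exp (diagram_of B) i j = coxeter_exp (diagram_of B) j i.
Proof.
move=> sk; rewrite !coxeter_expE // edge_weight_sym.
by have := adj_sym sk i j; rewrite /adj; case: eqP; case: eqP.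
Qed.

(* Each of (x, x'), (y, y'), (z, z') stands for the absolute values of the two
   matrix entries of one edge of an oriented triangle. *)
Lemma triangle_weights (x x' y y' z z' : int) :
  0 < x -> 0 < x' -> 0 < y -> 0 < y' -> 0 < z -> 0 < z' ->
  x * x' <= 3 -> y * y' <= 3 -> z * z' <= 3 -> z' * y' * x' = x * y * z ->
  (z' - x * y) * (z - y' * x') <= 3 -> (x - z' * y') * (x' - y * z) <= 3 ->
  (y - x' * z') * (y' - z * x) <= 3 ->
  [\/ [/\ x * x' = 1, y * y' = 1, z * z' = 1, x * y = z' & y' * x' = z],
      [/\ x * x' = 2, y * y' = 2, z * z' = 1, x * y - z' = 1 & y' * x' - z = 1] |
      [/\ x * x' = 1 /\ y * y' = 2 \/ x * x' = 2 /\ y * y' = 1, z * z' = 2,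
          x * y = z' & y' * x' = z]].
Proof.
move=> x0 x0' y0 y0' z0 z0' hx hy hz.
have cases (u v : int) : 0 < u -> 0 < v -> u * v <= 3 ->
    (u = 1 /\ v = 1) \/ (u = 1 /\ v = 2) \/ (u = 2 /\ v = 1) \/ (u = 1 /\ v = 3) \/ (u = 3 /\ v = 1).
  move=> u0 v0 uv; have u3 : u <= 3 by nia.
  have v3 : v <= 3 by nia.
  have [?|[?|?]] : u = 1 \/ u = 2 \/ u = 3 by lia.
  - by subst u; lia.
  - by subst u; lia.
  - by subst u; lia.
have [[-> ->]|[[-> ->]|[[-> ->]|[[-> ->]|[-> ->]]]]] := cases x x' x0 x0' hx;
have [[-> ->]|[[-> ->]|[[-> ->]|[[-> ->]|[-> ->]]]]] := cases y y' y0 y0' hy;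
have [[-> ->]|[[-> ->]|[[-> ->]|[[-> ->]|[-> ->]]]]] := cases z z' z0 z0' hz.
(* A pair of positive integers with product at most 3 has five possible values. Each of the 125
   combinations violates the cocycle identity or one of the three bounds, or is listed. *)
all: clear => c e1 e2 e3; first [ (exfalso; clear -c; done) | (exfalso; clear -e1; done)
  | (exfalso; clear -e2; done) | (exfalso; clear -e3; done)
  | solve [constructor 1; split; done] | solve [constructor 2; split; done]
  | solve [constructor 3; split; try done; left; done]
  | solve [constructor 3; split; try done; right; done] ].
Qed.

Lemma ord2_commute (G : groupType) (x y : G) : (x * x = 1)%g -> (y * y = 1)%g ->
  ((x * y) ^+ 2 = 1)%g <-> commute x y.
Proof.
move=> x2 y2; rewrite expg2; split=> h; last first.
  by rewrite {1}h -mulgA [(x * (x * y))%g]mulgA x2 mul1g.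
by rewrite /commute -[LHS](mulg1_eq h) invgM (mulg1_eq x2) (mulg1_eq y2).
Qed.

Lemma coxeter_exp0 n (B : 'M[int]_n) i j : sign_skew B -> B i j = 0 ->
  coxeter_exp (diagram_of B) i j = 2%N.
Proof. by move=> sk ij; rewrite coxeter_expE // ij eqxx. Qed.

Lemma coxeter_exp_weight n (B : 'M[int]_n) i j w : sign_skew B -> edge_weight B i j = w ->
  (0 < w)%N -> coxeter_exp (diagram_of B) i j =
    match w with 1 => 3 | 2 => 4 | 3 => 6 | _ => 0 end%N.
Proof.
move=> sk ij w0; rewrite coxeter_expE // ij; case: eqP => // B0.
by move: ij w0; rewrite /edge_weight B0 mul0r => <-.
Qed.

(** The alternatives are sorted by the position of [k] in the triangle. The last two equations of
    each tell what the mutation at [k] does to the edge between [i] and [j]: it disappears in the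
    first and third case, and in the second it is reversed with weight 1. *)
Lemma oriented_triangle_weights n (B : 'M[int]_n) a i k j : sign_skew B ->
  positive_companion B a -> i != j -> j != k -> i != k ->
  0 < B i k -> 0 < B k j -> 0 < B j i ->
  [\/ [/\ B i k * - B k i = 1, B k j * - B j k = 1, B j i * - B i j = 1,
          B i k * B k j = - B i j & B j k * B k i = B j i],
      [/\ B i k * - B k i = 2, B k j * - B j k = 2, B j i * - B i j = 1,
          B i k * B k j + B i j = 1 & B j k * B k i - B j i = 1] |
      [/\ B i k * - B k i = 1 /\ B k j * - B j k = 2 \/
          B i k * - B k i = 2 /\ B k j * - B j k = 1, B j i * - B i j = 2,
          B i k * B k j = - B i j & B j k * B k i = B j i]].
Proof.
move=> sk pa ij jk ik ikp kjp jip.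
have s1 := sk i k; have s2 := sk k j; have s3 := sk j i.
have [ki kj ji] : [/\ k != i, k != j & j != i] by split; rewrite eq_sym.
have tri := @positive_companion_triangle _ B a i k j sk pa.
have [h1 h2 h3] : [/\ B i k != 0, B k j != 0 & B j i != 0] by split; lia.
move: tri => /(_ h1 h2 h3) tri.
have av u v (uv : u != v) : a u v = if 0 < a u v then `|B u v| else - `|B u v|.
  by have := pc_abs pa uv; case: ifP; lia.
have le u v (uv : u != v) : `|B u v| * `|B v u| <= 3.
  have vu : v != u by rewrite eq_sym.
  have := pc_le3 pa uv; rewrite (av u v) // (av v u) // (pc_sym pa v u).
  by case: ifP => _; rewrite ?mulrNN.
have Eik := av i k ik; have Eki := av k i ki; have Ekj := av k j kj.
have Ejk := av j k jk; have Eij := av i j ij; have Eji := av j i ji.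
have coc := pc_cocycle pa i j k.
have m1 := pc_refl_le3 pa ij jk ik.
have m2 := pc_refl_le3 pa ik kj ij.
have m3 := pc_refl_le3 pa kj ji ki.
have l1 := le i k ik; have l2 := le k j kj; have l3 := le j i ji.
have [p1 p2 p3] : [/\ B k i < 0, B j k < 0 & B i j < 0] by split; lia.
move: l1 l2 l3 coc m1 m2 m3; rewrite Eik Eki Ekj Ejk Eij Eji.
rewrite (pc_sym pa k i) (pc_sym pa j k) (pc_sym pa i j) tri.
rewrite !(ltr0_norm p1, ltr0_norm p2, ltr0_norm p3, gtr0_norm ikp, gtr0_norm kjp, gtr0_norm jip).
move: ikp kjp jip p1 p2 p3; clear.
move: (B i k) (B k i) (B k j) (B j k) (B j i) (B i j) => x x' y y' z z'.
move=> xp yp zp xn yn zn l1 l2 l3.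
have := @triangle_weights x (- x') y (- y') z (- z') xp _ yp _ zp _ l1 l2 l3.
rewrite !oppr_gt0 => /(_ xn yn zn).
rewrite !mulrNN !opprK => T; case: (0 < a k j) => /=; case: (0 < a j i) => /=;
  rewrite ?(mulrN, mulNr, opprK) => c m1 m2 m3; move: T; rewrite !mulrN; apply; lia.
Qed.

Definition mutate_gens (G : groupType) n (B : 'M[int]_n) k (s : 'I_n -> G) (i : 'I_n) : G :=
  if 0 < B i k then (s i ^ s k)%g else s i.

Lemma rot_middle (T : eqType) (c : seq T) k : k \in c -> (2 < size c)%N ->
  exists i j p m, rot m c = [:: i, k, j & p].
Proof.
move=> kc; have [m [q cE]] := rot_to_cons kc; rewrite -(size_rot m) cE.
case: q cE => [|j q] cE sz; first by exfalso; move: sz; rewrite /=; clear; lia.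
case/lastP: q cE sz => [|q i] cE sz; first by exfalso; move: sz; rewrite /=; clear; lia.
exists i, j, q, (rot_add c m (size [:: k, j & q])); rewrite -rot_rot_add cE.
by rewrite -!rcons_cons -cats1 rot_size_cat.
Qed.

Section MutateRelations.
Variables (n : nat) (B : 'M[int]_n) (k : 'I_n).
Notation B' := (mutate_mx k B).
Hypotheses (skB : sign_skew B) (skB' : sign_skew B').
Hypotheses (oriB : oriented B).
Variables (a a' : 'I_n -> 'I_n -> int).
Hypotheses (pa : positive_companion B a) (pa' : positive_companion B' a').
Hypothesis a'E : forall x y, x != k -> y != k -> a' x y =
  if (0 < B x k) == (0 < B y k) then a x y else a x y - a x k * a k y.
Variables (G : groupType) (s : 'I_n -> G).
Hypothesis cs : cycle_satisfies s B.
Notation t := (mutate_gens B k s).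
Notation w := (edge_weight B).
Notation w' := (edge_weight B').

Let s2 := cs_invol cs.

Lemma gens_commute i j : B i j = 0 -> commute (s i) (s j).
Proof.
move=> ij; case: (eqVneq i j) => [->|nij]; first exact: commute_refl.
by apply/ord2_commute => //; rewrite -(cs_braid cs nij) coxeter_exp0.
Qed.

Lemma weight_ord i j e : i != j -> w i j = e -> (0 < e)%N ->
  ((s i * s j) ^+ match e with 1 => 3 | 2 => 4 | 3 => 6 | _ => 0 end%N = 1)%g.
Proof. by move=> ij we e0; rewrite -(coxeter_exp_weight skB we e0); apply: cs_braid. Qed.

Lemma mutate_gens_invol i : (t i * t i = 1)%g.
Proof. by rewrite /mutate_gens; case: ifP => _ //; rewrite -conjMg s2 conj1g. Qed.

Lemma mutate_gens_k : t k = s k.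
Proof. by rewrite /mutate_gens sign_skew_diag. Qed.

Lemma weight_mutate_k i : w' i k = w i k.
Proof. by rewrite /edge_weight mutate_row mutate_col mulrNN. Qed.

Lemma coxeter_exp_mutate i j : B' i j = B i j -> B' j i = B j i ->
  coxeter_exp (diagram_of B') i j = coxeter_exp (diagram_of B) i j.
Proof. by move=> e1 e2; rewrite !coxeter_expE // /edge_weight e1 e2. Qed.

Lemma edge_weight_pos i j : B i j != 0 -> (0 < w i j)%N.
Proof. by move=> ij; rewrite /edge_weight absz_gt0 mulf_neq0 //; have := adj_sym skB i j; rewrite /adj ij => /esym. Qed.

Lemma edge_weight_le3 i j : i != j -> (w i j <= 3)%N.
Proof. by move=> ij; have := companion_weight pa ij; rewrite /edge_weight; lia. Qed.

Lemma edge_weight_le3' i j : i != j -> (w' i j <= 3)%N.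
Proof. by move=> ij; have := companion_weight pa' ij; rewrite /edge_weight; lia. Qed.

Lemma mutate_through i j : i != k -> j != k -> 0 < B i k -> 0 < B k j ->
  B' i j = B i j + B i k * B k j /\ B' j i = B j i - B j k * B k i.
Proof.
move=> ik jk p1 p2; have e1 := skB i k; have e2 := skB k j; have e3 := skB j k; have e4 := skB k i.
rewrite !mutate_mxE (negbTE ik) (negbTE jk) p1 p2 /=; split=> //.
by case: ifP => h1; [|case: ifP => h2]; lia.
Qed.

Lemma mutate_through_weight i j : i != k -> j != k -> 0 < B i k -> 0 < B k j -> B i j = 0 ->
  w' i j = (w i k * w k j)%N.
Proof.
move=> ik jk p1 p2 ij; have [e1 e2] := mutate_through ik jk p1 p2.
have ji : B j i = 0 by have := skB i j; have := skB j i; lia.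
by rewrite /edge_weight e1 e2 ij ji add0r sub0r -abszM -[RHS]abszN; congr absz; ring.
Qed.

(** On a path through [k] the new weight is a product of two weights and at most 3, so one factor is
    1. On a triangle the new braid relation is the old cycle relation at [i], whose exponent 2 or 3
    is the order required by the new edge. *)
Lemma braid_through i j : i != j -> i != k -> j != k -> 0 < B i k -> B j k <= 0 ->
  ((s i ^ s k * s j) ^+ coxeter_exp (diagram_of B') i j = 1)%g.
Proof.
move=> ij ik jk pik pjk.
have s3 := skB k j; have s4 := skB j k.
case: (eqVneq (B k j) 0) => [kj|nkj].
  have e1 : B' i j = B i j by apply: mutate_nonadj_r.
  have e2 : B' j i = B j i by apply: mutate_nonadj => //; lia.
  rewrite coxeter_exp_mutate //.
  rewrite -(commuteP (commute_sym (gens_commute kj))); apply/ord_conj.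
  exact: cs_braid.
have pkj : 0 < B k j by lia.
have nki : k != i by rewrite eq_sym.
have nkj' : k != j by rewrite eq_sym.
case: (eqVneq (B i j) 0) => [zij|nij].
  have wE := mutate_through_weight ik jk pik pkj zij.
  have w3 := edge_weight_le3' ij.
  have w1 : (0 < w i k)%N by apply: edge_weight_pos; lia.
  have w2 : (0 < w k j)%N by apply: edge_weight_pos.
  have com := gens_commute zij.
  have w0 : (0 < w' i j)%N by rewrite wE muln_gt0 w1.
  rewrite (coxeter_exp_weight skB' (erefl (w' i j)) w0).
  have [wik|wkj] : w i k = 1%N \/ w k j = 1%N by move: w3 w1 w2; rewrite wE; clear; nia.
    apply: edge_path1 => //; first exact: (weight_ord ik wik).
    by rewrite wE wik mul1n; apply: weight_ord.
  apply: edge_path2 => //; first exact: (weight_ord nkj' wkj).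
  by rewrite wE wkj muln1; apply: weight_ord.
have [jk0 ki0] : B j k != 0 /\ B k i != 0.
  by have := adj_sym skB j k; have := adj_sym skB k i; rewrite /adj; lia.
have pji : 0 < B j i.
  by have := oriented_triangle skB oriB nij jk0 ki0; lia.
have ki' : B i k != 0 by lia.
have ji0 : B j i != 0 by lia.
have ic := induced_triangle (adj_sym skB) (adj_irr skB) ki' nkj ji0.
have cy : cycle (arr B) [:: i; k; j] by rewrite /= /arr pik pkj pji.
have [e1 e2] := mutate_through ik jk pik pkj.
apply: edge_triangle => //; rewrite -[(s j ^ s k)%g]/(path_refl s [:: k; j]).
have n1 := @sign_skew_lt _ B _ _ skB.
have [[h1 h2 h3 h4 h5]|[h1 h2 h3 h4 h5]|[h1 h3 h4 h5]] := oriented_triangle_weights skB pa ij jk ik pik pkj pji.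
- rewrite coxeter_exp0 //; last by rewrite e1; lia.
  apply: (cs_cycle1 cs ic cy); rewrite /cedges /= /edge_weight.
  by apply/and4P; split=> //; lia.
- rewrite (@coxeter_exp_weight _ _ _ _ 1) //; last by rewrite /edge_weight e1 e2; nia.
  have -> : 3%N = (4 - w j i)%N by rewrite /edge_weight; lia.
  by apply: (cs_cycle2 cs ic cy); rewrite /cedges /= /edge_weight; apply/orP; left; lia.
- rewrite coxeter_exp0 //; last by rewrite e1; lia.
  have -> : 2%N = (4 - w j i)%N by rewrite /edge_weight; lia.
  by apply: (cs_cycle2 cs ic cy); rewrite /cedges /= /edge_weight; apply/or4P; apply: Or43; lia.
Qed.

Lemma mutate_braid i j : i != j -> ((t i * t j) ^+ coxeter_exp (diagram_of B') i j = 1)%g.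
Proof.
move=> ij.
have kcase x : x != k -> ((t k * t x) ^+ coxeter_exp (diagram_of B') k x = 1)%g.
  move=> xk; have kx : k != x by rewrite eq_sym.
  have -> : coxeter_exp (diagram_of B') k x = coxeter_exp (diagram_of B) k x.
    by rewrite !coxeter_expE // /edge_weight mutate_row mutate_col oppr_eq0 mulrNN.
  rewrite mutate_gens_k /mutate_gens; case: ifP => _; last exact: cs_braid.
  by rewrite -{1}(commuteP (commute_refl (s k))); apply/ord_conj; apply: cs_braid.
case: (eqVneq i k) => [ik|ik]; first by rewrite ik; apply: kcase; rewrite -ik eq_sym.
case: (eqVneq j k) => [jk|jk].
  by rewrite jk; apply: ord_swap; rewrite coxeter_exp_sym //; apply: kcase; rewrite -jk.
have [e1 e2] := (skB i k, skB j k); have [e3 e4] := (skB k i, skB k j).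
rewrite /mutate_gens; case: ifP => hi; case: ifP => hj.
- apply/ord_conj; rewrite coxeter_exp_mutate; first exact: cs_braid.
    by apply: mutate_same => //; lia.
  by apply: mutate_same => //; lia.
- by apply: braid_through => //; lia.
- apply: ord_swap; rewrite coxeter_exp_sym //; apply: braid_through => //; rewrite 1?eq_sym //; lia.
- rewrite coxeter_exp_mutate; first exact: cs_braid.
    by apply: mutate_same => //; lia.
  by apply: mutate_same => //; lia.
Qed.

(** The flag [two] selects between the cycles with all weights 1 and those with an edge of weight 2,
    so that both kinds of cycle relation are transferred by the same argument. *)
Definition cycle_kind (C : 'M[int]_n) (two : bool) c :=
  if two then has (fun e => edge_weight C e.1 e.2 == 2)%N (cedges c)
  else all (fun e => edge_weight C e.1 e.2 == 1)%N (cedges c).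

Definition cycle_exp (two : bool) (v : nat) : nat := if two then (4 - v)%N else 2%N.

Lemma cs_cycle two c m x r : induced_cycle (adj B) c -> cycle (arr B) c ->
  cycle_kind B two c -> rot m c = x :: r ->
  ((s x * path_refl s r) ^+ cycle_exp two (w (last x r) x) = 1)%g.
Proof.
move=> ic cy ck cE; have icr := induced_cycle_rot m ic.
have cyr : cycle (arr B) (x :: r) by rewrite -cE rot_cycle.
rewrite cE in icr; case: two ck; rewrite /cycle_kind /cycle_exp => ck.
  by apply: (cs_cycle2 cs icr cyr); rewrite -cE (eq_has_r (mem_cedges_rot m c)).
by apply: (cs_cycle1 cs icr cyr); rewrite -cE (eq_all_r (mem_cedges_rot m c)).
Qed.

Lemma rot_cases i j (p : seq 'I_n) m x r : uniq [:: i, j & p] ->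
  rot m (x :: r) = [:: i, j & p] ->
  [\/ x = i /\ r = j :: p, x = j /\ r = rcons p i |
      exists p1 p2, p = p1 ++ x :: p2 /\ r = p2 ++ [:: i, j & p1]].
Proof.
move=> u rE; have : x \in [:: i, j & p] by rewrite -rE mem_rot inE eqxx.
rewrite !inE => /or3P[/eqP xi|/eqP xj|/splitPr xp].
- apply: Or31; split=> //; have := @rot_cons_split _ m x r _ [::] (j :: p) u rE.
  by rewrite cats0; apply; rewrite xi.
- apply: Or32; split=> //; have := @rot_cons_split _ m x r _ [:: i] p u rE.
  by rewrite cats1; apply; rewrite xj.
- case: xp u rE => p1 p2 u rE; apply: Or33; exists p1, p2; split=> //.
  by apply: (@rot_cons_split _ m x r _ [:: i, j & p1] p2 u rE).
Qed.

Lemma pedges_through (T : eqType) (i j u v : T) p : p != [::] ->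
  (u, v) \in pedges (j :: rcons p i) -> (u \in p) || (v \in p).
Proof.
case: p => // z p _; rewrite rcons_cons pedges_cons [(u, v) \in _]in_cons.
case/predU1P => [[_ ->]|]; first by rewrite mem_head orbT.
rewrite -rcons_cons; elim: p z => [|y p IH] z.
  by rewrite -[pedges _]/[:: (z, i)] [(u, v) \in _]mem_seq1 => /eqP[-> _]; rewrite mem_head.
rewrite !rcons_cons pedges_cons [(u, v) \in _]in_cons.
case/predU1P => [[-> _]|/IH]; first by rewrite mem_head.
by case/orP => h; rewrite ![_ \in [:: z, y & p]]in_cons h ?orbT.
Qed.

Lemma edge_weight_same i j : B' i j = B i j -> B' j i = B j i -> w' i j = w i j.
Proof. by move=> e1 e2; rewrite /edge_weight e1 e2. Qed.

Lemma edge_weight_nonadj u v : B u k = 0 -> u != k -> v != k -> w' u v = w u v.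
Proof.
move=> uk nu nv; apply: edge_weight_same; first exact: mutate_nonadj.
by apply: mutate_nonadj_r => //; have := skB u k; have := skB k u; zlia.
Qed.

(** The cycle comes from the longer chordless cycle of [B] that runs from [i] through [k] to [j],
    and each of its relations from one of that cycle. The exponents agree because the weight of the
    new edge is the product of the two weights at [k], one of which is 1. *)
Lemma shrink_relation i j p two m x r : induced_cycle (adj B') [:: i, j & p] ->
  k \notin [:: i, j & p] -> {in p, forall z, B' k z = 0} ->
  0 < B' i j -> 0 < B' j k -> 0 < B' k i -> cycle_kind B' two [:: i, j & p] ->
  rot m (x :: r) = [:: i, j & p] ->
  ((t x * path_refl t r) ^+ cycle_exp two (w' (last x r) x) = 1)%g.
Proof.
move=> ic kn zp pij pjk pki ck rE.
have [Bij icB] := avoiding_grow skB skB' oriB pa pa' a'E ic kn zp pij pjk pki.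
have [cyB _] := grow_cycle skB skB' oriB pa pa' a'E ic kn zp pij pjk pki.
have [u sz _] := ic; have p0 : p != [::] by case: (p) sz.
have := kn; rewrite !inE !negb_or => /and3P[ki kj kp].
have [ik jk] : i != k /\ j != k by split; rewrite eq_sym.
have nij : i != j by move: u; rewrite /= inE negb_or => /andP[/andP[]].
have [e1 e2 e3 e4] : [/\ B i k = - B' i k, B j k = - B' j k, B k i = - B' k i & B k j = - B' k j].
  by rewrite !mutate_row !mutate_col !opprK.
have g1 := skB' i k; have g2 := skB' j k; have g3 := skB' k i; have g4 := skB' k j.
have [pBik pBkj] : 0 < B i k /\ 0 < B k j by split; zlia.
have pk z : z \in p -> z != k by move=> zP; apply: contraNneq kp => <-.
have zk z : z \in p -> B z k = 0 /\ B k z = 0.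
  move=> zP; have := zp z zP; rewrite mutate_row => h0.
  by have := skB z k; have := skB k z; zlia.
have ti : t i = (s i ^ s k)%g by rewrite /mutate_gens pBik.
have tj : t j = s j by rewrite /mutate_gens; case: ifP => //; zlia.
have tp : {in p, t =1 s} by move=> z /zk[h _]; rewrite /mutate_gens h ltxx.
have tk := mutate_gens_k.
have kpc : {in p, forall y, commute (s k) (s y)} by move=> y /zk[_ h]; apply: gens_commute.
have wij := mutate_through_weight ik jk pBik pBkj Bij.
have wp a1 a2 : a1 \in [:: i, j & p] -> a2 \in [:: i, j & p] ->
    (a1 \in p) || (a2 \in p) -> w' a1 a2 = w a1 a2.
  have ckk z : z \in [:: i, j & p] -> z != k.
    by rewrite !inE => /or3P[/eqP->|/eqP->|/pk].
  move=> /ckk h1 /ckk h2 /orP[] /zk[h3 _]; first exact: edge_weight_nonadj.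
  by rewrite edge_weight_sym [RHS]edge_weight_sym; apply: edge_weight_nonadj.
have sub z : z \in j :: rcons p i -> z \in [:: i, j & p].
  by rewrite !inE mem_rcons inE orbCA.
have wE e : e \in pedges (j :: rcons p i) -> w' e.1 e.2 = w e.1 e.2.
  case: e => a1 a2 h; have [h1 h2] := mem_pedges h.
  by apply: wp; rewrite ?sub // (pedges_through p0 h).
have wik : (0 < w i k)%N by apply: edge_weight_pos; zlia.
have wkj : (0 < w k j)%N by apply: edge_weight_pos; zlia.
have w3 := edge_weight_le3' nij.
have ckB : cycle_kind B two [:: i, k, j & p].
  have cE' : cedges [:: i, j & p] = (i, j) :: pedges (j :: rcons p i) by [].
  have cE : cedges [:: i, k, j & p] = [:: (i, k), (k, j) & pedges (j :: rcons p i)] by [].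
  move: ck; rewrite /cycle_kind cE' cE; case: (two) => /=; rewrite wij.
    case/orP => [h|/hasP[e eP he]].
      by move: h w3; rewrite wij; clear -wik wkj; nia.
    by apply/or3P; apply: Or33; apply/hasP; exists e; rewrite -?wE.
  case/andP => h /allP hall; apply/and3P; split; try by clear -h wik wkj; nia.
  by apply/allP => e eP; rewrite -wE //; apply: hall.
have rel m' y q : rot m' [:: i, k, j & p] = y :: q ->
    ((s y * path_refl s q) ^+ cycle_exp two (w (last y q) y) = 1)%g := cs_cycle icB cyB ckB.
have lastp : last j p \in p by case: (p) p0 => // z q _; apply: (mem_last z q).
case: (rot_cases u rE) => [[-> ->]|[-> ->]|[p1 [p2 [pE ->]]]].
- have := rel 0%N i [:: k, j & p]; rewrite rot0 => /(_ erefl) h.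
  have -> : w' (last i (j :: p)) i = w (last i [:: k, j & p]) i.
    by apply: wp; rewrite ?inE ?eqxx ?lastp ?orbT.
  exact: (shrink_first s2 tp ti tj h).
- rewrite last_rcons -cats1.
  (* The predecessor of [j] is now [i], and the exponent involves the product weight; the factor
     different from 1, if any, decides whether the old relation at [j] or at [k] carries it. *)
  have [wik1|wkj1] : w i k = 1%N \/ w k j = 1%N by move: w3; rewrite wij; clear -wik wkj; nia.
    have := rel 2%N j (p ++ [:: i; k]) (erefl _).
    rewrite last_cat /= => h; apply: (shrink_second1 s2 tp ti tj) => //.
      exact: (weight_ord ik wik1).
    by rewrite wij wik1 mul1n.
  have := rel 1%N k (j :: p ++ [:: i]); rewrite rot1_cons -cats1 => /(_ erefl).
  rewrite /= last_cat /= => h; apply: (shrink_second2 s2 tp kpc ti tj) => //.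
    exact: (weight_ord kj wkj1).
  by rewrite wij wkj1 muln1.
have xp : x \in p by rewrite pE mem_cat inE eqxx orbT.
have := rel (size ([:: i, k, j & p1])) x (p2 ++ [:: i, k, j & p1]).
rewrite pE -[[:: i, k, j & p1 ++ _]]/([:: i, k, j & p1] ++ x :: p2) rot_size_cat => /(_ erefl) h.
have -> : w' (last x (p2 ++ [:: i, j & p1])) x = w (last x (p2 ++ [:: i, k, j & p1])) x.
  rewrite !last_cat /=; apply: wp; rewrite ?inE ?xp ?orbT //.
  have := mem_last j p1; rewrite inE => /predU1P[->|h']; first by rewrite eqxx orbT.
  by rewrite pE mem_cat h' !orbT.
exact: (shrink_other s2 tp kpc ti tj pE h).
Qed.

Section GrowRelation.
Variables (i j : 'I_n) (p : seq 'I_n) (two : bool).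
Hypotheses (ik : i != k) (jk : j != k).
Hypothesis zk : {in p, forall z, B z k = 0 /\ B k z = 0}.
Hypotheses (nik : B i k < 0) (pjk : 0 < B j k).

Let ti : t i = s i.
Proof. by rewrite /mutate_gens ltNge ltW. Qed.
Let tj : t j = (s j ^ s k)%g. Proof. by rewrite /mutate_gens pjk. Qed.
Let tp : {in p, t =1 s}.
Proof. by move=> z /zk[h _]; rewrite /mutate_gens h ltxx. Qed.
Let kpc : {in p, forall y, commute (s k) (s y)}.
Proof. by move=> y /zk[_ h]; apply: gens_commute. Qed.

(** The old relations are hypotheses rather than taken from a cycle of [B]: when [p] is empty and
    [i], [j] are not joined in [B], there is no old cycle, and they reduce to the commutation of
    [s i] and [s j]. *)
Lemma grow_relation m x r : uniq [:: i, k, j & p] ->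
  (w i k == 1)%N && (w k j == 1)%N ||
  two && ((w i k == 1)%N && (w k j == 2)%N || (w i k == 2)%N && (w k j == 1)%N) ->
  ((s i * path_refl s (j :: p)) ^+ cycle_exp two (w' (last j p) i) = 1)%g ->
  ((s j * path_refl s (p ++ [:: i])) ^+ cycle_exp two (w i k * w k j) = 1)%g ->
  (forall p1 y p2, p = p1 ++ y :: p2 ->
    ((s y * path_refl s (p2 ++ [:: i, j & p1])) ^+ cycle_exp two (w' (last j p1) y) = 1)%g) ->
  rot m (x :: r) = [:: i, k, j & p] ->
  ((t x * path_refl t r) ^+ cycle_exp two (w' (last x r) x) = 1)%g.
Proof.
move=> u kinds relI relJ relY rE.
have tk := mutate_gens_k.
have kj : k != j by rewrite eq_sym.
have ki : k != i by rewrite eq_sym.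
have w'ki : w' i k = w i k by apply: weight_mutate_k.
have w'kj : w' k j = w k j by rewrite edge_weight_sym weight_mutate_k edge_weight_sym.
have wki : w k i = w i k by apply: edge_weight_sym.
have wjk : w j k = w k j by apply: edge_weight_sym.
have commQ : (w i k * w k j = 2)%N -> two -> commute (s j) (path_refl s (p ++ [:: i])).
  move=> wE tw; move: relJ; rewrite wE tw => h; apply/ord2_commute => //.
  by rewrite path_refl_cat //= -conjMg s2 conj1g.
case: (rot_cases u rE) => [[-> ->]|[-> ->]|[p1 [p2 [pE rE']]]].
- exact: (grow_first s2 tp tk kpc ti tj).
- rewrite last_rcons -cats1 w'ki.
  case: (eqVneq (w k j) 1%N) => wkj1.
    apply: (grow_new1 s2 tp tk ti tj); first by apply: (weight_ord jk (e := 1)); rewrite ?wjk.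
    by move: relJ; rewrite wkj1 muln1.
  move: kinds; rewrite (negbTE wkj1) !andbF orbF /= => /and3P[tw /eqP wik1 /eqP wkj2].
  apply: (grow_new2 s2 tp tk kpc ti tj).
  + by apply: (weight_ord jk (e := 2)); rewrite ?wjk.
  + by apply: commQ; rewrite ?wik1 ?wkj2.
  + by rewrite wik1 tw; apply: (weight_ord ki (e := 1)); rewrite ?wki.
- case: p1 pE rE' => [|j' p1] [xj pE] ->.
    rewrite -xj -pE last_cat /= w'kj.
    case: (eqVneq (w i k) 1%N) => wik1.
      apply: (grow_second1 s2 tp tk kpc ti tj); first exact: (weight_ord ik (e := 1)).
      by move: relJ; rewrite wik1 mul1n.
    move: kinds; rewrite (negbTE wik1) /= => /and3P[tw /eqP wik2 /eqP wkj1].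
    apply: (grow_second2 s2 tp tk kpc ti tj).
    + exact: (weight_ord ik (e := 2)).
    + by apply: commQ; rewrite ?wik2 ?wkj1.
    + by rewrite wkj1 tw; apply: (weight_ord jk (e := 1)); rewrite ?wjk.
  have := relY _ _ _ pE; rewrite -xj !last_cat /=.
  exact: (grow_other s2 tp tk kpc ti tj pE).
Qed.

End GrowRelation.

(** Three configurations of [B] lead to a cycle through [k]: a path through [k] whose ends are not
    joined, a triangle, and, for longer cycles, the chordless cycle with [k] left out, whose edge
    between [i] and [j] forms a triangle with [k]. *)
Lemma through_relation i j p two m x r : induced_cycle (adj B') [:: i, k, j & p] ->
  0 < B' i k -> cycle_kind B' two [:: i, k, j & p] ->
  rot m (x :: r) = [:: i, k, j & p] ->
  ((t x * path_refl t r) ^+ cycle_exp two (w' (last x r) x) = 1)%g.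
Proof.
move=> ic pik' ck rE.
have pkj' : 0 < B' k j by rewrite -(through_opposite skB' oriB ic).
have [u sz _] := ic.
have cy := through_cycle skB skB' oriB pa ic pik'.
have zp z : z \in p -> B' k z = 0 by apply: through_nonadj ic z.
have [ik ij ip] : [/\ i != k, i != j & i \notin p].
  by move: u; rewrite /= !inE !negb_or => /andP[/and3P[-> -> ->]].
have [kj kp] : k != j /\ k \notin p.
  by move: u; rewrite /= !inE !negb_or => /and3P[_ /andP[]].
have [jk ki ji] : [/\ j != k, k != i & j != i] by split; rewrite eq_sym.
have [e1 e2 e3 e4] : [/\ B i k = - B' i k, B j k = - B' j k, B k i = - B' k i & B k j = - B' k j].
  by rewrite !mutate_row !mutate_col !opprK.
have g1 := skB' i k; have g2 := skB' j k; have g3 := skB' k i; have g4 := skB' k j.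
have [nik pjk] : B i k < 0 /\ 0 < B j k by split; zlia.
have [pki nkj] : 0 < B k i /\ B k j < 0 by split; zlia.
have zk : {in p, forall z, B z k = 0 /\ B k z = 0}.
  move=> z zP; have := zp z zP; rewrite mutate_row => h0.
  by have := skB z k; have := skB k z; zlia.
have pk z : z \in p -> z != k by move=> zP; apply: contraNneq kp => <-.
have EBij : B i j = B' i j + B' i k * B' k j by apply: through_edge ic _ _.
have EBji : B j i = B' j i - B' j k * B' k i.
  have [q1 q2] : B' j i = B j i + B j k * B k i /\ B' i j = B i j - B i k * B k j.
    by apply: mutate_through.
  by rewrite q1 e2 e3; ring.
have wik : (0 < w i k)%N by apply: edge_weight_pos; zlia.
have wkj : (0 < w k j)%N by apply: edge_weight_pos; zlia.
have w'ki : w' i k = w i k by apply: weight_mutate_k.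
have w'kj : w' k j = w k j by rewrite edge_weight_sym weight_mutate_k edge_weight_sym.
have wki : w k i = w i k by apply: edge_weight_sym.
have wjk : w j k = w k j by apply: edge_weight_sym.
have cE : cedges [:: i, k, j & p] = [:: (i, k), (k, j) & pedges (j :: rcons p i)] by [].
have wle : (w' i j <= 3)%N by apply: edge_weight_le3'.
have relY0 : p = [::] -> forall p1 y p2, p = p1 ++ y :: p2 ->
    ((s y * path_refl s (p2 ++ [:: i, j & p1])) ^+ cycle_exp two (w' (last j p1) y) = 1)%g.
  by move=> -> [].
have cEk : cycle_kind B' two [:: i, k, j & p] =
    if two then [|| w i k == 2, w k j == 2 | has (fun e => w' e.1 e.2 == 2) (pedges (j :: rcons p i))]%N
    else [&& w i k == 1, w k j == 1 & all (fun e => w' e.1 e.2 == 1) (pedges (j :: rcons p i))]%N.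
  by rewrite /cycle_kind cE /= w'ki w'kj.
rewrite cEk in ck.
have T := oriented_triangle_weights skB pa ji ik jk pjk pki.
have wE v1 v2 : w v1 v2 = absz (B v1 v2 * - B v2 v1) by rewrite mulrN abszN.
case: (eqVneq p [::]) => [p0|p0].
  have pji : 0 < B' j i by move: cy; rewrite p0 /= andbT => /and3P[_ _].
  have ckp : pedges (j :: rcons p i) = [:: (j, i)] by rewrite p0.
  rewrite ckp /= orbF andbT in ck.
  case: (eqVneq (B i j) 0) => [Bij|Bij].
    have Bji : B j i = 0 by apply: sign_skew_eq0 skB Bij.
    have w'ij : w' j i = (w i k * w k j)%N.
      have q1 : B' i j = - (B i k * B k j).
        by move: EBij; rewrite Bij e1 e4 mulrNN; clear; lia.
      have q2 : B' j i = B j k * B k i.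
        by move: EBji; rewrite Bji e2 e3 mulrNN; clear; lia.
      by rewrite /edge_weight q1 q2 -abszM -[RHS]abszN; congr absz; ring.
    have com : commute (s i) (s j) by apply: gens_commute.
    move: wle; rewrite edge_weight_sym w'ij => wle.
    have kinds : (w i k == 1)%N && (w k j == 1)%N ||
      two && ((w i k == 1)%N && (w k j == 2)%N || (w i k == 2)%N && (w k j == 1)%N).
      by move: ck; rewrite w'ij; case: (two) => /=; clear -wle wik wkj; nia.
    have ex2 : cycle_exp two (w i k * w k j) = 2%N.
      by rewrite /cycle_exp; move: ck kinds; rewrite w'ij; case: (two) => //=; clear -wle wik wkj; nia.
    apply: (grow_relation ik jk zk nik pjk u kinds _ _ (relY0 p0) rE).
      by rewrite p0 /= w'ij ex2; apply/ord2_commute.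
    by rewrite p0 /= ex2; apply/ord2_commute => //; apply: commute_sym.
  have [kj0 ik0] : B j k != 0 /\ B k i != 0 by split; rewrite gt_eqF.
  have pij : 0 < B i j.
    by have := oriented_triangle skB oriB Bij kj0 ik0; clear -pjk pki nik nkj; lia.
  (* The edge between [i] and [j] survives the mutation, whereas the first and third alternatives
     make [B' j i] vanish; what remains is the triangle with two double edges at [k]. *)
  have [[_ _ _ h _]|[h1 h2 h3 h4 h5]|[_ _ h _]] := T pij.
  - by exfalso; move: EBji; rewrite e2 e3 in h; clear -h pji; lia.
  - have wki2 : w k i = 2%N by rewrite wE h2.
    have wjk2 : w j k = 2%N by rewrite wE h1.
    have wij1 : w i j = 1%N by rewrite wE h3.
    have w'ji : w' j i = 1%N.
      rewrite /edge_weight.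
      have -> : B' j i = 1 by move: EBji; rewrite e2 e3 in h4; clear -h4; lia.
      have -> : B' i j = -1 by move: EBij; rewrite e1 e4 in h5; clear -h5; lia.
      by [].
    have tw : two by case: (two) ck => //; rewrite -wki wki2.
    have ic3 : induced_cycle (adj B) [:: k; i; j].
      by apply: (induced_triangle (adj_sym skB) (adj_irr skB)).
    have cy3 : cycle (arr B) [:: k; i; j] by rewrite /= /arr pki pij pjk.
    have ck3 : cycle_kind B true [:: k; i; j] by rewrite /cycle_kind /cedges /= wki2.
    have rel3 : ((s k * s j ^ s i) ^+ 2 = 1)%g.
      by have := cs_cycle ic3 cy3 ck3 (rot0 _); rewrite /= wjk2.
    have ti : t i = s i by rewrite /mutate_gens ltNge ltW.
    have tj : t j = (s j ^ s k)%g by rewrite /mutate_gens pjk.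
    have tk := mutate_gens_k.
    have ij3 := weight_ord ij wij1 isT.
    have jk4 := weight_ord jk wjk2 isT.
    have ik4 : ((s i * s k) ^+ 4 = 1)%g by apply: (weight_ord ik (e := 2)); rewrite -?wki.
    rewrite p0 in u rE; rewrite tw.
    case: (rot_cases u rE) => [[-> ->]|[-> ->]|[p1 [p2 [pE ->]]]].
    + by rewrite /= w'ji tk tj ti conjg_invol.
    + by rewrite /= w'ki -wki wki2 tk tj ti; apply: triangle_new.
    + case: p1 pE => [[<- <-]|j' []//].
      by rewrite /= w'kj -wjk wjk2 tk tj ti; apply: triangle_second.
  - by exfalso; move: EBji; rewrite e2 e3 in h; clear -h pji; lia.
(* From here on [B' i j] vanishes, which excludes the triangle with two double edges at [k]; in the
   other alternatives the weight of the edge from [i] to [j] is the product of the two weights at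
   [k]. *)
have [B'ij pij icB] := through_shrink skB skB' ic pik' pkj' p0.
have B'ji : B' j i = 0 by apply: sign_skew_eq0 skB' B'ij.
have cyB : cycle (arr B) [:: i, j & p].
  have := oriB icB; rewrite !cycle_cedges => -[//|/allP h].
  have := h (j, i); rewrite mem_cedges_rev inE eqxx => /(_ isT).
  by rewrite /arr /= skB lt_gtF.
have sub z : z \in j :: rcons p i -> z \in [:: i, j & p].
  by rewrite !inE mem_rcons inE orbCA.
have wp a1 a2 : a1 \in [:: i, j & p] -> a2 \in [:: i, j & p] ->
    (a1 \in p) || (a2 \in p) -> w' a1 a2 = w a1 a2.
  have ckk z : z \in [:: i, j & p] -> z != k.
    by rewrite !inE => /or3P[/eqP->|/eqP->|/pk].
  move=> /ckk h1 /ckk h2 /orP[] /zk[h3 _]; first exact: edge_weight_nonadj.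
  by rewrite edge_weight_sym [RHS]edge_weight_sym; apply: edge_weight_nonadj.
have wEp e : e \in pedges (j :: rcons p i) -> w' e.1 e.2 = w e.1 e.2.
  case: e => a1 a2 h; have [h1 h2] := mem_pedges h.
  by apply: wp; rewrite ?sub // (pedges_through p0 h).
have cEB : cedges [:: i, j & p] = (i, j) :: pedges (j :: rcons p i) by [].
have wjk' : w j k = absz (B j k * - B k j) := wE j k.
have wki' : w k i = absz (B k i * - B i k) := wE k i.
have wij' : w i j = absz (B i j * - B j i) := wE i j.
have [kinds ckB wij] : [/\ (w i k == 1)%N && (w k j == 1)%N ||
      two && ((w i k == 1)%N && (w k j == 2)%N || (w i k == 2)%N && (w k j == 1)%N),
      cycle_kind B two [:: i, j & p] & w i j = (w i k * w k j)%N].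
  have hasE : has (fun e => w' e.1 e.2 == 2)%N (pedges (j :: rcons p i)) =
              has (fun e => w e.1 e.2 == 2)%N (pedges (j :: rcons p i)).
    by apply: eq_in_has => e eP; rewrite wEp.
  have allE : all (fun e => w' e.1 e.2 == 1)%N (pedges (j :: rcons p i)) =
              all (fun e => w e.1 e.2 == 1)%N (pedges (j :: rcons p i)).
    by apply: eq_in_all => e eP; rewrite wEp.
  rewrite hasE allE in ck.
  rewrite /cycle_kind cEB /= -wki -wjk in ck *.
  have [[h1 h2 h3 _ _]|[_ _ _ h _]|[h1 h3 _ _]] := T pij.
  - rewrite wjk' wki' wij' h1 h2 h3 in ck *; split=> //; by case: (two) ck.
  - by exfalso; move: EBji; rewrite B'ji e2 e3 in h *; clear -h; lia.
  - by case: h1 => -[h1 h2]; rewrite wjk' wki' wij' h1 h2 h3 in ck *; split=> //; case: (two) ck.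
have rel m' y q : rot m' [:: i, j & p] = y :: q ->
    ((s y * path_refl s q) ^+ cycle_exp two (w (last y q) y) = 1)%g := cs_cycle icB cyB ckB.
have lastp : last j p \in p by case: (p) p0 => // z q _; apply: (mem_last z q).
apply: (grow_relation ik jk zk nik pjk u kinds _ _ _ rE).
- rewrite wp ?inE ?eqxx ?lastp ?orbT //.
  by apply: (rel 0%N); rewrite rot0.
- by have := rel 1%N j (p ++ [:: i]); rewrite rot1_cons -cats1 last_cat /= wij; apply.
move=> p1 y p2 pE.
have yp : y \in p by rewrite pE mem_cat inE eqxx orbT.
have := rel (size [:: i, j & p1]) y (p2 ++ [:: i, j & p1]).
rewrite {1}pE -[[:: i, j & p1 ++ _]]/([:: i, j & p1] ++ y :: p2) rot_size_cat => /(_ erefl).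
rewrite last_cat /= wp ?inE ?yp ?orbT //.
have := mem_last j p1; rewrite inE => /predU1P[->|h']; first by rewrite eqxx orbT.
by rewrite pE mem_cat h' !orbT.
Qed.

Lemma path_refl_conj z q : path_refl (fun i => s i ^ z)%g q = (path_refl s q ^ z)%g.
Proof.
elim: q => [|y q IH]; first by rewrite /= conj1g.
case: q IH => [|v q] // IH.
by rewrite -[LHS]/(path_refl (fun i => s i ^ z) (v :: q) ^ (s y ^ z))%g IH -conjJg.
Qed.

Lemma cycle_kind_rot (C : 'M[int]_n) two m c :
  cycle_kind C two (rot m c) = cycle_kind C two c.
Proof.
by rewrite /cycle_kind (eq_has_r (mem_cedges_rot m c)) (eq_all_r (mem_cedges_rot m c)).
Qed.

(** Since all edges between [k] and the cycle point the same way, the new generators on it are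
    either all equal to the old ones or all conjugated by [s k]; vertices not joined to [k] fit both
    descriptions because their generators commute with [s k]. *)
Lemma same_relation two c m x r : k \notin c ->
  {in c, forall x, B' k x <= 0} \/ {in c, forall x, 0 <= B' k x} ->
  induced_cycle (adj B') c -> cycle (arr B') c ->
  cycle_kind B' two c -> rot m c = x :: r ->
  ((t x * path_refl t r) ^+ cycle_exp two (w' (last x r) x) = 1)%g.
Proof.
move=> kc sg ic cy ck cE.
have same : {in c &, forall x y, B' x y = B x y} by apply: avoiding_same kc sg.
have icB := same_induced same ic.
have cyB : cycle (arr B) c by rewrite -(eq_cycle_arr same).
have wc y z : y \in c -> z \in c -> w' y z = w y z.
  by move=> yc zc; apply: edge_weight_same; apply: same.
have ckB : cycle_kind B two c.
  have E e : e \in cedges c -> w' e.1 e.2 = w e.1 e.2.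
    by case: e => y z /mem_cedges[yc zc]; apply: wc.
  move: ck; rewrite /cycle_kind; case: (two).
    by rewrite (eq_in_has (a2 := fun e => w e.1 e.2 == 2%N)) // => e /E ->.
  by rewrite (eq_in_all (a2 := fun e => w e.1 e.2 == 1%N)) // => e /E ->.
have sub y : y \in x :: r -> y \in c by rewrite -cE mem_rot.
rewrite wc ?sub ?mem_last ?mem_head //.
have rel := cs_cycle icB cyB ckB cE.
case: sg => h.
  have tE : {in x :: r, t =1 s}.
    move=> y /sub/h; rewrite mutate_row /mutate_gens => h'.
    by rewrite skB (_ : B k y < 0 = false) //; clear -h'; lia.
  rewrite tE ?mem_head // (@eq_path_refl _ _ s t r) // => y yr.
  by apply: tE; rewrite inE yr orbT.
have tE : {in x :: r, t =1 fun y => (s y ^ s k)%g}.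
  move=> y /sub/h; rewrite mutate_row /mutate_gens => h'; case: ifP => // n0.
  have ky : B k y = 0 by have := skB y k; clear -h' n0; lia.
  by rewrite (commuteP (commute_sym (gens_commute ky))).
rewrite tE ?mem_head // (@eq_path_refl _ _ (fun y => s y ^ s k)%g t r) => [|y yr].
  by rewrite path_refl_conj; apply/ord_conj.
by apply: tE; rewrite inE yr orbT.
Qed.

Lemma mutate_relation two c m x r : induced_cycle (adj B') c -> cycle (arr B') c ->
  cycle_kind B' two c -> rot m c = x :: r ->
  ((t x * path_refl t r) ^+ cycle_exp two (w' (last x r) x) = 1)%g.
Proof.
move=> ic cy ck cE.
have back m0 d : rot m0 c = d -> exists m1, rot m1 (x :: r) = d.
  move=> <-; exists (rot_add (x :: r) (size c - m) m0); rewrite -rot_rot_add.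
  by congr rot; rewrite -cE -(size_rot m); apply: rotK.
case: (boolP (k \in c)) => kc.
  have [_ sz _] := ic; have [i [j [p [m0 cE0]]]] := rot_middle kc sz.
  have ic0 := induced_cycle_rot m0 ic; rewrite cE0 in ic0.
  have pik : 0 < B' i k.
    by move: cy; rewrite -(rot_cycle m0) cE0 /= => /andP[].
  have [m1 rE] := back m0 _ cE0.
  by apply: (through_relation ic0 pik _ rE); rewrite -cE0 cycle_kind_rot.
case: (avoiding_cycle skB skB' oriB pa pa' kc ic) => [h|h|[m0 [i [j [p [c' [cc cE0 zp [ij jk ki]]]]]]]].
- by apply: (same_relation kc _ ic cy ck cE); left.
- by apply: (same_relation kc _ ic cy ck cE); right.
(* The reversed cycle is excluded: its arrow from [i] to [j] would contradict the orientation of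
   [c]. *)
have c'E : c' = c.
  case: cc => // cc; exfalso.
  have : (i, j) \in cedges c' by rewrite -(mem_cedges_rot m0) cE0 inE eqxx.
  rewrite cc mem_cedges_rev => ji; move: cy; rewrite cycle_cedges => /allP/(_ _ ji).
  by rewrite /arr /= skB' lt_gtF.
rewrite c'E in cE0; have ic0 := induced_cycle_rot m0 ic; rewrite cE0 in ic0.
have [m1 rE] := back m0 _ cE0.
apply: (shrink_relation ic0 _ zp ij jk ki _ rE); first by rewrite -cE0 mem_rot.
by rewrite -cE0 cycle_kind_rot.
Qed.

Lemma mutate_satisfies : cycle_satisfies t B'.
Proof.
split.
- exact: mutate_gens_invol.
- exact: mutate_braid.
- by move=> x p ic cy ck; apply: (@mutate_relation false _ 0%N x p ic cy ck); rewrite rot0.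
- by move=> x p ic cy ck; apply: (@mutate_relation true _ 0%N x p ic cy ck); rewrite rot0.
Qed.

End MutateRelations.

(** * The Coxeter presentation for a base *)

Section SimpleRoots.
Variables (R : realFieldType) (n : nat) (Phi : root_system R n).
Notation g := (gram Phi).
Notation root := (root_of Phi).
Implicit Types (b c : root) (i j k : 'I_n) (v u : seq 'I_n).

Definition simple_system (alpha : 'I_n -> root) : Prop :=
  independent alpha /\ forall b, exists2 z : 'I_n -> int,
    (forall i, 0 <= z i) \/ (forall i, z i <= 0) &
    val b = \sum_i (z i)%:~R *: val (alpha i).

Variable alpha : 'I_n -> root.
Hypothesis simple : simple_system alpha.

Let ind : independent alpha := proj1 simple.

Definition coef b : 'I_n -> int := s2val (cid2 (proj2 simple b)).

Lemma coefE b : val b = \sum_i (coef b i)%:~R *: val (alpha i).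
Proof. exact: (s2valP' (cid2 (proj2 simple b))). Qed.

Lemma coef_sign b : (forall i, 0 <= coef b i) \/ (forall i, coef b i <= 0).
Proof. exact: (s2valP (cid2 (proj2 simple b))). Qed.

Lemma coef_unique b (z : 'I_n -> int) :
  val b = \sum_i (z i)%:~R *: val (alpha i) -> coef b =1 z.
Proof.
move=> bE i; have : \sum_i ((coef b i)%:~R - (z i)%:~R : R) *: val (alpha i) = 0.
  rewrite -[RHS](subrr (val b)) {1}coefE bE -sumrB.
  by apply: eq_bigr => j _; rewrite scalerBl.
by move/ind => /(_ i)/eqP; rewrite subr_eq0 eqr_int => /eqP.
Qed.

Lemma coef_simple i j : coef (alpha i) j = (i == j)%:R.
Proof.
apply: (@coef_unique _ (fun j => (i == j)%:R)); rewrite (bigD1 i) //= eqxx scale1r.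
by rewrite big1 ?addr0 // => k ki; rewrite eq_sym (negbTE ki) scale0r.
Qed.

Lemma coef_refl i b j :
  coef (rrefl (alpha i) b) j = coef b j - (i == j)%:R * cint b (alpha i).
Proof.
apply: (@coef_unique _ (fun j => coef b j - (i == j)%:R * cint b (alpha i))).
rewrite rreflE {1}coefE cintE (bigD1 i) //= [RHS](bigD1 i) //= addrAC; congr (_ + _).
  by rewrite eqxx mul1r rmorphB /= scalerBl.
by apply: eq_bigr => k ki; rewrite eq_sym (negbTE ki) mul0r subr0.
Qed.

Definition positive b : bool := [forall i, 0 <= coef b i].

Lemma coef_neq0 b : exists i, coef b i != 0.
Proof.
apply: contrapT => h; have b0 : val b = 0.
  rewrite coefE big1 // => i _; apply/eqP; rewrite scaler_eq0 intr_eq0.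
  by case: eqP => //= bi; case: h; exists i; apply/eqP.
by have := root_gt0 b; rewrite b0 form0l ltxx.
Qed.

Lemma positive_simple i : positive (alpha i).
Proof. by apply/forallP => j; rewrite coef_simple ler0n. Qed.

Lemma positive_gt0 b i : 0 < coef b i -> positive b.
Proof. by move=> bi; apply/forallP; case: (coef_sign b) => // /(_ i); lia. Qed.

Lemma negativeP b : ~~ positive b -> forall i, coef b i <= 0.
Proof. by case: (coef_sign b) => // h /forallP. Qed.

Lemma positive_single b i : positive b -> (forall j, j != i -> coef b j = 0) ->
  b = alpha i.
Proof.
move=> /forallP pb b0; have bE : val b = (coef b i)%:~R *: val (alpha i).
  by rewrite {1}coefE (bigD1 i) //= big1 ?addr0 // => j /b0->; rewrite scale0r.
have [] := @roots_reduced _ _ Phi _ (valP (alpha i)) (coef b i)%:~R.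
- by rewrite -bE; apply: valP.
- by move=> c1; apply: val_inj; rewrite bE c1 scale1r.
- by move=> /eqP; rewrite -[-1]/((-1)%:~R) eqr_int => /eqP c1; have := pb i; rewrite c1.
Qed.

(** A simple reflection changes only the coefficient at [i]; by reducedness [b] has another positive
    coefficient, and this one decides the sign of the image. *)
Lemma positive_refl i b : positive b -> b != alpha i -> positive (rrefl (alpha i) b).
Proof.
move=> pb bi; have [j [ji bj]] : exists j, j != i /\ coef b j != 0.
  apply: contrapT => h; case/eqP: bi; apply: positive_single => // j ji.
  by apply/eqP/negPn/negP => bj; case: h; exists j.
apply: (@positive_gt0 _ j); rewrite coef_refl eq_sym (negbTE ji) mul0r subr0.
by move/forallP: pb => /(_ j); lia.
Qed.

Lemma coef_opp b i : coef (rrefl b b) i = - coef b i.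
Proof.
apply: (@coef_unique _ (fun i => - coef b i)); rewrite rrefl_self {1}coefE -sumrN.
by apply: eq_bigr => j _; rewrite rmorphN scaleNr.
Qed.

Definition act v b : root := foldr (fun i => rrefl (alpha i)) b v.

Lemma act_cat v u b : act (v ++ u) b = act v (act u b).
Proof. exact: foldr_cat. Qed.

Lemma rrefl_rrefl (c d b : root) :
  rrefl (rrefl c d) (rrefl c b) = rrefl c (rrefl d b).
Proof.
apply: val_inj; rewrite rreflE cpair_rrefl.
rewrite -[RHS]/(reflmx g (val c) *m val (rrefl d b)) [val (rrefl d b)]rreflE mulmxBr.
by rewrite -scalemxAr.
Qed.

Lemma act_rrefl v c b : rrefl (act v c) (act v b) = act v (rrefl c b).
Proof. by elim: v => //= i v IH; rewrite rrefl_rrefl IH. Qed.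

Lemma act_inj v : injective (act v).
Proof. by elim: v => [|i v IH] b c //= /(can_inj (rreflK (alpha i)))/IH. Qed.

(** Reading [v] from the right, the image of [alpha k] turns negative at some letter [p]; just
    before, it is a positive root made negative by a simple reflection, hence [alpha p]. *)
Lemma exchange v k : ~~ positive (act v (alpha k)) ->
  exists v1 p v2, v = v1 ++ p :: v2 /\ act v2 (alpha k) = alpha p.
Proof.
elim: v => [|i v IH] /=; first by rewrite positive_simple.
case: (boolP (positive (act v (alpha k)))) => [pv|/IH[v1 [p [v2 [-> e]]]] _]; last first.
  by exists (i :: v1), p, v2.
case: (eqVneq (act v (alpha k)) (alpha i)) => [e _|ne]; first by exists [::], i, v.
by rewrite positive_refl.
Qed.

Lemma act_opp v b : act v (rrefl b b) = rrefl (act v b) (act v b).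
Proof. by rewrite act_rrefl. Qed.

Lemma negative_opp b : positive (rrefl b b) -> ~~ positive b.
Proof.
move=> /forallP pn; apply/negP => /forallP pb; have [i bi] := coef_neq0 b.
by have := pn i; have := pb i; rewrite coef_opp; lia.
Qed.

(* Descent on the height. *)
Lemma positive_conj b : positive b -> exists v i, b = act v (alpha i).
Proof.
have [m] := ubnP (\sum_i `|coef b i|%N); elim: m b => // m IH b /ltnSE hb pb.
case: (pselect (exists i, b = alpha i)) => [[i ->]|ns]; first by exists [::], i.
(* Otherwise every term of [form b b], expanded in the first argument, would be nonpositive. *)
have [i [ci pi]] : exists i, 0 < coef b i /\ 0 < cint b (alpha i).
  apply: contrapT => h; have := root_gt0 b; rewrite ltNge => /negP; apply.
  rewrite {1}coefE form_suml sumr_le0 // => i _; rewrite formZl.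
  have c0 : 0 <= coef b i by move/forallP: pb.
  rewrite form_sym; case: (ltP 0 (form g (val b) (val (alpha i)))) => [|fi].
    rewrite -cint_gt0 => pi; have -> : coef b i = 0.
      by apply/eqP/negPn/negP => ne; case: h; exists i; split=> //; lia.
    by rewrite mul0r.
  by rewrite mulr_ge0_le0 // ler0z.
have pr : positive (rrefl (alpha i) b).
  by apply: positive_refl => //; apply/eqP => bi; case: ns; exists i.
have [|v [j e]] := IH _ _ pr.
  apply: leq_trans hb; rewrite (bigD1 i) //= [X in (_ < X)%N](bigD1 i) //=.
  rewrite -addSn leq_add //; last first.
    by apply: leq_sum => j ji; rewrite coef_refl eq_sym (negbTE ji) mul0r subr0.
  move/forallP: pr => /(_ i); rewrite coef_refl eqxx mul1r => h.
  by lia.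
by exists (i :: v), j; rewrite /= -e rreflK.
Qed.

Lemma root_conj b : exists v i, b = act v (alpha i).
Proof.
case: (boolP (positive b)) => [/positive_conj//|nb].
have /positive_conj[v [i e]] : positive (rrefl b b).
  by apply/forallP => i; rewrite coef_opp oppr_ge0 negativeP.
exists (rcons v i), i; rewrite -cats1 act_cat /= act_opp -e.
by rewrite rrefl_rrefl rreflK.
Qed.

Lemma cint_simple_le0 i j : i != j -> cint (alpha i) (alpha j) <= 0.
Proof.
move=> ij; have ne : alpha i != alpha j.
  apply/eqP => e; have := coef_simple i i; rewrite e coef_simple eqxx eq_sym (negbTE ij).
  by [].
have := positive_refl (positive_simple i) ne; move/forallP/(_ j).
by rewrite coef_refl coef_simple eqxx (negbTE ij) mul1r sub0r oppr_ge0.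
Qed.

Lemma cartan_cases i j : i != j ->
  let x := cint (alpha i) (alpha j) in let y := cint (alpha j) (alpha i) in
  (x = 0 /\ y = 0) \/ (x = -1 /\ y = -1) \/ (x = -1 /\ y = -2) \/
  (x = -2 /\ y = -1) \/ (x = -1 /\ y = -3) \/ (x = -3 /\ y = -1).
Proof.
move=> ij x y; have ji : j != i by rewrite eq_sym.
have := cint_le3 (independent_pair ind ij); have := cint_simple_le0 ij.
have := cint_simple_le0 ji; rewrite -/x -/y => y0 x0 xy.
have : (x == 0) = (y == 0) by rewrite !cint_eq0 form_sym.
case: (eqVneq x 0) => [->|nx] /esym => [/eqP->|/eqP ny]; first by left.
right; have x3 : -3 <= x by nia.
have y3 : -3 <= y by nia.
have [e|[e|e]] : x = -1 \/ x = -2 \/ x = -3 by lia.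
all: rewrite e in xy *; lia.
Qed.

(** For distinct [i] and [j] the default branch is reached only with the value 3, by
    [cartan_cases]. *)
Definition simple_exp i j : nat :=
  match absz (cint (alpha i) (alpha j) * cint (alpha j) (alpha i))%R with
  | 0 => 2 | 1 => 3 | 2 => 4 | _ => 6
  end%N.

Section DihedralCoordinates.
Variables (j k : 'I_n) (x : 'cV[R]_n).
Notation a1 := (val (alpha j)).
Notation a2 := (val (alpha k)).

(** The effect of applying [s_j s_k] to a vector [x] plus a combination of the two simple roots, on
    the coefficients of that combination: [c] and [d] pair the two roots, [p] and [q] pair [x] with
    their coroots. *)
Definition dihedral_step (c d p q : R) (ab : R * R) : R * R :=
  let b := - ab.2 - q - ab.1 * c in (- ab.1 - p - b * d, b).

Lemma dihedral_iter e :
  val ((refl (alpha j) * refl (alpha k)) ^+ e)%g *m x =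
  let ab := iter e (dihedral_step (cpair g a1 a2) (cpair g a2 a1) (cpair g x a1) (cpair g x a2)) (0, 0) in
  x + ab.1 *: a1 + ab.2 *: a2.
Proof.
elim: e => [|e IH]; first by rewrite expg0 /= mul1mx !scale0r !addr0.
rewrite expgS iterS; move: IH; set ab := iter e _ _ => IH.
rewrite -[val _]/(reflmx g a1 *m reflmx g a2 *m val ((refl (alpha j) * refl (alpha k)) ^+ e)%g).
rewrite -!mulmxA IH (reflE _ _ a2) !cpairDl !cpairZl cpair_self.
rewrite reflE !(cpairDl, cpairNl, cpairZl) cpair_self /dihedral_step /=.
apply/matrixP => u w; rewrite !mxE; ring.
Qed.

End DihedralCoordinates.

Lemma refl_group_eq (X Y : reflection_group Phi) :
  (forall x : 'cV[R]_n, val X *m x = val Y *m x) -> X = Y.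
Proof.
move=> h; apply: val_inj; apply/matrixP => i j.
by have /matrixP/(_ i 0) := h (delta_mx j 0); rewrite -!colE !mxE.
Qed.

Lemma dihedral_order j k : j != k ->
  ((refl (alpha j) * refl (alpha k)) ^+ simple_exp j k = 1)%g.
Proof.
move=> jk; apply: refl_group_eq => x; rewrite dihedral_iter /= mul1mx.
rewrite /simple_exp !cintE; move: (cartan_cases jk) => /=.
move: (cpair g x _) (cpair g x _) => p q.
have E (ab : R * R) (u w : 'cV[R]_n) : ab = (0, 0) -> x + ab.1 *: u + ab.2 *: w = x.
  by move=> ->; rewrite /= !scale0r !addr0.
do 5?[case]; case=> -> ->; apply: E; rewrite /= /dihedral_step /=; congr pair; ring.
Qed.

(** Dividing [e] by the order leaves a remainder of at most 5; for a nonzero one the coordinates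
    computed by [dihedral_iter] show that [alpha k] is moved. *)
Lemma dihedral_faithful j k e : j != k ->
  ((refl (alpha j) * refl (alpha k)) ^+ e = 1)%g -> (simple_exp j k %| e)%N.
Proof.
move=> jk; have ord := dihedral_order jk.
have m0 : (0 < simple_exp j k)%N by rewrite /simple_exp; case: absz => [|[|[]]].
rewrite {1}(divn_eq e (simple_exp j k)) expgnDr mulnC expgnA ord expg1n mul1g => h.
rewrite /dvdn; apply/negPn/negP; rewrite -lt0n => r0.
have rm : (e %% simple_exp j k < simple_exp j k)%N by rewrite ltn_mod.
move: h r0 rm; move: (e %% simple_exp j k)%N => r h r0 rm.
have := congr1 (fun X : reflection_group Phi => val X *m val (alpha k)) h.
rewrite dihedral_iter mul1mx /= -[RHS]addr0 -addrA => /addrI.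
move/(independent_pair ind jk); rewrite cpair_self.
move: rm; rewrite /simple_exp !cintE; move: (cartan_cases jk) => /=.
do 5?[case]; case=> -> ->; rewrite /absz /=.
all: case: r r0 {h} => [|[|[|[|[|[|r]]]]]] // _ _ [];
  rewrite /= /dihedral_step /=; lra.
Qed.

Notation gp s v := (\prod_(i <- v) s i)%g.

Lemma gp_rev (G : groupType) (s : 'I_n -> G) u : (forall i, s i * s i = 1)%g ->
  gp s (rev u) = ((gp s u)^-1)%g.
Proof.
move=> s2; elim: u => [|i u IH]; first by rewrite !big_nil invg1.
by rewrite rev_cons -cats1 big_cat big_seq1 big_cons /= IH invgM sV.
Qed.

(** The exponent depends on the word alone and not on the group, so what is found about it in the
    reflection group can be used in any group satisfying the same relations. *)
Lemma dihedral_normal j k m u : (0 < m)%N -> {subset u <= [:: j; k]} ->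
  exists e, forall (G : groupType) (s : 'I_n -> G),
    (s j * s j = 1)%g -> (s k * s k = 1)%g -> ((s j * s k) ^+ m = 1)%g ->
    gp s u = ((s j * s k) ^+ e * (if odd (size u) then s j else 1))%g.
Proof.
move=> m0; elim: u => [|i u IH] sub; first by exists 0%N => G s *; rewrite big_nil mulg1.
have [e he] : exists e, forall (G : groupType) (s : 'I_n -> G),
    (s j * s j = 1)%g -> (s k * s k = 1)%g -> ((s j * s k) ^+ m = 1)%g ->
    gp s u = ((s j * s k) ^+ e * (if odd (size u) then s j else 1))%g.
  by apply: IH => x xu; apply: sub; rewrite inE xu orbT.
(* Conjugation by [J] inverts [J * K]; the inverse is written as a power with exponent [m.-1] to
   keep exponents natural. *)
have swap (G : groupType) (J K : G) d : (J * J = 1)%g -> (K * K = 1)%g ->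
    ((J * K) ^+ m = 1)%g -> (J * (J * K) ^+ d = (J * K) ^+ (m.-1 * d) * J)%g.
  move=> J2 K2 JK; have TV : ((J * K) ^ J = (J * K) ^+ m.-1)%g.
    have -> : ((J * K) ^ J = (J * K)^-1)%g.
      by rewrite /conjg invgM (mulg1_eq J2) (mulg1_eq K2) !mulgA J2 mul1g.
    by apply: mulg1_eq; rewrite -expgS prednK.
  by rewrite expgnA -TV -conjXg /conjg (mulg1_eq J2) -!mulgA J2 mulg1.
have := sub i (mem_head _ _); rewrite !inE => /orP[/eqP->|/eqP->].
  exists (m.-1 * e)%N => G s J2 K2 JK; rewrite big_cons (he G s) // mulgA swap //.
  by rewrite -mulgA; congr (_ * _)%g; rewrite /=; case: odd; rewrite /= ?mulg1 ?J2.
exists (m.-1 * e.+1)%N => G s J2 K2 JK; rewrite big_cons (he G s) //.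
have E : (s k * (s j * s k) ^+ e = s j * (s j * s k) ^+ e.+1)%g.
  by rewrite expgS !mulgA J2 mul1g.
rewrite mulgA E swap //.
by rewrite -mulgA; congr (_ * _)%g; rewrite /=; case: odd; rewrite /= ?mulg1 ?J2.
Qed.

Notation rs := (fun i => refl (alpha i)).

Lemma refl_invol b : (refl b * refl b = 1)%g.
Proof. by apply: refl_group_eq => x; rewrite /= -mulmxA reflK mul1mx. Qed.

Lemma refl_rrefl b c : refl (rrefl c b) = (refl b ^ refl c)%g.
Proof.
rewrite /conjg (mulg1_eq (refl_invol c)); apply: val_inj => /=.
by rewrite reflmx_refl mulmxA.
Qed.

Lemma refl_act v b : refl (act v b) = (gp rs v * refl b * (gp rs v)^-1)%g.
Proof.
elim: v => [|i v IH]; first by rewrite big_nil mul1g invg1 mulg1.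
rewrite [act _ _]/= refl_rrefl IH big_cons /conjg (mulg1_eq (refl_invol _)) invgM.
by rewrite (mulg1_eq (refl_invol _)) !mulgA.
Qed.

Lemma gp_act v b : val (gp rs v) *m val b = val (act v b).
Proof.
elim: v => [|i v IH]; first by rewrite big_nil /= mul1mx.
by rewrite big_cons /= -mulmxA; congr (_ *m _); exact: IH.
Qed.

Lemma gp_trivial v : (forall i, act v (alpha i) = alpha i) <-> gp rs v = 1%g.
Proof.
split=> h; last by move=> i; apply: val_inj; rewrite -gp_act h /= mul1mx.
by apply/val_inj/(independent_mx_eq ind) => i; rewrite gp_act h /= mul1mx.
Qed.

(** * The Coxeter relations imply all relations between simple reflections *)

Section Coxeter.
Variables (G : groupType) (s : 'I_n -> G).
Hypothesis s2 : forall i, (s i * s i = 1)%g.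
Hypothesis sb : forall i j, i != j -> ((s i * s j) ^+ simple_exp i j = 1)%g.

(** The word [u], [k], reversed [u], [l] has even length, so it is a power of the product of the two
    generators. It is trivial on reflections, which makes the exponent a multiple of the order, and
    therefore trivial in [G]. *)
Lemma rank2_commute j k u l : j != k -> {subset u <= [:: j; k]} -> l \in [:: j; k] ->
  act u (alpha k) = alpha l -> (gp s u * s k = s l * gp s u)%g.
Proof.
move=> jk sub lP ul.
have m0 : (0 < simple_exp j k)%N by rewrite /simple_exp; case: absz => [|[|[]]].
have sub' : {subset u ++ k :: rev u ++ [:: l] <= [:: j; k]}.
  move=> x; rewrite mem_cat inE mem_cat mem_rev mem_seq1.
  by case/or4P => [/sub//|/eqP->|/sub//|/eqP->//]; rewrite !inE eqxx orbT.
have [e he] := dihedral_normal m0 sub'.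
have even : odd (size (u ++ k :: rev u ++ [:: l])) = false.
  by rewrite size_cat /= size_cat size_rev /= addn1 !addnS /= negbK oddD addbb.
have := he _ rs (refl_invol _) (refl_invol _) (dihedral_order jk).
rewrite even mulg1 big_cat big_cons big_cat big_seq1 /= gp_rev; last by move=> i; apply: refl_invol.
have -> : (gp rs u * (refl (alpha k) * ((gp rs u)^-1 * refl (alpha l))) = 1)%g.
  by rewrite !mulgA -refl_act ul refl_invol.
move/esym/(dihedral_faithful jk)/dvdnP => [q eq].
have := he _ s (s2 j) (s2 k) (sb jk).
rewrite even mulg1 big_cat big_cons big_cat big_seq1 /= gp_rev // eq mulnC expgnA sb // expg1n.
rewrite !mulgA => /mulg1_eq h.
have {}h : (gp s u * s k * (gp s u)^-1 = s l)%g by rewrite -[LHS]invgK h sV.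
by rewrite -h mulgVK.
Qed.

(** The counterpart in [G] of the rule that conjugating a reflection by [v] gives the reflection in
    the image root, for images that are simple. *)
Definition intertwines v := forall k i,
  act v (alpha k) = alpha i -> (gp s v * s k = s i * gp s v)%g.

Lemma exchange_word v k : (forall u, (size u < size v)%N -> intertwines u) ->
  ~~ positive (act v (alpha k)) ->
  exists v', [/\ (size v' < size v)%N, gp s v = (gp s v' * s k)%g &
                 forall b, act v b = act v' (rrefl (alpha k) b)].
Proof.
move=> IH /exchange[v1 [p [v2 [vE e]]]]; exists (v1 ++ v2); split.
- by rewrite vE !size_cat /= addnS.
- rewrite vE !big_cat big_cons /= -mulgA; congr (_ * _)%g.
  by rewrite (IH v2 _ k p e) // vE size_cat /= addnS ltnS leq_addl.
- by move=> b; rewrite vE !act_cat /= -e act_rrefl.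
Qed.

(** This writes [v] as a minimal representative of its coset modulo the subgroup generated by [j]
    and [k], times a word in these two letters. As long as one of the two roots becomes negative,
    exchange splits off a letter. *)
Lemma strip_dihedral v j k : (forall u, (size u < size v)%N -> intertwines u) ->
  exists v' u, [/\ (size v' <= size v)%N, {subset u <= [:: j; k]},
    gp s v = (gp s v' * gp s u)%g, forall b, act v b = act v' (act u b) &
    positive (act v' (alpha j)) && positive (act v' (alpha k))].
Proof.
have [m] := ubnP (size v); elim: m v => // m IHm v /ltnSE vm IH.
have step l : l \in [:: j; k] -> ~~ positive (act v (alpha l)) -> exists v' u,
   [/\ (size v' <= size v)%N, {subset u <= [:: j; k]},
    gp s v = (gp s v' * gp s u)%g, forall b, act v b = act v' (act u b) &
    positive (act v' (alpha j)) && positive (act v' (alpha k))].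
  move=> lP /(exchange_word IH)[v1 [s1 g1 a1]].
  have [|u us|v' [u [s2' us g2 a2 p2]]] := IHm v1.
  - exact: leq_trans s1 vm.
  - by apply: IH; apply: ltn_trans us s1.
  exists v', (rcons u l); split=> //.
  - exact: leq_trans s2' (ltnW s1).
  - by move=> x; rewrite mem_rcons inE => /predU1P[->//|/us].
  - by rewrite g1 g2 -cats1 big_cat big_seq1 mulgA.
  - by move=> b; rewrite a1 a2 -cats1 act_cat.
case: (boolP (positive (act v (alpha j)))) => pj; last by apply: (step j); rewrite ?inE ?eqxx.
case: (boolP (positive (act v (alpha k)))) => pk; last first.
  by apply: (step k); rewrite ?inE ?eqxx ?orbT.
by exists v, [::]; rewrite big_nil mulg1 pj pk; split.
Qed.

Lemma coef_act_dihedral j k u i : {subset u <= [:: j; k]} -> i \notin [:: j; k] ->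
  coef (act u (alpha k)) i = 0.
Proof.
move=> sub ni; elim: u sub => [|l u IH] sub /=.
  by rewrite coef_simple; move: ni; rewrite !inE negb_or eq_sym => /andP[_]; rewrite eq_sym => /negbTE->.
rewrite coef_refl IH => [|x xu]; last by apply: sub; rewrite inE xu orbT.
have : l != i by apply: contraNneq ni => <-; apply: sub; rewrite mem_head.
by move/negbTE->; rewrite mul0r subr0.
Qed.

Lemma coef_act_linear v b i : coef (act v b) i = \sum_l coef b l * coef (act v (alpha l)) i.
Proof.
apply: (@coef_unique _ (fun i => \sum_l coef b l * coef (act v (alpha l)) i)).
rewrite -gp_act {1}(coefE b) mulmx_sumr.
under eq_bigr => l _ do rewrite -scalemxAr gp_act coefE scaler_sumr.
rewrite exchange_big /=; apply: eq_bigr => x _.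
rewrite rmorph_sum scaler_suml; apply: eq_bigr => l _.
by rewrite rmorphM scalerA.
Qed.

(* Applying v writes alpha i as a nonnegative combination of two positive roots,
   so one of the two coefficients vanishes. *)
Lemma simple_indecomposable j k v u i : j != k -> {subset u <= [:: j; k]} ->
  positive (act v (alpha j)) -> positive (act v (alpha k)) ->
  act v (act u (alpha k)) = alpha i ->
  act u (alpha k) = alpha j \/ act u (alpha k) = alpha k.
Proof.
move=> jk sub /forallP pj /forallP pk e; set c := act u (alpha k) in e *.
have c0 l : l != j -> l != k -> coef c l = 0.
  by move=> lj lk; apply: (coef_act_dihedral sub); rewrite !inE negb_or lj.
have lin l : (i == l)%:R = coef c j * coef (act v (alpha j)) l + coef c k * coef (act v (alpha k)) l.
  rewrite -coef_simple -e coef_act_linear (bigD1 j) //= (bigD1 k) ?(eq_sym k) //=.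
  by rewrite big1 ?addr0 // => x /andP[xj xk]; rewrite c0 ?mul0r.
have pc : positive c.
  apply/negPn/negP => /negativeP nc; have := lin i; rewrite eqxx.
  by have := nc j; have := nc k; have := pj i; have := pk i; nia.
have cj0 : 0 <= coef c j by move/forallP: pc.
have ck0 : 0 <= coef c k by move/forallP: pc.
case: (eqVneq (coef c j) 0) => [cj|cj].
  by right; apply: positive_single => // l lk; case: (eqVneq l j) => [->//|lj]; apply: c0.
case: (eqVneq (coef c k) 0) => [ck|ck].
  by left; apply: positive_single => // l lj; case: (eqVneq l k) => [->//|lk]; apply: c0.
have z l : l != i -> coef (act v (alpha j)) l = 0 /\ coef (act v (alpha k)) l = 0.
  move=> li; have := lin l; rewrite eq_sym (negbTE li).
  have := pj l; have := pk l; move: cj0 ck0 cj ck; clear; nia.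
have ej : act v (alpha j) = alpha i by apply: positive_single => [|l /z[]//]; apply/forallP.
have ek : act v (alpha k) = alpha i by apply: positive_single => [|l /z[]//]; apply/forallP.
case/eqP: jk; have := act_inj (etrans ej (esym ek)) => jk.
have := coef_simple j j; rewrite jk coef_simple eqxx; case: eqP => // ->.
Qed.

(** Induction on the length, by the last letter [j]. If it equals [k], exchange cancels two letters.
    Otherwise the word splits into a minimal representative [v'], covered by the induction, and a
    word in [j] and [k], which must send [alpha k] to one of the two simple roots and is covered by
    the rank 2 case. *)
Lemma intertwines_all v : intertwines v.
Proof.
have [m] := ubnP (size v); elim: m v => // m IHm v /ltnSE vm.
have IH u : (size u < size v)%N -> intertwines u.
  by move=> uv; apply: IHm; apply: leq_trans uv vm.
move=> k i; case/lastP: v vm IH => [|v j] vm IH e.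
  rewrite big_nil mul1g mulg1; congr s; apply/eqP.
  by have := coef_simple k i; rewrite (e : alpha k = alpha i) coef_simple eqxx; case: eqP.
rewrite size_rcons in vm.
have IH' u : (size u < size v)%N -> intertwines u.
  by move=> us; apply: IH; rewrite size_rcons; apply: ltn_trans us _.
move: e; rewrite -cats1 act_cat /= big_cat big_seq1 /=.
case: (eqVneq j k) => [->|jk] e.
  have neg : ~~ positive (act v (alpha k)).
    by apply: negative_opp; rewrite -act_opp e positive_simple.
  have [v' [sv' gv' av']] := exchange_word IH' neg.
  rewrite gv' -[(gp s v' * _ * _)%g]mulgA s2 mulg1.
  apply: IH; first by rewrite size_rcons; apply: ltn_trans sv' _.
  by rewrite -e av' rreflK.
have [v' [u [sv' us gv av /andP[pj pk]]]] := strip_dihedral j k IH'.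
have us' : {subset rcons u j <= [:: j; k]}.
  by move=> x; rewrite mem_rcons inE => /predU1P[->|/us//]; rewrite inE eqxx.
have e' : act v' (act (rcons u j) (alpha k)) = alpha i.
  by rewrite -cats1 act_cat /= -av.
have [l lP ul] : exists2 l, l \in [:: j; k] & act (rcons u j) (alpha k) = alpha l.
  by have [h|h] := simple_indecomposable jk us' pj pk e'; [exists j|exists k]; rewrite ?inE ?eqxx ?orbT.
have := rank2_commute jk us' lP ul; rewrite -cats1 big_cat big_seq1 /= => r2.
rewrite gv -[(gp s v' * gp s u * s j)%g]mulgA -[LHS]mulgA r2 [LHS]mulgA.
rewrite ul in e'; rewrite (IH v' _ l i e') ?mulgA //.
by rewrite size_rcons ltnS.
Qed.

(** In a word acting trivially the part before the last letter makes the corresponding root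
    negative, so exchange rewrites that part to end in the same letter, and the two letters
    cancel. *)
Lemma coxeter_trivial v : gp rs v = 1%g -> gp s v = 1%g.
Proof.
move=> /gp_trivial; have [m] := ubnP (size v); elim: m v => // m IHm v /ltnSE vm h.
case/lastP: v vm h => [|v k] vm h; first by rewrite big_nil.
have neg : ~~ positive (act v (alpha k)).
  apply: negative_opp; rewrite -act_opp; have := h k; rewrite -cats1 act_cat /= => ->.
  exact: positive_simple.
have [v' [sv' gv' av']] := exchange_word (fun u _ => @intertwines_all u) neg.
rewrite -cats1 big_cat big_seq1 /= gv' -mulgA s2 mulg1; apply: IHm.
  by rewrite size_rcons in vm; apply: ltn_trans sv' vm.
by move=> i; rewrite -[RHS](h i) -cats1 act_cat /= av' rreflK.
Qed.

End Coxeter.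

End SimpleRoots.

(** * The presentation attached to a companion *)

Section Presents.
Variables (R : realFieldType) (n : nat) (Phi : root_system R n).
Notation g := (gram Phi).
Notation root := (root_of Phi).
Implicit Types (B : 'M[int]_n) (b : 'I_n -> root) (i j k : 'I_n).

(** The third clause states that the relations suffice by testing in every group; applied to the
    group given by the relators themselves, it determines the kernel of evaluation. *)
Definition presents B b : Prop :=
  [/\ forall x : reflection_group Phi, exists w, weval (fun i => refl (b i)) w = x,
      cycle_satisfies (fun i => refl (b i)) B &
      forall (G : groupType) (s : 'I_n -> G), cycle_satisfies s B ->
        forall w, weval (fun i => refl (b i)) w = 1%g -> weval s w = 1%g].

Lemma companion_mutate_sign B b k x y : companion B b -> x != k -> y != k ->
  let b' := mutate_roots (fun i => 0 < B i k) k b in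
  cint (b' x) (b' y) = if (0 < B x k) == (0 < B y k) then cint (b x) (b y)
    else cint (b x) (b y) - cint (b x) (b k) * cint (b k) (b y).
Proof.
move=> cb xk yk b'; rewrite /b' /mutate_roots.
case: ifP => h1; case: ifP => h2 //=; first exact: cint_rrefl.
  exact: cint_rrefl_l.
exact: cint_rrefl_r.
Qed.

Definition sub_word B k (w : word n) : word n :=
  flatten [seq (if 0 < B l.1 k then [:: (k, false); l; (k, true)] else [:: l]) | l <- w].

Lemma weval_sub_word (G : groupType) (s : 'I_n -> G) B k w : (s k * s k = 1)%g ->
  weval s (sub_word B k w) = weval (mutate_gens B k s) w.
Proof.
move=> k2; elim: w => [|[i e] w IH]; first by rewrite /sub_word /= !weval_nil.
have cons_cat (l : 'I_n * bool) u : l :: u = [:: l] ++ u by [].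
rewrite /sub_word /= -/(sub_word B k w) weval_cat IH [RHS](weval_cat _ [:: _]).
congr (_ * _)%g; rewrite /weval !big_seq1 /mutate_gens /=; case: ifP => _.
  rewrite !big_cons big_nil /= mulg1 /conjg (mulg1_eq k2).
  by case: e; rewrite ?invgM ?(mulg1_eq k2) ?mulgA.
by rewrite big_seq1.
Qed.

(** The arrows at [k] are reversed between the two mutations, so each neighbour of [k] is conjugated
    exactly once; the remaining generators commute with [s k]. *)
Lemma mutate_gens_twice (G : groupType) (s : 'I_n -> G) B k i :
  sign_skew B -> (forall x, s x * s x = 1)%g ->
  (forall x, B x k = 0 -> commute (s x) (s k)) ->
  mutate_gens B k (mutate_gens (mutate_mx k B) k s) i = (s i ^ s k)%g.
Proof.
move=> sk s2 com; have kk : B k k = 0 by apply: sign_skew_diag.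
rewrite /mutate_gens !mutate_col kk oppr0 ltxx oppr_gt0.
case: (ltgtP (B i k) 0) => h //.
by rewrite (commuteP (com i h)).
Qed.

Lemma refl_mutate B k b i :
  refl (mutate_roots (fun i => 0 < B i k) k b i) = mutate_gens B k (fun i => refl (b i)) i.
Proof. by rewrite /mutate_roots /mutate_gens; case: ifP => // _; rewrite refl_rrefl. Qed.

Lemma cycle_satisfies_conj (G : groupType) (s : 'I_n -> G) B x : sign_skew B ->
  cycle_satisfies s B <-> cycle_satisfies (fun i => s i ^ x)%g B.
Proof.
move=> sk; split=> /(satisfiesP sk) h; apply/(satisfiesP sk) => r hr.
  by rewrite weval_conj (h r hr) conj1g.
by have := h r hr; rewrite weval_conj => /eqP; rewrite conjg_eq1 => /eqP.
Qed.

Lemma cycle_satisfies_eq (G : groupType) (s t : 'I_n -> G) B : sign_skew B -> s =1 t ->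
  cycle_satisfies s B -> cycle_satisfies t B.
Proof.
move=> sk st /(satisfiesP sk) h; apply/(satisfiesP sk) => r hr.
by rewrite -(eq_weval st) h.
Qed.

Lemma companion_orthogonal B b i j : companion B b -> i != j -> B i j = 0 ->
  commute (refl (b i)) (refl (b j)).
Proof.
move=> [_ bB] ij B0; have c0 : cint (b i) (b j) = 0.
  by apply/eqP; rewrite -normr_eq0 bB // B0.
have : refl (rrefl (b j) (b i)) = refl (b i).
  by congr refl; apply: val_inj; rewrite rreflE cintE c0 scale0r subr0.
rewrite refl_rrefl => /(congr1 (fun z => refl (b j) * z)%g).
by rewrite /commute -conjgC.
Qed.

Section Step.
Variables (d : 'I_n -> rat) (B : 'M[int]_n) (k : 'I_n) (b0 : 'I_n -> root).
Notation B' := (mutate_mx k B).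
Hypotheses (dB : skew_by d B) (oriB : oriented B) (cb0 : companion B b0).

Let skB : sign_skew B := skew_by_sign dB.
Let skB' : sign_skew B' := skew_by_sign (skew_by_mutate k dB).

Lemma companion_step : companion B' (mutate_roots (fun i => 0 < B i k) k b0).
Proof. exact: companion_mutate. Qed.

Lemma oriented_step : oriented B'.
Proof.
apply: (oriented_mutate skB skB' oriB (companion_positive cb0) (companion_positive companion_step)).
by move=> x y xk yk; apply: companion_mutate_sign.
Qed.

Lemma satisfies_step (G : groupType) (s : 'I_n -> G) :
  cycle_satisfies s B -> cycle_satisfies (mutate_gens B k s) B'.
Proof.
move=> cs; apply: (mutate_satisfies skB skB' oriB (companion_positive cb0)
  (companion_positive companion_step) _ cs).
by move=> x y xk yk; apply: companion_mutate_sign.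
Qed.

End Step.

(** The arbitrary companion [b'] is mutated back to a companion [b] of [B], possibly different from
    [b0], and the presentation for [b] is carried forward again. The result concerns the generators
    of [b'] conjugated by one reflection, which has the same relations. *)
Lemma presents_step d B k b0 : skew_by d B -> oriented B -> companion B b0 ->
  (forall b, companion B b -> presents B b) ->
  forall b, companion (mutate_mx k B) b -> presents (mutate_mx k B) b.
Proof.
move=> dB oriB cb0 IH b' cb'; set B' := mutate_mx k B in cb' *.
have dB' : skew_by d B' := skew_by_mutate k dB.
have skB := skew_by_sign dB; have skB' := skew_by_sign dB'.
have oriB' : oriented B' := oriented_step dB oriB cb0.
have BB : mutate_mx k B' = B by apply: mutate_mxK.
pose b := mutate_roots (fun i => 0 < B' i k) k b'.
have cb : companion B b by rewrite -BB; apply: (companion_step _ dB' oriB' cb').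
have [gen sat faith] := IH b cb.
have rb i : refl (b i) = mutate_gens B' k (fun i => refl (b' i)) i by apply: refl_mutate.
have com x : B x k = 0 -> commute (refl (b' x)) (refl (b' k)).
  move=> xk0; case: (eqVneq x k) => [->|xk]; first exact: commute_refl.
  by apply: (companion_orthogonal cb') => //; rewrite mutate_col xk0 oppr0.
have twice i : mutate_gens B k (fun i => refl (b i)) i = (refl (b' i) ^ refl (b' k))%g.
  rewrite -(mutate_gens_twice i skB (fun x => refl_invol (b' x)) com).
  by rewrite /mutate_gens !rb.
split.
- move=> x; have [w <-] := gen x; exists (sub_word B' k w).
  by rewrite weval_sub_word ?refl_invol //; apply: eq_weval => i; rewrite rb.
- apply/(cycle_satisfies_conj _ (refl (b' k)) skB').
  apply: (cycle_satisfies_eq skB' twice).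
  exact: (satisfies_step k dB oriB cb0 sat).
move=> G s cs w w1.
have cs' : cycle_satisfies (mutate_gens B' k s) B.
  by have := satisfies_step k dB' oriB' cb' cs; rewrite BB.
have := faith G _ cs' (sub_word B k w).
rewrite !weval_sub_word ?refl_invol //; last exact: (cs_invol cs').
rewrite (eq_weval twice) weval_conj w1 conj1g => /(_ erefl).
rewrite (eq_weval (t := fun i => (s i ^ s k)%g)) ?weval_conj => [|i].
  by move/eqP; rewrite conjg_eq1 => /eqP.
apply: mutate_gens_twice => //; first exact: (cs_invol cs).
by move=> x xk0; apply: (gens_commute skB' cs); rewrite mutate_col xk0 oppr0.
Qed.

Section Base.
Variables (B : 'M[int]_n) (alpha : 'I_n -> root).
Hypotheses (skB : sign_skew B) (simple : simple_system alpha) (ca : companion B alpha).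

(** Distinct simple roots pair nonpositively, so a chordless cycle would have no positive entry,
    against the odd parity. *)
Lemma base_no_cycle c : ~ induced_cycle (adj B) c.
Proof.
move=> ic; have := companion_odd ca ic; have [u sz _] := ic.
rewrite /par big_seq big1 // => -[x y] xy /=; apply/negbTE; rewrite -leNgt.
apply: cint_simple_le0 => //; apply: contraTneq xy => ->; apply/negP.
by apply: cedges_irr => //; apply: ltnW.
Qed.

Lemma base_oriented : oriented B.
Proof. by move=> c /base_no_cycle. Qed.

Lemma simple_exp_coxeter i j : i != j ->
  simple_exp alpha i j = coxeter_exp (diagram_of B) i j.
Proof.
move=> ij; have ji : j != i by rewrite eq_sym.
have [ind aB] := ca; have e1 := aB i j ij; have e2 := aB j i ji.
have wE : absz (cint (alpha i) (alpha j) * cint (alpha j) (alpha i)) = edge_weight B i j.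
  by rewrite /edge_weight !abszM; congr (_ * _)%N; lia.
have w3 := edge_weight_le3 (companion_positive ca) ij.
rewrite coxeter_expE // /simple_exp wE; case: (eqVneq (B i j) 0) => [B0|B0].
  by rewrite /edge_weight B0 mul0r.
have := edge_weight_pos skB B0; move: w3.
by case: (edge_weight B i j) => [|[|[|[|]]]].
Qed.

Variable b : 'I_n -> root.
Hypothesis cb : companion B b.

Lemma cint_opp_l (x y : root) : cint (rrefl x x) y = - cint x y.
Proof. by rewrite cint_rrefl_l cint_self; ring. Qed.

Lemma cint_opp_r (x y : root) : cint x (rrefl y y) = - cint x y.
Proof. by rewrite cint_rrefl_r cint_self; ring. Qed.

(** Without chordless cycles every sign pattern on the edges comes from signs on the vertices;
    flipping roots accordingly makes all off-diagonal Cartan integers nonpositive, like those of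
    [alpha]. *)
Lemma base_signs : exists eps : 'I_n -> bool,
  forall i j, cint (if eps i then rrefl (b i) (b i) else b i)
                   (if eps j then rrefl (b j) (b j) else b j) = cint (alpha i) (alpha j).
Proof.
have [eps epsP] := @balanced_potential _ (adj B) (fun x y => 0 < cint (b x) (b y))
  (adj_sym skB) (adj_irr skB) (fun x y => cint_gt0C (b x) (b y))
  (fun c ic => False_ind _ (base_no_cycle ic)).
exists eps => i j; case: (eqVneq i j) => [->|ij].
  by case: ifP => _; rewrite ?cint_rrefl !cint_self.
have e1 := proj2 ca i j ij; have e2 := proj2 cb i j ij.
have le0 := cint_simple_le0 simple ij.
have E : cint (if eps i then rrefl (b i) (b i) else b i)
              (if eps j then rrefl (b j) (b j) else b j)
   = if eps i (+) eps j then - cint (b i) (b j) else cint (b i) (b j).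
  by case: (eps i); case: (eps j); rewrite /= ?cint_opp_l ?cint_opp_r ?opprK.
rewrite E; case: (eqVneq (B i j) 0) => [B0|B0].
  by rewrite B0 in e1 e2; case: ifP => _; lia.
have := epsP i j B0; case: ifP => _; lia.
Qed.

Lemma weval_letters (G : groupType) (s : 'I_n -> G) (w : word n) :
  (forall i, s i * s i = 1)%g -> weval s w = (\prod_(i <- [seq l.1 | l <- w]) s i)%g.
Proof.
move=> s2; rewrite /weval big_map; apply: eq_bigr => -[i e] _ /=.
by case: e; rewrite // sV.
Qed.

(** * Transport from a base to a family with the same Cartan integers *)

Section Intertwiner.
Variables (beta : 'I_n -> root) (M : 'M[R]_n).
Hypothesis Mbeta : forall i, M *m val (alpha i) = val (beta i).
Hypothesis cint_beta : forall i j, cint (beta i) (beta j) = cint (alpha i) (alpha j).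
Hypothesis Munit : M \in unitmx.

Let ind := proj1 simple.

Definition intertwined (X Y : reflection_group Phi) := M *m val X = val Y *m M.

Lemma intertwined_refl i : intertwined (refl (alpha i)) (refl (beta i)).
Proof.
apply: (independent_mx_eq ind) => j.
rewrite -!mulmxA Mbeta /= !reflE mulmxBr -scalemxAr !Mbeta !cintE.
by rewrite cint_beta.
Qed.

Lemma intertwinedM X Y X' Y' : intertwined X Y -> intertwined X' Y' ->
  intertwined (X * X')%g (Y * Y')%g.
Proof.
by rewrite /intertwined /= => h h'; rewrite mulmxA h -mulmxA h' mulmxA.
Qed.

Lemma intertwined1 : intertwined 1%g 1%g.
Proof. by rewrite /intertwined /= mulmx1 mul1mx. Qed.

Lemma intertwinedX X Y m : intertwined X Y -> intertwined (X ^+ m)%g (Y ^+ m)%g.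
Proof.
move=> h; elim: m => [|m IH]; first exact: intertwined1.
by rewrite !expgS; apply: intertwinedM.
Qed.

Lemma intertwined_prod v : intertwined (\prod_(i <- v) refl (alpha i))%g
  (\prod_(i <- v) refl (beta i))%g.
Proof.
elim: v => [|i v IH]; first by rewrite !big_nil; apply: intertwined1.
by rewrite !big_cons; apply: intertwinedM => //; apply: intertwined_refl.
Qed.

Lemma intertwined_eq1 X Y : intertwined X Y -> X = 1%g <-> Y = 1%g.
Proof.
move=> h; split=> e; apply: val_inj.
  by move: h; rewrite /intertwined e /= mulmx1 => h; rewrite -(mulmxK Munit (val Y)) -h mulmxV.
by move: h; rewrite /intertwined e /= mul1mx => h; rewrite -(mulKmx Munit (val X)) h mulVmx.
Qed.

Lemma intertwiner_act v i : M *m val (act alpha v (alpha i)) = val (act beta v (beta i)).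
Proof. by rewrite -!gp_act mulmxA intertwined_prod -mulmxA Mbeta. Qed.

Lemma intertwiner_root (c : root) : M *m val c \in roots Phi.
Proof.
have [v [i ->]] := root_conj simple c.
by rewrite intertwiner_act; apply: valP.
Qed.

(** The family [beta] is not known to be a base. But [M] maps the finite set of roots injectively
    into itself, hence onto, so every root is reached from [beta] by its own reflections. *)
Lemma intertwiner_onto (c : root) : exists v i, c = act beta v (beta i).
Proof.
pose F (x : seq_sub (roots Phi)) : seq_sub (roots Phi) := SeqSub (intertwiner_root x).
have Finj : injective F.
  move=> x y /(congr1 val) /= e; apply: val_inj.
  by rewrite -(mulKmx Munit (val x)) e mulKmx.
have [F' _ F'K] := injF_bij Finj.
have [v [i e]] := root_conj simple (F' c); exists v, i.
by apply: val_inj; rewrite -intertwiner_act -e -[in LHS](F'K c).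
Qed.

End Intertwiner.

Lemma presents_base : presents B b.
Proof.
have [eps cE] := base_signs.
pose beta i := if eps i then rrefl (b i) (b i) else b i.
(* A root and its negative define the same reflection, so the sign changes do not affect the
   generators. *)
have rE i : refl (beta i) = refl (b i).
  by rewrite /beta; case: (eps i) => //; rewrite refl_rrefl commuteP.
have indb : independent beta.
  move=> z z0; have := proj1 cb (fun i => (if eps i then -1 else 1) * z i).
  have -> : \sum_i ((if eps i then -1 else 1) * z i) *: val (b i) = \sum_i z i *: val (beta i).
    apply: eq_bigr => i _; rewrite /beta; case: (eps i); last by rewrite mul1r.
    by rewrite rrefl_self mulN1r scaleNr scalerN.
  move=> /(_ z0) h i; have := h i; case: (eps i); last by rewrite mul1r.
  by rewrite mulN1r => /eqP; rewrite oppr_eq0 => /eqP.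
pose M := family_mx beta *m invmx (family_mx alpha).
have ind := proj1 simple.
have Munit : M \in unitmx by rewrite unitmx_mul unitmx_inv !independent_unitmx.
have Mbeta i : M *m val (alpha i) = val (beta i).
  rewrite -!col_family_mx ![col i _]colE mulmxA /M -(mulmxA (family_mx beta)).
  by rewrite mulVmx ?independent_unitmx // mulmx1.
have inv i : (refl (b i) * refl (b i) = 1)%g by apply: refl_invol.
have wE w : weval (fun i => refl (b i)) w = (\prod_(i <- [seq l.1 | l <- w]) refl (beta i))%g.
  by rewrite weval_letters //; apply: eq_bigr => i _; rewrite rE.
split.
- move=> x.
  have gen1 (c : root) : exists w, weval (fun i => refl (b i)) w = refl c.
    have [v [i ->]] := intertwiner_onto Mbeta cE Munit c.
    exists (wgens (v ++ i :: rev v)); rewrite weval_gens refl_act.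
    rewrite -(gp_rev v (fun y => refl_invol (beta y))).
    rewrite big_cat big_cons /= mulgA rE.
    by congr (_ * _ * _)%g; apply: eq_bigr => y _; rewrite rE.
  have /asboolP[cs xE] := valP x.
  elim: cs x xE => [|c cs IH] x xE.
    by exists [::]; rewrite weval_nil; apply: val_inj; rewrite xE big_nil.
  have hx : val (refl c * x)%g = \prod_(b <- cs) reflmx g (val b).
    by rewrite /= xE big_cons -mulmxE mulmxA reflmxK ?gram_sym ?root_form_neq0 // mul1mx.
  have [w wc] := gen1 c; have [w' w'E] := IH _ hx.
  by exists (w ++ w'); rewrite weval_cat wc w'E mulgA refl_invol mul1g.
- split.
  + exact: inv.
  + move=> i j ij; rewrite -!rE.
    have h := intertwinedX (coxeter_exp (diagram_of B) i j)
      (intertwinedM (intertwined_refl Mbeta cE i) (intertwined_refl Mbeta cE j)).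
    apply/(intertwined_eq1 Munit h).
    by rewrite -simple_exp_coxeter //; apply: dihedral_order.
  + by move=> x p /base_no_cycle.
  + by move=> x p /base_no_cycle.
move=> G s cs w; rewrite wE weval_letters; last exact: cs_invol cs.
move/(intertwined_eq1 Munit (intertwined_prod Mbeta cE _)).
apply: coxeter_trivial => //; first exact: cs_invol cs.
by move=> i j ij; rewrite simple_exp_coxeter //; apply: (cs_braid cs).
Qed.

End Base.

End Presents.

(** * Mutation classes *)

Section MutationClass.
Variable n : nat.
Implicit Types (B : 'M[int]_n) (k : 'I_n).

Definition mutate_seq (ks : seq 'I_n) B := foldl (fun B k => mutate_mx k B) B ks.

Definition relabel_mx (s : 'S_n) B : 'M[int]_n := \matrix_(i, j) B (s i) (s j).

Lemma mutation_class_mx (S0 S : seed n) :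
  mutation_class S0 S -> exists ks, S.2 = mutate_seq ks S0.2.
Proof.
elim=> [|T k _ [ks TE]]; first by exists [::].
by exists (rcons ks k); rewrite /mutate_seq -cats1 foldl_cat /= -/(mutate_seq ks _) -TE.
Qed.

Lemma mutate_seq_rev ks B : mutate_seq (rev ks) (mutate_seq ks B) = B.
Proof.
elim: ks B => [|k ks IH] B //=.
by rewrite rev_cons /mutate_seq -cats1 foldl_cat -!/(mutate_seq _ _) IH /= mutate_mxK.
Qed.

Lemma relabel_mutate (s : 'S_n) k B :
  mutate_mx k (relabel_mx s B) = relabel_mx s (mutate_mx (s k) B).
Proof. by apply/matrixP => i j; rewrite !(mutate_mxE, mxE) !(inj_eq perm_inj). Qed.

Lemma relabel_mutate_seq (s : 'S_n) ks B :
  relabel_mx s (mutate_seq ks B) = mutate_seq [seq (s^-1)%g k | k <- ks] (relabel_mx s B).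
Proof.
by elim: ks B => [|k ks IH] B //=; rewrite IH relabel_mutate permKV.
Qed.

Lemma skew_by_symmetrisable B : skew_symmetrisable B -> exists d, skew_by d B.
Proof.
case=> d d0 /= dB; exists (fun i => d 0 i); split=> // i j.
by move: dB; rewrite mul_diag_mx => /matrixP/(_ j i); rewrite !mxE.
Qed.

Lemma skew_by_seq d ks B : skew_by d B -> skew_by d (mutate_seq ks B).
Proof. by elim: ks B => //= k ks IH B dB; apply/IH/skew_by_mutate. Qed.

Lemma skew_by_relabel d (s : 'S_n) B : skew_by d B -> skew_by (d \o s) (relabel_mx s B).
Proof. by move=> [d0 dB]; split=> [i|i j]; rewrite /= ?mxE // !mxE. Qed.

End MutationClass.

Section Invariant.
Variables (R : realFieldType) (n : nat) (Phi : root_system R n).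
Notation root := (root_of Phi).
Implicit Types (B : 'M[int]_n) (b : 'I_n -> root).

Definition good_matrix B : Prop :=
  [/\ exists d, skew_by d B, oriented B, exists b, companion B b &
      forall b, companion B b -> presents B b].

Lemma good_matrix_mutate B k : good_matrix B -> good_matrix (mutate_mx k B).
Proof.
case=> [[d dB] oB [b cb] pB]; split.
- by exists d; apply: skew_by_mutate.
- exact: (oriented_step dB oB cb).
- by eexists; apply: (companion_step k dB oB cb).
- exact: presents_step dB oB cb pB.
Qed.

Lemma good_matrix_seq ks B : good_matrix B -> good_matrix (mutate_seq ks B).
Proof. by elim: ks B => //= k ks IH B gB; apply/IH/good_matrix_mutate. Qed.

Lemma simple_system_relabel (alpha : 'I_n -> root) (s : 'S_n) :
  simple_system alpha -> simple_system (alpha \o s).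
Proof.
move=> [ind sg]; split=> [z z0|c].
  have h := ind (fun i => z ((s^-1)%g i)).
  move=> i; have := h _ (s i); rewrite permK; apply.
  rewrite (reindex_inj (@perm_inj _ s)) -[RHS]z0 /=.
  by apply: eq_bigr => j _; rewrite permK.
have [z zs ->] := sg c; exists (z \o s).
  by case: zs => zs; [left|right] => i; apply: zs.
by rewrite (reindex_inj (@perm_inj _ s)).
Qed.

Lemma base_simple_system (alpha : 'I_n -> root) : is_base alpha -> simple_system alpha.
Proof.
move=> [/basis_free/freeP fr sg]; split=> [z z0 i|c].
  apply: fr; rewrite -[RHS]z0; apply: eq_bigr => j _.
  by rewrite -tnth_nth tnth_mktuple.
have [z zs ->] := sg c; exists z => //.
by apply: eq_bigr => i _; rewrite scaler_int.
Qed.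

Lemma good_matrix_base B d (alpha : 'I_n -> root) : skew_by d B -> simple_system alpha ->
  companion B alpha -> good_matrix B.
Proof.
move=> dB sa ca; have skB := skew_by_sign dB; split; first by exists d.
- exact: (base_oriented sa ca).
- by exists alpha.
- by move=> b cb; apply: (presents_base skB sa ca cb).
Qed.

(** A companion basis is independent over the integers by definition; over the field this follows
    because its integer span contains the independent family [alpha] of the same size. *)
Lemma companion_basis_companion (alpha : 'I_n -> root) B b :
  independent alpha -> companion_basis B b -> companion B b.
Proof.
move=> ind [_ span [_ _ absA]]; split=> [z z0|i j ij]; last first.
  have := absA i j ij; rewrite mxE cintE => /eqP.
  by rewrite -intr_norm eqr_int => /eqP.
have sp i : exists w : 'cV[R]_n, val (alpha i) = family_mx b *m w.
  have : inIntSpan (in_tuple (roots Phi)) (val (alpha i)).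
    have ai : val (alpha i) \in roots Phi by apply: valP.
    have ri : (index (val (alpha i)) (roots Phi) < size (roots Phi))%N by rewrite index_mem.
    exists [ffun x => (x == Ordinal ri)%:R]; rewrite (bigD1 (Ordinal ri)) //= ffunE eqxx.
    rewrite mulr1z nth_index // big1 ?addr0 // => x /negbTE xr.
    by rewrite ffunE xr mulr0z.
  move/span => [y ->]; exists (\col_j (y j)%:~R).
  apply/matrixP => x x'; rewrite summxE mxE; apply: eq_bigr => j _.
  by rewrite -tnth_nth tnth_mktuple !mxE ord1 mulrzr -scaler_int mxE mulrC mulrzr.
have [A EA] := choice sp.
have ub : family_mx b \in unitmx.
  have := independent_unitmx ind.
  have -> : family_mx alpha = family_mx b *m \matrix_(i, j) A j i 0.
    apply/matrixP => x y; have := EA y; rewrite -col_family_mx => /matrixP/(_ x 0).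
    by rewrite !mxE => ->; apply: eq_bigr => j _; rewrite !mxE.
  by rewrite unitmx_mul => /andP[].
have : family_mx b *m \col_i z i = 0.
  rewrite -[RHS]z0; apply/matrixP => x y; rewrite summxE mxE; apply: eq_bigr => j _.
  by rewrite !mxE ord1 mulrC.
move/(congr1 (mulmx (invmx (family_mx b)))); rewrite mulKmx // mulmx0 => /matrixP h i.
by have := h i 0; rewrite !mxE.
Qed.

(** The third clause of [presents], used for the presented group and its own generators, shows that
    a word trivial on reflections is trivial modulo the relators. The isomorphism sends an element
    to the class of any word that evaluates to it. *)
Lemma presents_has_presentation B b : sign_skew B -> presents B b ->
  (exists2 f : {multiplicative reflection_group Phi -> diagram_group (diagram_of B)},
     bijective f & forall i, f (refl (b i)) = pgen _ i) /\
  has_presentation (fun i => refl (b i)) (diagram_relator (diagram_of B)).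
Proof.
move=> skB [gen sat faith]; set D := diagram_group _.
pose rel := diagram_relator (diagram_of B).
pose p : 'I_n -> D := fun i => pgen rel i.
pose q w : D := \pi_(presented rel)%qT w.
have qM u v : q (u ++ v) = (q u * q v)%g by rewrite /q -pmulE.
have pV i : ((p i)^-1 = q [:: (i, true)])%g.
  apply: mulg1_eq; rewrite -[p i]/(q [:: (i, false)]) -qM.
  by apply/pi_eqP; apply: (PresInv _ (i, false)).
have pE w : weval p w = q w.
  elim: w => [|[i e] w IH]; first by rewrite weval_nil.
  rewrite -cat1s weval_cat IH qM /weval big_seq1 /=.
  by case: e; rewrite ?pV.
have psat : cycle_satisfies p B.
  apply/(satisfiesP skB) => r hr; rewrite pE.
  by apply/pi_eqP; apply: PresRel.
have iff w : weval (fun i => refl (b i)) w = 1%g <-> pres_eq rel w [::].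
  split=> [/(faith _ _ psat)|h]; first by rewrite pE => /pi_eqP.
  by rewrite (weval_pres_eq _ h) ?weval_nil //; apply/(satisfiesP skB).
split; last by split.
have [W WE] := choice gen.
pose f x : D := q (W x).
have fE w : f (weval (fun i => refl (b i)) w) = q w.
  rewrite /f; apply: (mulIg (q w)^-1)%g; rewrite mulgV.
  have winvE u : weval (fun i => refl (b i)) (winv u) = ((weval (fun i => refl (b i)) u)^-1)%g.
    apply/esym/mulg1_eq; rewrite -weval_cat.
    by rewrite (weval_pres_eq _ (pres_mulwV rel u)) ?weval_nil //; apply/(satisfiesP skB).
  have -> : ((q w)^-1 = q (winv w))%g.
    by apply: mulg1_eq; rewrite -qM; apply/pi_eqP/pres_mulwV.
  rewrite -qM; apply/pi_eqP/iff.
  by rewrite weval_cat WE winvE mulgV.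
have fM : {morph f : x y / (x * y)%g}.
  by move=> x y; rewrite -{1}(WE x) -{1}(WE y) -weval_cat fE qM.
pose F : {multiplicative reflection_group Phi -> D} :=
  HB.pack f (isMultiplicative.Build _ _ f fM).
exists F; last first.
  by move=> i; rewrite /= -(weval_gen (fun i => refl (b i))) fE.
exists (fun y => weval (fun i => refl (b i)) (repr y)) => [x|y] /=.
  rewrite -[RHS](WE x) /f; apply: weval_pres_eq; first exact/(satisfiesP skB).
  exact: pres_repr.
by rewrite fE /q reprK.
Qed.

End Invariant.

Theorem theorem6p8 (R : realFieldType) (n : nat)
    (S0 : seed n) (C : 'M[int]_n) (Phi : root_system R n)
    (B : 'M[int]_n) (beta : 'I_n -> root_of Phi) :
  valid_seed S0 ->
  of_finite_type S0 C ->
  has_cartan_matrix Phi C ->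
  exchange_matrix S0 B ->
  companion_basis B beta ->
  (exists2 f : {multiplicative reflection_group Phi -> diagram_group (diagram_of B)},
     bijective f & forall i, f (refl (beta i)) = pgen _ i) /\
  has_presentation (fun i => refl (beta i)) (diagram_relator (diagram_of B)).
Proof.
move=> [_ /skew_by_symmetrisable[d dS]] [_ [B1 [S1 [T1 mT1 [s1 S1E]] B1E] [sg B1C]]].
move=> [alpha /base_simple_system sa alphaC] [S [T mT [s SE]] BE] cb.
have [ks1 T1E] := mutation_class_mx mT1; have [ks TE] := mutation_class_mx mT.
(* The mutations leading to the Dynkin seed are undone in reverse order, then those leading to [B]
   are performed; the relabelling [s] is moved to the start of the sequence. *)
have BsE : B = mutate_seq [seq (s^-1)%g k | k <- rev ks1 ++ ks] (relabel_mx s T1.2).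
  rewrite -relabel_mutate_seq BE SE /= TE T1E /mutate_seq foldl_cat.
  by rewrite -!/(mutate_seq _ _) mutate_seq_rev.
have dT : skew_by (d \o s) (relabel_mx s T1.2).
  by apply: skew_by_relabel; rewrite T1E; apply: skew_by_seq.
(* The vertices pass from the labels of [B] to those of the unrelabelled seed [T1], then to those of
   [B1], and finally to those of the Cartan matrix [C]. *)
pose tau := (s * s1^-1 * sg)%g.
have ca : companion (relabel_mx s T1.2) (alpha \o tau).
  split=> [|i j ij]; first by case: (simple_system_relabel tau sa).
  have -> : cint (alpha (tau i)) (alpha (tau j)) = C (tau i) (tau j).
    by apply: cint_eq; rewrite alphaC.
  rewrite /tau !permM -B1C mxE (inj_eq perm_inj) (inj_eq perm_inj) (negbTE ij).
  by rewrite B1E S1E /= !mxE !permKV normrN normr_id.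
have gB : good_matrix Phi B.
  rewrite BsE; apply: good_matrix_seq.
  exact: good_matrix_base dT (simple_system_relabel tau sa) ca.
have [[d' dB] _ _ pB] := gB.
apply: presents_has_presentation; first exact: skew_by_sign dB.
apply: pB; exact: companion_basis_companion (proj1 sa) cb.
Qed.
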